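(* Let $f \in W^{1,1}(\mathbb{R}^n) \cap W^{1,\infty}(\mathbb{R}^n)$ be nonzero. Then the following hold. (i) For any fixed $s \in (0,1)$, $\lim_{p\to\infty} |\Pi^{\ast,s}_p f| = |\Pi^{\ast,s}_\infty f|$. (ii) $\lim_{p\to\infty} |\Pi^{\ast}_p f| = |\Pi^{\ast}_\infty f|$. (iii) $\lim_{s\to 1^-} |\Pi^{\ast,s}_\infty f| = |\Pi^{\ast}_\infty f|$.
   Context: Functions are real valued; $|\cdot|$ is the Euclidean norm on $\mathbb{R}^n$ and, for a measurable set, its Lebesgue measure. $W^{1,p}(\mathbb{R}^n)=\{f\in L^p: |\nabla f|\in L^p\}$, $p\in[1,\infty]$; elements of $W^{1,\infty}(\mathbb{R}^n)$ are identified with their Lipschitz representatives. For a set $K\subset\mathbb{R}^n$ star-shaped with respect to the origin, the gauge function is $\|x\|_K=\inf\{\lambda>0: x\in\lambda K\}\in[0,\infty]$, and its volume is $|K|=\frac1n\int_{\mathbb{S}^{n-1}}\|\xi\|_K^{-n}\,d\xi$. The following sets star-shaped with respect to the origin are defined through their gauge functions (a set with prescribed gauge $\|\cdot\|$ being $\{\xi:\|\xi\|\le 1\}$), for $\xi\in\mathbb{R}^n$, $s\in(0,1)$, $p\in[1,\infty)$: - $s$-fractional $L^p$ polar projection body $\Pi^{\ast,s}_p f$: $\|\xi\|_{\Pi^{\ast,s}_p f}^{ps}=p(1-s)\int_0^\infty t^{-ps-1}\int_{\mathbb{R}^n}|f(x+t\xi)-f(x)|^p\,dx\,dt$; - $L^p$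 polar projection body $\Pi^{\ast}_p f$: $\|\xi\|_{\Pi^\ast_p f}^p=\int_{\mathbb{R}^n}|\langle\nabla f(x),\xi\rangle|^p\,dx$; - $s$-fractional $L^\infty$ polar projection body $\Pi^{\ast,s}_\infty f$: $\|\xi\|_{\Pi^{\ast,s}_\infty f}^{s}=\sup_{(x,t)\in\mathbb{R}^n\times(0,\infty)}t^{-s}|f(x+t\xi)-f(x)|$; - $L^\infty$ polar projection body $\Pi^{\ast}_\infty f$: $\|\xi\|_{\Pi^\ast_\infty f}=\operatorname{ess\,sup}_{x\in\mathbb{R}^n}|\langle\nabla f(x),\xi\rangle|$. *)

(* Defs.v *)
From HB Require Import structures.
From mathcomp Require Import all_boot all_order all_algebra.
From mathcomp Require Import all_classical all_reals all_analysis.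
From mathcomp Require Import measurable_realfun ess_sup_inf.

Set Implicit Arguments.
Unset Strict Implicit.
Unset Printing Implicit Defensive.

Import Order.TTheory GRing.Theory Num.Theory.
Import numFieldTopology.Exports numFieldNormedType.Exports.

Local Open Scope classical_set_scope.
Local Open Scope ring_scope.

(* R^n is the type 'rV[R]_n of row vectors. Its library norm `|x| is the sup
   norm, which is only used here for its topology; the Euclidean norm is
   [enorm] below. *)

(* The sigma-algebra on R^n is the product one, generated by the coordinates;
   it is the Borel sigma-algebra. *)
Section measurable_rV.
Context {R : realType} (n : nat).

Let coord (i : 'I_n) (x : 'rV[R]_n) : R := x ord0 i.

Let rV_set0 : g_sigma_preimage coord set0.
Proof. exact: sigma_algebra0. Qed.

Let rV_setC A : g_sigma_preimage coord A -> g_sigma_preimage coord (~` A).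
Proof. exact: sigma_algebraC. Qed.

Let rV_bigcup (F : (set 'rV[R]_n)^nat) :
  (forall i, g_sigma_preimage coord (F i)) ->
  g_sigma_preimage coord (\bigcup_i (F i)).
Proof. exact: sigma_algebra_bigcup. Qed.

HB.instance Definition _ := @isMeasurable.Build default_measure_display
  'rV[R]_n (g_sigma_preimage coord) rV_set0 rV_setC rV_bigcup.

Lemma measurable_coord (i : 'I_n) :
  measurable_fun [set: 'rV[R]_n] (fun x : 'rV[R]_n => x ord0 i).
Proof.
move=> _ Y mY; rewrite setTI; apply: sub_sigma_algebra => /=.
rewrite -bigcup_seq/=; exists i => /=; first by rewrite mem_index_enum.
by exists Y => //; rewrite setTI.
Qed.

Lemma measurable_fun_rVP d (T : measurableType d) (f : T -> 'rV[R]_n) :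
  measurable_fun [set: T] f <->
  forall i, measurable_fun [set: T] (fun x => f x ord0 i).
Proof.
split=> [mf i|mf].
  exact: (measurableT_comp (measurable_coord i) mf).
have : g_sigma_preimage (fun i => coord i \o f) `<=` measurable.
  apply: smallest_sub; first exact: sigma_algebra_measurable.
  rewrite -bigcup_seq/=; apply: bigcup_sub => i _.
  by move=> A [B mB <-]; exact: mf.
rewrite g_sigma_preimage_comp => prefS _ A mA.
by apply: prefS; exists A.
Qed.

End measurable_rV.

Section lebesgue_measure_rV.
Context {R : realType}.

Definition consv n (z : measurableTypeR R * 'rV[R]_n) : 'rV[R]_n.+1 :=
  \row_i oapp (z.2 ord0) z.1 (unlift ord0 i).

Definition unconsv n (x : 'rV[R]_n.+1) : measurableTypeR R * 'rV[R]_n :=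
  (x ord0 ord0, \row_i x ord0 (lift ord0 i)).

Lemma consvK n : cancel (@consv n) (@unconsv n).
Proof.
move=> [a v]; rewrite /unconsv /consv mxE unlift_none; congr pair.
by apply/rowP => i; rewrite !mxE liftK.
Qed.

Lemma measurable_consv n : measurable_fun setT (@consv n).
Proof.
apply/measurable_fun_rVP => i; rewrite /consv.
under eq_fun do rewrite mxE.
case: (unliftP ord0 i) => [j _|_] /=.
- exact: (measurableT_comp (measurable_coord j) measurable_snd).
- exact: measurable_fst.
Qed.

Lemma measurable_unconsv n : measurable_fun setT (@unconsv n).
Proof.
apply: measurable_fun_pair.
  exact: measurable_coord.
apply/measurable_fun_rVP => i; rewrite /comp /=.
under eq_fun do rewrite mxE.
exact: measurable_coord.
Qed.

Section step.
Variables (n : nat) (mu : {sigma_finite_measure set 'rV[R]_n -> \bar R}).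

Definition lebesgue_step : set 'rV[R]_n.+1 -> \bar R :=
  pushforward (@lebesgue_measure R \x mu)%E (@consv n).

Let m : {measure set 'rV[R]_n.+1 -> \bar R} :=
  measure_function_pushforward__canonical__measure_function_Measure
    (@lebesgue_measure R \x mu)%E (@measurable_consv n).

Let step0 : lebesgue_step set0 = 0%E.
Proof. exact: (measure0 m). Qed.

Let step_ge0 A : (0 <= lebesgue_step A)%E.
Proof. exact: (measure_ge0 m). Qed.

Let step_sigma_additive : semi_sigma_additive lebesgue_step.
Proof. exact: (@measure_semi_sigma_additive _ _ _ m). Qed.

HB.instance Definition _ := isMeasure.Build _ _ _ lebesgue_step
  step0 step_ge0 step_sigma_additive.

Let lebesgue_step_sigma_finite : sigma_finite setT lebesgue_step.
Proof.
have /sigma_finiteP[F [TF ndF Foo]] := sigma_finiteT (@lebesgue_measure R).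
have /sigma_finiteP[G [TG ndG Goo]] := sigma_finiteT mu.
exists (fun k => @unconsv n @^-1` (F k `*` G k)).
  rewrite -preimage_bigcup (_ : \bigcup_k _ = setT) ?preimage_setT//.
  apply/seteqP; split => // -[a v] _.
  have [i _ Fi] : (\bigcup_k F k) a by rewrite -TF.
  have [j _ Gj] : (\bigcup_k G k) v by rewrite -TG.
  exists (maxn i j) => //; split => /=.
    by move: a Fi; exact/subsetPset/ndF/leq_maxl.
  by move: v Gj; exact/subsetPset/ndG/leq_maxr.
move=> k; have [? ?] := Foo k; have [? ?] := Goo k; split.
  rewrite -[X in measurable X]setTI; apply: measurable_unconsv => //.
  exact: measurableX.
rewrite /lebesgue_step /pushforward -comp_preimage.
rewrite (_ : _ \o _ = id); last by apply/funext => z /=; rewrite consvK.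
by rewrite preimage_id product_measure1E// lte_mul_pinfty// ge0_fin_numE.
Qed.

HB.instance Definition _ :=
  Measure_isSigmaFinite.Build _ _ _ lebesgue_step lebesgue_step_sigma_finite.

End step.

(* Lebesgue measure on R^n, as the n-fold product of Lebesgue measure on R. *)
Fixpoint lebesgue_rV (n : nat) : {sigma_finite_measure set 'rV[R]_n -> \bar R} :=
  match n with
  | 0 => [the {sigma_finite_measure set _ -> \bar R} of dirac (0 : 'rV[R]_0)]
  | n'.+1 => [the {sigma_finite_measure set _ -> \bar R} of
               lebesgue_step (lebesgue_rV n')]
  end.

End lebesgue_measure_rV.

Section euclidean.
Context {R : realType} {n : nat}.
Implicit Types x y : 'rV[R]_n.

Definition dotv x y : R := \sum_(i < n) x ord0 i * y ord0 i.

Definition enorm x : R := Num.sqrt (dotv x x).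

Definition esphere : set 'rV[R]_n := [set x | enorm x = 1].

Definition punctured_ball : set 'rV[R]_n := [set x | 0 < enorm x <= 1].

Definition normalizev x : 'rV[R]_n := (enorm x)^-1 *: x.

Lemma measurable_enorm :
  measurable_fun setT (enorm : 'rV[R]_n -> R).
Proof.
have dotv_ge0 x : 0 <= dotv x x by apply: sumr_ge0 => i _; rewrite -expr2 sqr_ge0.
rewrite (_ : enorm = fun x => dotv x x `^ 2^-1); last first.
  by apply/funext => x; rewrite powR12_sqrt.
apply: (@measurableT_comp _ _ _ _ _ _ (fun r : R => r `^ 2^-1)).
  exact: measurable_powR.
apply: measurable_sum => i; apply: measurable_funM; exact: measurable_coord.
Qed.

Lemma measurable_punctured_ball : measurable punctured_ball.
Proof.
rewrite (_ : punctured_ball = setT `&` enorm @^-1` `]0, 1]).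
  by apply: measurable_enorm => //; exact: measurable_itv.
by rewrite setTI; apply/seteqP; split => x /=; rewrite in_itv.
Qed.

Lemma measurable_normalizev : measurable_fun setT normalizev.
Proof.
apply/measurable_fun_rVP => i; rewrite /normalizev.
rewrite (_ : (fun x => _) = fun x : 'rV[R]_n => enorm x `^ (-1) * x ord0 i).
  apply: measurable_funM; last exact: measurable_coord.
  apply: (@measurableT_comp _ _ _ _ _ _ (fun r : R => r `^ (-1))).
    exact: measurable_powR.
  exact: measurable_enorm.
by apply/funext => x; rewrite mxE powR_inv1// sqrtr_ge0.
Qed.

(* Surface measure on the unit sphere, seen as a measure on R^n:
   sigma(A) = n |{x : 0 < |x| <= 1, x / |x| \in A}|. It is the unique measure
   for which integration in polar coordinates holds. *)
Definition sphere_measure (A : set 'rV[R]_n) : \bar R :=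
  (n%:R%:E * lebesgue_rV n (punctured_ball `&` normalizev @^-1` A))%E.

Let sphere_measure0 : sphere_measure set0 = 0%E.
Proof. by rewrite /sphere_measure preimage_set0 setI0 measure0 mule0. Qed.

Let sphere_measure_ge0 A : (0 <= sphere_measure A)%E.
Proof. by rewrite /sphere_measure mule_ge0// lee_fin ler0n. Qed.

Let sphere_measure_sigma_additive : semi_sigma_additive sphere_measure.
Proof.
have nge0 : 0 <= n%:R :> R by exact: ler0n.
have := @measure_semi_sigma_additive _ _ _ (mscale (NngNum nge0)
  (measure_function_pushforward__canonical__measure_function_Measure
    (mrestr (lebesgue_rV n) measurable_punctured_ball)
    measurable_normalizev)).
congr semi_sigma_additive; apply/funext => A.
by rewrite /sphere_measure setIC.
Qed.

HB.instance Definition _ := isMeasure.Build _ _ _ sphere_measure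
  sphere_measure0 sphere_measure_ge0 sphere_measure_sigma_additive.

End euclidean.

Section sobolev.
Context {R : realType} {n : nat}.
Implicit Types (f phi : 'rV[R]_n -> R) (G : 'rV[R]_n -> 'rV[R]_n).

Definition partial (i : 'I_n) phi : 'rV[R]_n -> R :=
  'D_(delta_mx ord0 i) phi.

Definition iter_partial (s : seq 'I_n) phi : 'rV[R]_n -> R := foldr partial phi s.

(* C^oo: all iterated partial derivatives exist and are continuous. *)
Definition smooth phi :=
  forall s : seq 'I_n,
    continuous (iter_partial s phi) /\
    forall i x, derivable (iter_partial s phi) x (delta_mx ord0 i).

Definition test_function phi :=
  smooth phi /\ compact (closure [set x | phi x != 0]).

Definition locally_integrable_rV f :=
  forall K : set 'rV[R]_n, compact K ->
    (lebesgue_rV n).-integrable K (EFin \o f).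

Definition is_weak_gradient f G :=
  (forall i, locally_integrable_rV (fun x => G x ord0 i)) /\
  forall phi, test_function phi -> forall i,
    (\int[lebesgue_rV n]_x (f x * partial i phi x)%:E =
     - \int[lebesgue_rV n]_x (G x ord0 i * phi x)%:E)%E.

(* A representative of the a.e. class of the weak gradient of f (0 if f has
   no weak gradient). *)
Definition weak_gradient f : 'rV[R]_n -> 'rV[R]_n :=
  xget (cst 0) [set G | is_weak_gradient f G].

Definition W1 (p : \bar R) f :=
  [/\ f \in Lfun (lebesgue_rV n) p,
      exists G, is_weak_gradient f G
    & (fun x => enorm (weak_gradient f x)) \in Lfun (lebesgue_rV n) p].

Definition euclidean_lipschitz f :=
  exists L : R, forall x y, `|f x - f y| <= L * enorm (x - y).

End sobolev.

Section star_bodies.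
Context {R : realType} {n : nat}.
Implicit Types (K : set 'rV[R]_n) (f : 'rV[R]_n -> R) (xi : 'rV[R]_n).
Local Open Scope ereal_scope.

(* The infimum of the empty set is +oo. *)
Definition gauge K (x : 'rV[R]_n) : \bar R :=
  ereal_inf [set lambda%:E | lambda in
    [set lambda : R | (0 < lambda)%R /\ [set (lambda *: y)%R | y in K] x]].

(* The integrand uses the conventions 0^-1 = +oo and +oo^-1 = 0 of \bar R. *)
Definition volume K : \bar R :=
  (n%:R^-1)%:E * \int[sphere_measure]_(xi in esphere) (gauge K xi ^+ n)^-1.

Definition gauge_body (g : 'rV[R]_n -> \bar R) : set 'rV[R]_n :=
  [set xi | g xi <= 1].

Definition frac_polar_gauge (s p : R) f xi : \bar R :=
  ((p * (1 - s))%:E *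
   \int[lebesgue_measure]_(t in `]0%R, +oo[)
     ((t `^ (- (p * s) - 1))%:E *
      \int[lebesgue_rV n]_x (`|f (x + t *: xi)%R - f x| `^ p)%:E))
  `^ (p * s)^-1.

Definition polar_gauge (p : R) f xi : \bar R :=
  (\int[lebesgue_rV n]_x (`|dotv (weak_gradient f x) xi| `^ p)%:E) `^ p^-1.

Definition frac_polar_gauge_oo (s : R) f xi : \bar R :=
  (ereal_sup [set (z.2 `^ (- s) * `|f (z.1 + z.2 *: xi) - f z.1|)%:E
             | z in [set z : 'rV[R]_n * R | (0 < z.2)%R]])
  `^ s^-1.

Definition polar_gauge_oo f xi : \bar R :=
  ess_sup (lebesgue_rV n) (fun x => `|dotv (weak_gradient f x) xi|%:E).

Definition frac_polar_body s p f := gauge_body (frac_polar_gauge s p f).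
Definition polar_body p f := gauge_body (polar_gauge p f).
Definition frac_polar_body_oo s f := gauge_body (frac_polar_gauge_oo s f).
Definition polar_body_oo f := gauge_body (polar_gauge_oo f).

End star_bodies.

(* Main.v *)
(* For a direction xi write D_t f(x) = f(x + t xi) - f(x). If phi is a product
   of one-dimensional bumps, the derivative of t |-> int f phi(. - t xi) is
   int <grad f, xi> phi(. - t xi). Taking phi concentrated near a point gives
   |D_t f| <= t ess sup |<grad f, xi>|; conversely, difference quotients of f
   converge weakly to <grad f, xi>, so that a bound |D_t f| <= D t valid
   everywhere forces |<grad f, xi>| <= D almost everywhere. Hence the
   L^oo gauge at xi is the best Lipschitz constant of f in direction xi.

   The gauges converge pointwise. In (i) and (ii) they are p-th roots of an
   integral I(p) with I(p) <= K^(p - p0) I(p0) and, for each a < K,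
   I(p) >= a^p m with m > 0, where K is the supremum that defines the limit.
   In (iii), f is bounded, so large t do not contribute in the limit to
   sup_t t^-s |D_t f|.

   Being Lipschitz and integrable, f vanishes at infinity, so |D_t f| >= a > 0
   on a fixed cube for all unit xi and all t >= T. This bounds all the gauges
   away from 0 on the sphere, and the volumes converge by dominated
   convergence. *)
Require Import Defs.
From mathcomp Require Import all_boot all_order all_algebra.
From mathcomp Require Import all_classical all_reals all_analysis.
From mathcomp Require Import measurable_realfun ess_sup_inf ring lra.
Set Implicit Arguments.
Unset Strict Implicit.
Unset Printing Implicit Defensive.
Import Order.TTheory GRing.Theory Num.Theory.
Import numFieldTopology.Exports numFieldNormedType.Exports.
Local Open Scope classical_set_scope.
Local Open Scope ring_scope.

(** * Lebesgue measure of boxes and translates *)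

(** The weak gradient is an arbitrary representative of an a.e. class, visible only through
    integrals against test functions. Turning such integrals into an almost everywhere bound is the
    delicate step: bumps approximate indicators of open boxes, and a lambda-system argument reaches
    all measurable sets. The volume integrates inverse powers of the gauge, so domination needs a
    positive lower bound uniform in the direction and in the parameter. The gauges of finite order
    are integrals, hence the estimate at large t has to hold on a whole cube rather than at a point.
    At fixed s the fractional energy is shown to be finite once p(1-s) >= 2 and ps >= 1, so the
    growth in p is measured from a base exponent p0 satisfying both. The normalizing factor p(1-s)
    disappears in the limit because its logarithm is o(p). *)

Section affine_lebesgue.
Context {R : realType}.
Local Notation leb := (@lebesgue_measure R).

Definition affine (a b : R) (x : measurableTypeR R) : measurableTypeR R :=
  a * x + b.

Lemma measurable_affine a b : measurable_fun setT (affine a b).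
Proof. by apply: measurable_funD => //; exact: measurable_funM. Qed.

(** Both sides are measures in A that agree on half-open intervals, so uniqueness of Lebesgue
    measure applies. The case a = 1 serves translations in R^n; the integral version below, with b =
    0, serves the dilation of the time variable in [frac_energy_scale]. *)
Lemma lebesgue_measure_affine (a b : R) (A : set R) : 0 < a -> measurable A ->
  leb A = (a%:E * leb [set x | A (a * x + b)%R])%E.
Proof.
move=> a0 mA.
pose m := mscale (NngNum (ltW a0))
  (measure_function_pushforward__canonical__measure_function_Measure
     leb (measurable_affine a b)).
suff: leb A = m A by [].
apply: lebesgue_measure_unique => // _ [[c d]] _ <-.
rewrite /m /=.
rewrite /mscale /= /pushforward.
have -> : affine a b @^-1` `]c, d] = `](c - b) / a, (d - b) / a]%classic.
  apply/seteqP; split => x /=; rewrite /affine !in_itv/=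
    ltr_pdivrMr// ler_pdivlMr// ltrBlDr lerBrDr mulrC//.
rewrite !lebesgue_measure_itv/= !lte_fin ltr_pM2r ?invr_gt0// ltrD2r.
case: ifPn => _; last by rewrite mule0.
by rewrite -!EFinD -EFinM; congr EFin; field; rewrite gt_eqF.
Qed.

Lemma ge0_integral_affine (a b : R) (D : set R) (f : R -> \bar R) : 0 < a ->
  measurable D -> measurable_fun D f -> (forall x, 0 <= f x)%E ->
  (\int[leb]_(x in D) f x =
   a%:E * \int[leb]_(x in [set x | D (a * x + b)%R]) f (a * x + b)%R)%E.
Proof.
move=> a0 mD mf f0.
pose pf := (measure_function_pushforward__canonical__measure_function_Measure
     leb (measurable_affine a b)).
pose m := mscale (NngNum (ltW a0)) pf.
transitivity (\int[m]_(x in D) f x)%E.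
  apply: eq_measure_integral => A mA _.
  exact: (lebesgue_measure_affine b a0 mA).
rewrite ge0_integral_mscale//=; congr (_ * _)%E.
rewrite ge0_integral_pushforward//; first exact: measurable_affine.
Qed.

End affine_lebesgue.

Section lebesgue_rV_theory.
Context {R : realType}.
Local Notation leb := (@lebesgue_measure R).

Definition box n (I : 'I_n -> set R) : set 'rV[R]_n :=
  [set x | forall i, I i (x ord0 i)].

Lemma measurable_box n (I : 'I_n -> set R) :
  (forall i, measurable (I i)) -> measurable (box I).
Proof.
move=> mI; rewrite (_ : box I = \bigcap_(i in [set` 'I_n]) ((fun x : 'rV[R]_n => x ord0 i) @^-1` I i)).
  apply: fin_bigcap_measurable => // i _.
  by rewrite -[X in measurable X]setTI; exact: measurable_coord.
by apply/seteqP; split => x /= h i; [move=> _|]; exact: h.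
Qed.

Lemma lebesgue_rV_box n (I : 'I_n -> set R) : (forall i, measurable (I i)) ->
  lebesgue_rV n (box I) = (\prod_(i < n) leb (I i))%E.
Proof.
elim: n I => [|n IH] I mI.
  rewrite big_ord0 /= diracE mem_set//= => -[].
  by [].
rewrite big_ord_recl -IH// -product_measure1E//; last exact: measurable_box.
rewrite /= /lebesgue_step /pushforward; congr ((_ \x _)%E _).
apply/seteqP; split => -[a v] /=.
  move=> h; split.
    by have := h ord0; rewrite /consv mxE unlift_none.
  by move=> i; have := h (lift ord0 i); rewrite /consv mxE liftK.
move=> [h1 h2] i; rewrite /consv mxE /=.
by case: unliftP => [j ->|->].
exact: mI.
Qed.

(** Induction on the dimension: through [consv] a translation acts separately on the first
    coordinate and on the rest, and uniqueness of the product measure reduces the claim to product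
    sets. *)
Lemma lebesgue_rV_shift n (v : 'rV[R]_n) (A : set 'rV[R]_n) : measurable A ->
  lebesgue_rV n [set x | A (x + v)] = lebesgue_rV n A.
Proof.
elim: n v A => [|n IH] v A mA.
  by congr (_ _); apply/seteqP; split => x; rewrite /= (_ : x + v = x)//;
    apply/rowP => -[].
rewrite /= /lebesgue_step /pushforward.
pose sh (z : measurableTypeR R * 'rV[R]_n) : measurableTypeR R * 'rV[R]_n :=
  (z.1 + v ord0 ord0, z.2 + \row_i v ord0 (lift ord0 i)).
have msh : measurable_fun setT sh.
  apply: measurable_fun_pair; first exact: measurable_funD.
  apply/measurable_fun_rVP => i /=.
  under eq_fun do rewrite mxE.
  apply: measurable_funD => //.
  exact: (measurableT_comp (measurable_coord i) measurable_snd).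
pose m' := (measure_function_pushforward__canonical__measure_function_Measure
     (leb \x lebesgue_rV n)%E msh).
have mA' : measurable (@consv R n @^-1` A).
  by rewrite -[X in measurable X]setTI; exact: measurable_consv.
rewrite [RHS](_ : _ = m' (@consv R n @^-1` A)).
  congr ((_ \x _)%E _); apply/seteqP; split => -[a w] /=;
    (rewrite (_ : consv _ + v = consv (sh (a, w)))//;
     apply/rowP => i; rewrite /consv /sh !mxE/=;
     case: unliftP => [j ->|->]//=; by rewrite !mxE).
apply: product_measure_unique => // B C mB mC.
rewrite /m' /= /pushforward.
rewrite (_ : sh @^-1` (B `*` C) =
  [set x | B (1 * x + v ord0 ord0)] `*` [set x | C (x + \row_i v ord0 (lift ord0 i))]); last first.
  by apply/seteqP; split => -[a w]/=; rewrite mul1r.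
rewrite product_measure1E.
- by rewrite IH// (lebesgue_measure_affine (v ord0 ord0) ltr01 mB) mul1e.
- by rewrite -[X in measurable X]setTI; exact: (measurable_affine 1 (v ord0 ord0)).
- rewrite -[X in measurable X]setTI.
  have h : measurable_fun setT (fun x : 'rV[R]_n => x + \row_i v ord0 (lift ord0 i)).
    apply/measurable_fun_rVP => i /=.
    under eq_fun do rewrite mxE.
    by apply: measurable_funD => //; exact: measurable_coord.
  exact: h.
Qed.

Lemma measurable_addv n (v : 'rV[R]_n) : measurable_fun setT (fun x : 'rV[R]_n => x + v).
Proof.
apply/measurable_fun_rVP => i /=.
under eq_fun do rewrite mxE.
by apply: measurable_funD => //; exact: measurable_coord.
Qed.

Lemma ge0_integral_shift n (v : 'rV[R]_n) (f : 'rV[R]_n -> \bar R) :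
  measurable_fun setT f -> (forall x, 0 <= f x)%E ->
  (\int[lebesgue_rV n]_x f (x + v)%R = \int[lebesgue_rV n]_x f x)%E.
Proof.
move=> mf f0.
have := @ge0_integral_pushforward _ _ _ _ _ _ (measurable_addv v) (lebesgue_rV n) setT f measurableT mf (fun _ _ => f0 _).
rewrite preimage_setT => <-.
pose pf := measure_function_pushforward__canonical__measure_function_Measure
  (lebesgue_rV n) (measurable_addv v).
apply: (@eq_measure_integral _ _ _ _ (lebesgue_rV n) pf) => A mA _.
exact: (lebesgue_rV_shift v mA).
Qed.

Lemma integral_shift n (v : 'rV[R]_n) (f : 'rV[R]_n -> \bar R) :
  measurable_fun setT f ->
  (\int[lebesgue_rV n]_x f (x + v)%R = \int[lebesgue_rV n]_x f x)%E.
Proof.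
move=> mf; rewrite integralE [RHS]integralE; congr (_ - _)%E.
- rewrite -(ge0_integral_shift v (measurable_funepos mf) (funepos_ge0 _)).
  by apply: eq_integral => x _; rewrite !funeposE.
- rewrite -(ge0_integral_shift v (measurable_funeneg mf) (funeneg_ge0 _)).
  by apply: eq_integral => x _; rewrite !funenegE.
Qed.

End lebesgue_rV_theory.

(** * Smooth bumps *)

Section flat_exponential.
Context {R : realType}.
Implicit Types (P Q : {poly R}) (x y : R).

(* The flat functions P(1/x) exp(-1/x), extended by 0 to x <= 0: this class is
   closed under differentiation. *)
Definition flatexp P x : R := if 0 < x then P.[x^-1] * expR (- x^-1) else 0.

(** y^k / k! is one term of the exponential series. *)
Lemma exprn_expRN_le k y : 0 <= y -> y ^+ k * expR (- y) <= k`!%:R.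
Proof.
move=> y0; rewrite expRN ler_pdivrMr ?expR_gt0//.
have e1 : 1 <= expR y by rewrite -expR0 ler_expR.
case: k => [|k]; first by rewrite expr0 fact0 mul1r.
rewrite mulrC -ler_pdivrMr ?ltr0n ?fact_gt0// (le_trans _ (expR_ge1Dxn k y0))//.
by rewrite lerDr.
Qed.

Lemma horner_expRN_bounded P k : exists C : R, 0 <= C /\
  forall y, 0 <= y -> y ^+ k * `|P.[y] * expR (- y)| <= C.
Proof.
exists (\sum_(i < size P) `|P`_i| * (k + i)`!%:R); split.
  by apply: sumr_ge0 => i _; rewrite mulr_ge0.
move=> y y0; rewrite normrM (ger0_norm (expR_ge0 _)) mulrA.
rewrite (@le_trans _ _ (\sum_(i < size P) `|P`_i| * (y ^+ (k + i) * expR (- y))))//; last first.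
  by apply: ler_sum => i _; rewrite ler_wpM2l// exprn_expRN_le.
under eq_bigr do rewrite mulrA.
rewrite -mulr_suml ler_wpM2r ?expR_ge0//.
under eq_bigr do rewrite exprD mulrCA.
rewrite -mulr_sumr ler_wpM2l ?exprn_ge0// horner_coef.
rewrite (le_trans (ler_norm_sum _ _ _))// ler_sum// => i _.
by rewrite normrM (ger0_norm (exprn_ge0 _ y0)).
Qed.

Lemma flatexp_bounded P : exists C : R, forall x, `|flatexp P x| <= C.
Proof.
have [C [C0 hC]] := horner_expRN_bounded P 0; exists C => x; rewrite /flatexp.
case: ifPn => x0; last by rewrite normr0.
by have := hC _ (ltW (divr_gt0 ltr01 x0)); rewrite expr0 !mul1r.
Qed.

(** With y = 1/x, this is the boundedness of y^2 P(y) exp(-y). A quadratic bound is exactly what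
    differentiability at 0 requires. *)
Lemma flatexp_le_sqr P : exists C : R, 0 <= C /\
  forall x, `|flatexp P x| <= C * x ^+ 2.
Proof.
have [C [C0 hC]] := horner_expRN_bounded P 2; exists C; split=> // x.
rewrite /flatexp.
case: ifPn => x0; last by rewrite normr0 mulr_ge0// sqr_ge0.
have := hC _ (ltW (divr_gt0 ltr01 x0)); rewrite !mul1r mulrC exprVn.
by rewrite ler_pdivrMr// exprn_gt0.
Qed.

Lemma flatexp_ge0 x : 0 <= flatexp 1 x.
Proof. by rewrite /flatexp; case: ifPn => // _; rewrite hornerC mul1r expR_ge0. Qed.

Lemma flatexp_gt0 x : 0 < x -> 0 < flatexp 1 x.
Proof. by rewrite /flatexp => ->; rewrite hornerC mul1r expR_gt0. Qed.

Lemma flatexp_le1 x : flatexp 1 x <= 1.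
Proof.
rewrite /flatexp; case: ifPn => // x0; rewrite hornerC mul1r -expR0 ler_expR.
by rewrite oppr_le0 invr_ge0 ltW.
Qed.

Lemma flatexp_le0 P x : x <= 0 -> flatexp P x = 0.
Proof. by rewrite /flatexp leNgt => /negbTE ->. Qed.

Lemma flatexpZ c P x : flatexp (c *: P) x = c * flatexp P x.
Proof. by rewrite /flatexp; case: ifPn => _; rewrite ?mulr0// hornerZ mulrA. Qed.

(** For x > 0 the chain rule gives x^-2 (P - P')(1/x) exp(-1/x), which is the flat function of the
    polynomial X^2 (P - P'). *)
Lemma is_derive_flatexp P x :
  is_derive x 1 (flatexp P) (flatexp ('X^2 * (P - P^`())) x).
Proof.
have [x0|x0|->] := ltgtP x 0.
- rewrite (flatexp_le0 _ (ltW x0)).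
  apply: near_eq_is_derive (is_derive_cst (0 : R) x 1).
  near=> y; rewrite flatexp_le0//=; near: y; exact: lt_le_nbhsl.
- rewrite {2}/flatexp x0.
  have xn0 : x != 0 by rewrite gt_eqF.
  have dV : is_derive x 1 (fun y => y^-1) (- x^-2 * 1).
    exact: (@is_deriveV _ id x 1 1 xn0 (is_derive_id x 1)).
  have dN : is_derive x 1 (fun y => - y^-1) (x^-2).
    by apply: is_derive_eq; rewrite mulr1 opprK.
  have dP := @is_derive1_comp _ (horner P) (fun y => y^-1) x _ _ (is_derive_poly _ _) dV.
  have dE := @is_derive1_comp _ expR (fun y => - y^-1) x _ _ (is_derive_expR _) dN.
  have := is_deriveM dP dE.
  have -> : ((horner P \o (fun y => y^-1)) x *: (expR (- x^-1) * x^-2) +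
      (expR \o (fun y => - y^-1)) x *: (P^`().[x^-1] * (- x^-2 * 1)) =
      ('X^2 * (P - P^`())).[x^-1] * expR (- x^-1)).
    rewrite /= /GRing.scale hornerM hornerXn hornerD hornerN.
    set e := expR _; set p := P.[_]; set q := _.[_].
    by rewrite [*%R]lock /= -lock; field.
  apply: near_eq_is_derive.
  by near=> y; rewrite /flatexp ifT//; near: y; exact: lt_nbhsr.
(* At 0 the quadratic bound makes the difference quotient at most C |h|. *)
- rewrite flatexp_le0//.
  have [C [C0 hC]] := flatexp_le_sqr P.
  suff h : (fun h => h^-1 *: (flatexp P (h *: 1 + 0) - flatexp P 0)) @ 0^' --> (0:R).
    by apply: DeriveDef; [apply/cvg_ex; exists 0|exact/cvg_lim].
  apply/cvgrPdist_le => /= e e0; near=> h.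
  have h0 : h != 0 by near: h; exact: nbhs_dnbhs_neq.
  rewrite sub0r normrN normrM (flatexp_le0 P (lexx 0)) subr0 addr0 normfV.
  rewrite ler_pdivrMl ?normr_gt0// /GRing.scale/= mulr1.
  rewrite (le_trans (hC h))// -real_normK ?num_real// expr2 mulrA mulrC.
  rewrite ler_wpM2l// (@le_trans _ _ ((C + 1) * `|h|))// ?ler_wpM2r ?lerDl//.
  rewrite mulrC -ler_pdivlMr ?ltr_wpDl//.
  near: h; apply: dnbhs0_le; rewrite divr_gt0// ltr_wpDl//.
Unshelve. all: by end_near. Qed.

End flat_exponential.

Section bump.
Context {R : realType}.

(* A class of compactly supported functions closed under differentiation, which
   makes smoothness of their products provable without iterated Leibniz rules. *)
Inductive bump : (R -> R) -> Prop :=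
| bump_base a b j P Q : 0 < j ->
    bump (fun x => flatexp P (j * (x - a)) * flatexp Q (j * (b - x)))
| bump_add u v : bump u -> bump v -> bump (fun x => u x + v x).

Lemma bump_support u : bump u -> exists M, forall x, M < `|x| -> u x = 0.
Proof.
elim=> [a b j P Q j0|{}u v _ [M1 h1] _ [M2 h2]]; last first.
  by exists (Num.max M1 M2) => x; rewrite gt_max => /andP[? ?]; rewrite h1// h2// addr0.
exists (Num.max `|a| `|b|) => x; rewrite gt_max => /andP[xa xb].
have [x0|x0] := leP 0 x.
  rewrite (flatexp_le0 Q) ?mulr0// pmulr_rle0// subr_le0.
  by rewrite (ger0_norm x0) in xb; exact: le_trans (ler_norm b) (ltW xb).
rewrite (flatexp_le0 P) ?mul0r// pmulr_rle0// subr_le0.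
rewrite (ltr0_norm x0) in xa.
by rewrite -lerN2; apply: le_trans (ler_norm (- a)) _; rewrite normrN ltW.
Qed.

Lemma bump_bounded u : bump u -> exists C, forall x, `|u x| <= C.
Proof.
elim=> [a b j P Q j0|{}u v _ [M1 h1] _ [M2 h2]]; last first.
  by exists (M1 + M2) => x; rewrite (le_trans (ler_normD _ _))// lerD.
have [C hC] := flatexp_bounded P; have [D hD] := flatexp_bounded Q.
by exists (C * D) => x; rewrite normrM ler_pM.
Qed.

Lemma bump_shift u c : bump u -> bump (fun x => u (x - c)).
Proof.
elim=> [a b j P Q j0|{}u v _ h1 _ h2]; last exact: bump_add h1 h2.
have := @bump_base (a + c) (b + c) j P Q j0; congr bump; apply/funext => x.
by congr (flatexp _ (_ * _) * flatexp _ (_ * _)); ring.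
Qed.

(** Leibniz' rule turns a product of two flat factors into a sum of two such products, which is why
    the class contains sums; the inner derivatives j and -j are absorbed into the polynomials. *)
Lemma bump_derive u : bump u ->
  exists2 v, bump v & forall x : R, is_derive x 1 u (v x).
Proof.
elim=> [a b j P Q j0|{}u v _ [u' bu' hu] _ [v' bv' hv]]; last first.
  exists (fun x => u' x + v' x); first exact: bump_add.
  by move=> x; exact: is_deriveD.
pose D (P : {poly R}) := 'X^2 * (P - P^`()).
eexists.
  exact: (bump_add (bump_base a b (j *: D P) Q j0) (bump_base a b P (- j *: D Q) j0)).
move=> x /=.
have d1 : is_derive x 1 (fun x => j * (x - a)) j.
  have := is_deriveZ j (is_deriveB (is_derive_id x 1) (is_derive_cst a x 1)).
  by rewrite /GRing.scale/= subr0 mulr1.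
have d2 : is_derive x 1 (fun x => j * (b - x)) (- j).
  have := is_deriveZ j (is_deriveB (is_derive_cst b x 1) (is_derive_id x 1)).
  by rewrite /GRing.scale/= sub0r mulrN mulr1.
have e1 := @is_derive1_comp _ (flatexp P) (fun x => j * (x - a)) x _ _ (is_derive_flatexp _ _) d1.
have e2 := @is_derive1_comp _ (flatexp Q) (fun x => j * (b - x)) x _ _ (is_derive_flatexp _ _) d2.
have := is_deriveM e1 e2; rewrite !flatexpZ /GRing.scale/=.
set A := (X in is_derive _ _ _ X); set B := (X in _ -> is_derive _ _ _ X).
suff -> : A = B by [].
by rewrite /A /B /D; ring.
Qed.

Lemma bump_continuous u : bump u -> continuous u.
Proof.
move=> /bump_derive[v _ h] x.
by apply: differentiable_continuous; apply/derivable1_diffP; have [] := h x.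
Qed.

End bump.

(** * Products of one-dimensional bumps as test functions *)

Section tensor.
Context {R : realType}.

Lemma is_derive_prod_ord n (g : 'I_n -> R -> R) (dg : 'I_n -> R) t :
  (forall i, is_derive (t : R) 1 (g i) (dg i)) ->
  is_derive (t : R) 1 (fun t : R => \prod_i g i t) (\sum_i dg i * \prod_(k | k != i) g k t).
Proof.
elim: n g dg => [|n IH] g dg h.
  under eq_fun do rewrite big_ord0.
  by rewrite big_ord0; exact: is_derive_cst.
under eq_fun do rewrite big_ord_recl.
have := is_deriveM (h ord0) (IH _ _ (fun i => h (lift ord0 i))).
set A := (X in is_derive _ _ _ X); set B := (X in _ -> is_derive _ _ _ X).
suff -> : A = B by [].
rewrite /A /B /GRing.scale/= big_ord_recl addrC; congr (_ + _).
  rewrite mulrC; congr (_ * _).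
  by rewrite [RHS]big_mkcond/= big_ord_recl/= mul1r.
rewrite mulr_sumr; apply: eq_bigr => i _.
rewrite mulrCA; congr (_ * _).
rewrite [RHS]big_mkcond/= big_ord_recl/=; congr (_ * _).
by rewrite big_mkcond/=; apply: eq_bigr => k _; rewrite (inj_eq lift_inj).
Qed.

Definition tensor n (u : 'I_n -> R -> R) (x : 'rV[R]_n) : R :=
  \prod_i u i (x ord0 i).

(* The i-th partial derivative of a tensor product replaces its i-th factor by
   the derivative of that factor. *)
Definition upd n (u : 'I_n -> R -> R) (i : 'I_n) (v : R -> R) :=
  fun k => if k == i then v else u k.

Lemma tensor_upd n (u : 'I_n -> R -> R) i v x :
  tensor (upd u i v) x = v (x ord0 i) * \prod_(k | k != i) u k (x ord0 k).
Proof.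
rewrite /tensor (bigD1 i)//= /upd eqxx; congr (_ * _).
by apply: eq_bigr => k /negbTE ->.
Qed.

Lemma is_derive_tensor n (u u' : 'I_n -> R -> R) (x xi : 'rV[R]_n) t :
  (forall i (x : R), is_derive x 1 (u i) (u' i x)) ->
  is_derive (t : R) 1 (fun t : R => tensor u (x + t *: xi))
    (\sum_i xi ord0 i * tensor (upd u i (u' i)) (x + t *: xi)).
Proof.
move=> h; rewrite /tensor.
have dl i : is_derive t 1 (fun t : R => (x + t *: xi) ord0 i) (xi ord0 i).
  have -> : (fun t : R => (x + t *: xi) ord0 i) = (fun t => x ord0 i + t * xi ord0 i).
    by apply/funext => s; rewrite !mxE.
  have := is_deriveD (is_derive_cst (x ord0 i) t 1) (is_deriveM (is_derive_id t 1) (is_derive_cst (xi ord0 i) t 1)).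
  by rewrite /GRing.scale/= add0r mulr0 add0r mulr1.
have := is_derive_prod_ord (fun i => @is_derive1_comp _ (u i) (fun t => (x + t *: xi) ord0 i) t _ _ (h i _) (dl i)).
set A := (X in is_derive _ _ _ X); set B := (X in _ -> is_derive _ _ _ X).
suff -> : A = B by [].
apply: eq_bigr => i _; rewrite -/(tensor _ _) tensor_upd mulrA; congr (_ * _).
by rewrite mulrC.
Qed.

Lemma is_derive_line n (f : 'rV[R]_n -> R) x v (df : R) :
  is_derive (0 : R) 1 (fun t : R => f (x + t *: v)) df -> is_derive x v f df.
Proof.
have E : (fun h : R => h^-1 *: (((fun t : R => f (x + t *: v)) \o shift 0) (h *: 1) - f (x + 0 *: v))) =
    (fun h : R => h^-1 *: ((f \o shift x) (h *: v) - f x)).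
  apply/funext => h /=; rewrite scale0r addr0 addr0 [_ *: 1]mulr1.
  by rewrite [x + _]addrC.
move=> [d1 d2]; split.
  by move: d1; rewrite /derivable E.
by move: d2; rewrite /derive E.
Qed.

Lemma tensor_continuous n (u : 'I_n -> R -> R) :
  (forall i, continuous (u i)) -> continuous (tensor u).
Proof.
move=> cu; suff h (r : seq 'I_n) : continuous (fun x : 'rV[R]_n => \prod_(i <- r) u i (x ord0 i)).
  exact: h.
elim: r => [|i r IH] x.
  rewrite (_ : (fun x => _) = cst (1 : R)); first exact: cst_continuous.
  by apply/funext => y; rewrite big_nil.
rewrite (_ : (fun x => _) = (fun x : 'rV[R]_n => u i (x ord0 i)) \* (fun x : 'rV[R]_n => \prod_(i <- r) u i (x ord0 i))); last first.
  by apply/funext => y; rewrite big_cons.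
apply: continuousM; last exact: IH.
apply: (@continuous_comp _ _ _ (fun x : 'rV[R]_n => x ord0 i) (u i)); last exact: cu.
exact: coord_continuous.
Qed.

Lemma bump_family_derive n (u : 'I_n -> R -> R) : (forall i, bump (u i)) ->
  exists u', (forall i, bump (u' i)) /\
    forall i (x : R), is_derive x 1 (u i) (u' i x).
Proof.
move=> bu.
have h i : exists v, bump v /\ forall x : R, is_derive x 1 (u i) (v x).
  by have [v ? ?] := bump_derive (bu i); exists v.
by have [u' hu'] := choice h; exists u'; split=> i; have [] := hu' i.
Qed.

Lemma partial_tensor n (u u' : 'I_n -> R -> R) i :
  (forall i (x : R), is_derive x 1 (u i) (u' i x)) ->
  partial i (tensor u) = tensor (upd u i (u' i)).
Proof.
move=> h; apply/funext => x; rewrite /partial.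
have := is_derive_line (@is_derive_tensor n u u' x (delta_mx ord0 i) 0 h).
case=> _ ->.
rewrite scale0r addr0 (bigD1 i)//= mxE !eqxx mul1r big1 ?addr0//.
by move=> k ki; rewrite mxE eqxx/= (negbTE ki) mul0r.
Qed.

(** Iterated partial derivatives stay within products of bumps, so smoothness reduces to continuity
    and first-order differentiability of such products. *)
Lemma iter_partial_tensor n (s : seq 'I_n) (u : 'I_n -> R -> R) :
  (forall i, bump (u i)) ->
  exists2 w, (forall i, bump (w i)) & iter_partial s (tensor u) = tensor w.
Proof.
move=> bu; elim: s => [|i s [w bw /= ->]]; first by exists u.
have [w' [bw' dw']] := bump_family_derive bw.
exists (upd w i (w' i)); last exact: partial_tensor.
by move=> k; rewrite /upd; case: eqP.
Qed.

Lemma tensor_test_function n (u : 'I_n -> R -> R) :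
  (forall i, bump (u i)) -> test_function (tensor u).
Proof.
move=> bu; split.
  move=> s; have [w bw ->] := iter_partial_tensor s bu; split.
    by apply: tensor_continuous => i; exact: bump_continuous.
  move=> i x.
  have [w' [_ hw']] := bump_family_derive bw.
  by have [] := is_derive_line (@is_derive_tensor n w w' x (delta_mx ord0 i) 0 hw').
have [M hM] := choice (fun i => bump_support (bu i)).
have cK : compact [set v : 'rV[R]_n | forall i, `[- M i, M i]%classic (v ord0 i)].
  by apply: (@rV_compact R n (fun i => `[- M i, M i]%classic)) => i; exact: segment_compact.
apply: (subclosed_compact _ cK); first exact: closed_closure.
have clK : closed [set v : 'rV[R]_n | forall i, `[- M i, M i]%classic (v ord0 i)].
  apply: compact_closed => //; exact: norm_hausdorff.
rewrite [X in _ `<=` X](iffLR (closure_id _))//; apply: closureS.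
move=> x /= /prodf_neq0 h i; rewrite /= in_itv/= -ler_norml leNgt.
by apply: contra (h i isT) => /hM ->.
Qed.

Lemma tensor_measurable n (u : 'I_n -> R -> R) :
  (forall i, bump (u i)) -> measurable_fun setT (tensor u).
Proof.
move=> bu; apply: measurable_prod => i _.
apply: (@measurableT_comp _ _ _ _ _ _ (u i)); last exact: measurable_coord.
by apply: continuous_measurable_fun; exact: bump_continuous.
Qed.

Lemma tensor_bounded n (u : 'I_n -> R -> R) :
  (forall i, bump (u i)) -> exists C, forall x, `|tensor u x| <= C.
Proof.
move=> bu; have [C hC] := choice (fun i => bump_bounded (bu i)).
exists (\prod_i C i) => x; rewrite /tensor normr_prod.
by apply: ler_prod => i _; rewrite normr_ge0/=.
Qed.

Lemma tensor_shift n (u : 'I_n -> R -> R) (y x : 'rV[R]_n) :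
  tensor u (x - y) = tensor (fun i z => u i (z - y ord0 i)) x.
Proof. by apply: eq_bigr => i _; rewrite !mxE. Qed.

End tensor.

Lemma integrable_mul_bounded d (T : measurableType d) (R : realType)
    (mu : {measure set T -> \bar R}) (g phi : T -> R) (C : R) :
  mu.-integrable setT (EFin \o g) -> measurable_fun setT phi ->
  (forall x, `|phi x| <= C) ->
  mu.-integrable setT (EFin \o (fun x => g x * phi x)).
Proof.
move=> ig mphi hC.
have /integrableP[/measurable_EFinP mg _] := ig.
apply: (le_integrable measurableT _ _ (integrableZl measurableT C ig)).
  by apply/measurable_EFinP; exact: measurable_funM.
move=> x _ /=; rewrite lee_fin !normrM mulrC ler_wpM2r//.
by rewrite (le_trans (hC x))// ler_norm.
Qed.

Lemma Rintegral_sum d (T : measurableType d) (R : realType)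
    (mu : {measure set T -> \bar R}) I (s : seq I) (h : I -> T -> R) :
  (forall i, mu.-integrable setT (EFin \o h i)) ->
  mu.-integrable setT (EFin \o (fun x => \sum_(i <- s) h i x)) /\
  \int[mu]_x (\sum_(i <- s) h i x) = \sum_(i <- s) \int[mu]_x h i x.
Proof.
move=> ih; elim: s => [|i s [IH1 IH2]].
  rewrite big_nil; under [X in EFin \o X]eq_fun do rewrite big_nil.
  split; first exact: integrable0.
  under eq_Rintegral do rewrite big_nil.
  by rewrite Rintegral_cst//= mul0r.
rewrite big_cons; under [X in EFin \o X]eq_fun do rewrite big_cons.
under eq_Rintegral do rewrite big_cons.
split; last by rewrite RintegralD// IH2.
exact: (integrableD measurableT (ih i) IH1).
Qed.

Lemma is_derive_ext (R : realType) (g h : R -> R) (x a b : R) :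
  (forall y, g y = h y) -> a = b -> is_derive x 1 g a -> is_derive x 1 h b.
Proof. by move=> /funext -> ->. Qed.

(** * Weak gradients and directional Lipschitz constants *)

Section weak_directional_derivative.
Context {R : realType} {n : nat} (f : 'rV[R]_n -> R) (G : 'rV[R]_n -> 'rV[R]_n).
Local Notation mu := (@lebesgue_rV R n).
Hypothesis intf : mu.-integrable setT (EFin \o f).
Hypothesis intG : forall i, mu.-integrable setT (EFin \o (fun x => G x ord0 i)).
Hypothesis wG : is_weak_gradient f G.

Lemma weak_gradient_tensor (u u' : 'I_n -> R -> R) i :
  (forall i, bump (u i)) -> (forall i (x : R), is_derive x 1 (u i) (u' i x)) ->
  \int[mu]_x (f x * tensor (upd u i (u' i)) x) =
  - \int[mu]_x (G x ord0 i * tensor u x).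
Proof.
move=> bu du; rewrite -(partial_tensor i du) /Rintegral.
by rewrite (wG.2 _ (tensor_test_function bu)) fineN.
Qed.

Lemma integrable_mul_tensor (g : 'rV[R]_n -> R) (u : 'I_n -> R -> R) y :
  mu.-integrable setT (EFin \o g) -> (forall i, bump (u i)) ->
  mu.-integrable setT (EFin \o (fun x => g x * tensor u (x - y))).
Proof.
move=> ig bu.
have bu' i : bump (fun z => u i (z - y ord0 i)) by exact: bump_shift.
under [X in _.-integrable _ (_ \o X)]eq_fun do rewrite tensor_shift.
have [C hC] := tensor_bounded bu'.
by apply: (integrable_mul_bounded ig _ hC); exact: tensor_measurable.
Qed.

Lemma integrable_dotv xi : mu.-integrable setT (EFin \o (fun x => dotv (G x) xi)).
Proof.
have h i : mu.-integrable setT (EFin \o (fun x => G x ord0 i * xi ord0 i)).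
  exact: (integrableZr measurableT _ (intG i)).
exact: (Rintegral_sum (index_enum _) h).1.
Qed.

(** Differentiation under the integral puts the derivative on the test function, with a minus sign
    from the translation; the definition of the weak gradient moves it to f with a second minus
    sign. *)
Lemma is_derive_translated_integral (u : 'I_n -> R -> R) (xi : 'rV[R]_n) (t : R) :
  (forall i, bump (u i)) ->
  is_derive t 1 (fun t : R => \int[mu]_x (f x * tensor u (x - t *: xi)))
    (\int[mu]_x (dotv (G x) xi * tensor u (x - t *: xi))).
Proof.
move=> bu; have [u' [bu' du]] := bump_family_derive bu.
have bupd i k : bump (upd u i (u' i) k) by rewrite /upd; case: eqP.
have [C hC] := choice (fun i => tensor_bounded (bupd i)).
pose F (s : R) (x : 'rV[R]_n) := f x * tensor u (x - s *: xi).
have dF (s : R) x : is_derive s 1 (F ^~ x)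
    (f x * \sum_i (- xi ord0 i * tensor (upd u i (u' i)) (x - s *: xi))).
  apply: is_derive_ext (is_deriveZ (f x) (@is_derive_tensor _ n u u' x (- xi) s du)).
    by move=> r; rewrite /F /= scalerN.
  by congr (_ * _); apply: eq_bigr => i _; rewrite mxE scalerN.
have d1F s x : partial1of2 F s x = f x * \sum_i (- xi ord0 i * tensor (upd u i (u' i)) (x - s *: xi)).
  by rewrite partial1of2E; case: (dF s x).
(* A majorant of the derivative in s that does not depend on s, so any open interval around t can be
   used. *)
pose B x := `|f x| * \sum_i (`|xi ord0 i| * C i).
have B_ge0 x : 0 <= B x.
  rewrite mulr_ge0// sumr_ge0// => i _; rewrite mulr_ge0//.
  exact: le_trans (normr_ge0 _) (hC i 0).
have intB : mu.-integrable setT (EFin \o B).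
  rewrite /B; under [X in _.-integrable _ (_ \o X)]eq_fun do rewrite mulrC.
  under [X in _.-integrable _ X]eq_fun do rewrite /= EFinM.
  by apply: integrableZl => //; exact: integrable_norm.
have tI : `]t - 1, t + 1[%classic t by rewrite /= in_itv/= ltrBlDr ltrDl ltr01.
have intF s : `]t - 1, t + 1[%classic s -> mu.-integrable setT (EFin \o F s).
  by move=> _; exact: integrable_mul_tensor.
have derF s x : `]t - 1, t + 1[%classic s -> setT x -> derivable (F ^~ x) s 1.
  by move=> _ _; case: (dF s x).
have Bub s x : `]t - 1, t + 1[%classic s -> setT x -> `|partial1of2 F s x| <= B x.
  move=> _ _; rewrite d1F normrM /B ler_wpM2l// (le_trans (ler_norm_sum _ _ _))//.
  by apply: ler_sum => i _; rewrite normrM normrN ler_wpM2l.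
have h1 := derivable_under_integral measurableT tI intF derF B_ge0 intB Bub.
have h2 := differentiation_under_integral measurableT tI intF derF B_ge0 intB Bub.
split; first exact: h1.
rewrite -derive1E [LHS]h2.
under eq_Rintegral do rewrite d1F mulr_sumr.
have i1 i : mu.-integrable setT (EFin \o (fun x =>
    f x * (- xi ord0 i * tensor (upd u i (u' i)) (x - t *: xi)))).
  under [X in _.-integrable _ (_ \o X)]eq_fun do rewrite mulrCA.
  exact: (integrableZl measurableT _ (integrable_mul_tensor _ intf (bupd i))).
have i2 i : mu.-integrable setT (EFin \o (fun x =>
    G x ord0 i * xi ord0 i * tensor u (x - t *: xi))).
  under [X in _.-integrable _ (_ \o X)]eq_fun do rewrite mulrAC mulrC.
  exact: (integrableZl measurableT _ (integrable_mul_tensor _ (intG i) bu)).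
have [_ ->] := Rintegral_sum (index_enum _) i1.
under [RHS]eq_Rintegral do rewrite /dotv mulr_suml.
have [_ ->] := Rintegral_sum (index_enum _) i2.
apply: eq_bigr => i _.
(* The translated product is again a product of bumps, hence an admissible test function for the
   weak gradient. *)
pose y := t *: xi.
pose v k z := u k (z - y ord0 k); pose v' k z := u' k (z - y ord0 k).
have bv k : bump (v k) by exact: bump_shift.
have dv k (z : R) : is_derive z 1 (v k) (v' k z).
  have d1 : is_derive z 1 (fun z => z - y ord0 k) 1.
    apply: is_derive_ext (is_deriveB (is_derive_id z 1) (is_derive_cst (y ord0 k) z 1)) => //.
    by rewrite subr0.
  apply: is_derive_ext (@is_derive1_comp _ (u k) (fun z => z - y ord0 k) z _ _ (du k _) d1) => //.
  by rewrite mulr1.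
have E x : tensor (upd u i (u' i)) (x - y) = tensor (upd v i (v' i)) x.
  rewrite tensor_shift; apply: eq_bigr => k _.
  by rewrite /upd /v /v'; case: eqP => // ->.
under eq_Rintegral do rewrite E mulrCA.
rewrite RintegralZl//; last first.
  have := integrable_mul_tensor y intf (bupd i).
  by under [X in _.-integrable _ (_ \o X)]eq_fun do rewrite E.
rewrite weak_gradient_tensor// mulrN mulNr opprK.
under [RHS]eq_Rintegral do rewrite mulrAC tensor_shift.
rewrite RintegralZr// 1?mulrC//.
have := integrable_mul_tensor y (intG i) bu.
by under [X in _.-integrable _ (_ \o X) -> _]eq_fun do rewrite tensor_shift.
Qed.

End weak_directional_derivative.

(** * Open boxes as a generating pi-system *)

Section rectangles.
Context {R : realType} (n : nat).

(* Including the full line makes [setT] a rectangle, as the lambda-system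
   argument requires. *)
Definition open_itv_or_setT : set (set R) :=
  [set A | A = setT \/ exists a b : R, A = `]a, b[%classic].

Definition rectangles : set (set 'rV[R]_n) :=
  [set A | exists2 I : 'I_n -> set R, (forall i, open_itv_or_setT (I i)) & A = box I].

Lemma open_itv_or_setT_measurable : open_itv_or_setT `<=` measurable.
Proof. by move=> A [->//|[a [b ->]]]; exact: measurable_itv. Qed.

Lemma rectangles_measurable : rectangles `<=` measurable.
Proof.
by move=> A [I hI ->]; apply: measurable_box => i; exact: open_itv_or_setT_measurable.
Qed.

Lemma setI_itvoo (a b c d : R) :
  `]a, b[%classic `&` `]c, d[%classic = `]Num.max a c, Num.min b d[%classic.
Proof.
apply/seteqP; split => x /=; rewrite !in_itv/= gt_max lt_min.
  by move=> [/andP[-> ->] /andP[-> ->]].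
by move=> /andP[/andP[-> ->] /andP[-> ->]].
Qed.

Lemma setI_open_itv_or_setT : setI_closed open_itv_or_setT.
Proof.
move=> A B [->|[a [b ->]]]; first by rewrite setTI.
move=> [->|[c [d ->]]]; first by rewrite setIT; right; exists a, b.
by right; do 2 eexists; exact: setI_itvoo.
Qed.

Lemma box_setI (I J : 'I_n -> set R) : box I `&` box J = box (fun i => I i `&` J i).
Proof.
by apply/seteqP; split => [x [h1 h2] i|x h]; split => // i; have [] := h i.
Qed.

Lemma setI_rectangles : setI_closed rectangles.
Proof.
move=> A B [I hI ->] [J hJ ->]; rewrite box_setI.
by exists (fun i => I i `&` J i) => // i; exact: setI_open_itv_or_setT.
Qed.

(** The preimage of an open interval under a coordinate is a rectangle whose other factors are full
    lines, and open intervals generate the Borel sets of R. *)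
Lemma measurable_rectanglesE : @measurable _ 'rV[R]_n = <<s rectangles >>.
Proof.
apply/seteqP; split; last first.
  apply: smallest_sub; first exact: sigma_algebra_measurable.
  exact: rectangles_measurable.
apply: smallest_sub; first exact: smallest_sigma_algebra.
rewrite -bigcup_seq/=; apply: bigcup_sub => i _ A [B mB <-]; rewrite setTI.
have mc : measurable_fun setT
    ((fun x => x ord0 i) : g_sigma_algebraType rectangles -> R).
  apply: (measurability _ (RGenOpens.measurableE R)) => _ [_ [a [b ->]] <-].
  apply: sub_sigma_algebra; rewrite setTI.
  exists (fun k => if k == i then `]a, b[%classic else setT).
    by move=> k; case: eqP => _; [right; exists a, b|left].
  apply/seteqP; split => x /= h.
    by move=> k; case: eqP => // ->.
  by have := h i; rewrite eqxx.
by have := mc measurableT B mB; rewrite setTI.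
Qed.

Definition cube (x : 'rV[R]_n) (r : R) : set 'rV[R]_n :=
  box (fun i => `]x ord0 i - r, x ord0 i + r[%classic).

Lemma measurable_cube x r : measurable (cube x r).
Proof. by apply: measurable_box => i; exact: measurable_itv. Qed.

Lemma lebesgue_rV_openbox (a b : 'I_n -> R) : (forall i, a i < b i) ->
  lebesgue_rV n (box (fun i => `]a i, b i[%classic)) = (\prod_i (b i - a i))%:E.
Proof.
move=> ab; rewrite lebesgue_rV_box// -prodEFin; apply: eq_bigr => i _.
by rewrite lebesgue_measure_itv/= lte_fin ab -EFinB.
Qed.

Lemma lebesgue_rV_openbox_lty (a b : 'I_n -> R) :
  (lebesgue_rV n (box (fun i => `]a i, b i[%classic)) < +oo)%E.
Proof.
rewrite lebesgue_rV_box//.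
rewrite (eq_bigr (fun i => (if a i < b i then b i - a i else 0)%:E)) ?prodEFin ?ltry//.
by move=> i _; rewrite lebesgue_measure_itv/= lte_fin; case: ifPn => // _; rewrite -EFinB.
Qed.

Lemma lebesgue_rV_cube_gt0 x r : 0 < r -> (0 < lebesgue_rV n (cube x r))%E.
Proof.
move=> r0; rewrite lebesgue_rV_openbox.
  rewrite lte_fin prodr_gt0// => i _.
  by rewrite (_ : _ - _ = r + r) ?addr_gt0//; ring.
by move=> i; rewrite ltrBlDr -addrA ltrDl addr_gt0.
Qed.

Lemma lebesgue_rV_cube_lty x r : (lebesgue_rV n (cube x r) < +oo)%E.
Proof. exact: lebesgue_rV_openbox_lty. Qed.

Lemma nbhs_cube (x : 'rV[R]_n) (P : set 'rV[R]_n) :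
  nbhs x P -> exists2 r, 0 < r & cube x r `<=` P.
Proof.
move=> /nbhs_ballP[r /= r0 hr]; exists r => // y hy; apply: hr.
split=> // i j; rewrite (ord1 i).
by have := hy j; rewrite /= in_itv/= -ltr_distl /ball/= distrC.
Qed.

End rectangles.

Lemma integrable_indic_lty d (T : measurableType d) (R : realType)
    (mu : {measure set T -> \bar R}) (A : set T) :
  measurable A -> (mu A < +oo)%E ->
  mu.-integrable setT (EFin \o (\1_A : T -> R)).
Proof.
move=> mA Aoo; apply/integrableP; split; first exact/measurable_EFinP.
under eq_integral do rewrite /= ger0_norm//.
by rewrite integral_indic// setIT.
Qed.

Lemma Rintegral_eq0_null d (T : measurableType d) (R : realType)
    (mu : {measure set T -> \bar R}) (g : T -> R) (A : set T) :
  mu.-integrable setT (EFin \o g) -> (forall x, 0 <= g x) ->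
  \int[mu]_x g x = 0 -> measurable A -> (forall x, A x -> 0 < g x) -> mu A = 0%E.
Proof.
move=> ig g0 h0 mA gA.
have : (\int[mu]_x `|(g x)%:E| = 0)%E.
  under eq_integral do rewrite gee0_abs ?lee_fin//.
  rewrite -[LHS]fineK; first by congr EFin.
  exact: integrable_fin_num.
move/(ae_eq_integral_abs mu measurableT (measurable_int _ ig)) => [N [mN N0 sN]].
apply/eqP; rewrite -measure_le0 -N0.
apply: le_measure; rewrite ?inE// => x Ax; apply: sN => /= /(_ I)[] /eqP.
by rewrite gt_eqF// gA.
Qed.

Lemma coord_le_norm (R : realType) n (x : 'rV[R]_n) i : `|x ord0 i| <= `|x|.
Proof.
by rewrite [leRHS]/Num.Def.normr /= mx_normrE; apply/bigmax_geP; right => /=; exists (ord0, i).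
Qed.

(** * Smooth approximation of indicators of open boxes *)

Section box_bump.
Context {R : realType} (n : nat).
Implicit Types (a b : 'I_n -> R) (j : R).

(** For j > 0 the tensor product is positive exactly on the open box with corners a and b. The
    steepness j makes it tend pointwise to the indicator of the box. *)
Definition box_bump j a b : 'I_n -> R -> R :=
  fun i x => flatexp 1 (j * (x - a i)) * flatexp 1 (j * (b i - x)).

Lemma box_bumpP j a b : 0 < j -> forall i, bump (box_bump j a b i).
Proof. by move=> j0 i; exact: bump_base. Qed.

Lemma tensor_box_bump_ge0 j a b x : 0 <= tensor (box_bump j a b) x.
Proof. by apply: prodr_ge0 => i _; rewrite mulr_ge0// flatexp_ge0. Qed.

Lemma tensor_box_bump_le1 j a b x : tensor (box_bump j a b) x <= 1.
Proof.
rewrite (_ : 1 = \prod_(i < n) (1 : R)); last by rewrite big1_eq.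
apply: ler_prod => i _.
rewrite /box_bump mulr_ge0 ?flatexp_ge0//=.
by rewrite mulr_ile1// ?flatexp_ge0// flatexp_le1.
Qed.

Lemma tensor_box_bump_gt0 j a b x : 0 < j ->
  box (fun i => `]a i, b i[%classic) x -> 0 < tensor (box_bump j a b) x.
Proof.
move=> j0 h; apply: prodr_gt0 => i _; have := h i; rewrite /= in_itv/= => /andP[h1 h2].
by rewrite mulr_gt0// flatexp_gt0// mulr_gt0// subr_gt0.
Qed.

Lemma tensor_box_bump_eq0 j a b x : 0 < j ->
  ~ box (fun i => `]a i, b i[%classic) x -> tensor (box_bump j a b) x = 0.
Proof.
move=> j0 /existsNP[i /negP]; rewrite /= in_itv/= negb_and -!leNgt => h.
rewrite /tensor (bigD1 i)//= /box_bump.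
case/orP: h => h.
  by rewrite flatexp_le0 ?mul0r// pmulr_rle0// subr_le0.
by rewrite [X in _ * X * _]flatexp_le0 ?mulr0 ?mul0r// pmulr_rle0// subr_le0.
Qed.

Lemma tensor_box_bump_indic j a b x : 0 < j ->
  tensor (box_bump j a b) x <= \1_(box (fun i => `]a i, b i[%classic)) x.
Proof.
move=> j0; rewrite indicE; case: (asboolP (box (fun i => `]a i, b i[%classic) x)) => h.
  by rewrite mem_set//= tensor_box_bump_le1.
by rewrite memNset//= tensor_box_bump_eq0.
Qed.

Lemma flatexp_cvg1 (y : R) : 0 < y -> flatexp 1 (k.+1%:R * y) @[k --> \oo] --> (1:R).
Proof.
move=> y0.
have -> : (fun k : nat => flatexp 1 (k.+1%:R * y)) = (fun k => expR (- (y^-1 * k.+1%:R^-1))).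
  apply/funext => k; rewrite /flatexp mulr_gt0// hornerC mul1r.
  by rewrite invfM mulrC.
rewrite -[X in _ --> X]expR0; apply: continuous_cvg; first exact: continuous_expR.
rewrite -[X in _ --> X]oppr0; apply: cvgN.
rewrite -[X in _ --> X](mulr0 y^-1); apply: cvgMl_tmp.
exact: cvg_harmonic.
Qed.

Lemma cvg_bigprod (I : Type) (r : seq I) (g : I -> nat -> R) (l : I -> R) :
  (forall i, g i k @[k --> \oo] --> l i) ->
  (\prod_(i <- r) g i k) @[k --> \oo] --> \prod_(i <- r) l i.
Proof.
move=> h; elim: r => [|i r IH].
  by rewrite big_nil; under eq_fun do rewrite big_nil; exact: cvg_cst.
by rewrite big_cons; under eq_fun do rewrite big_cons; exact: cvgM.
Qed.

Lemma tensor_box_bump_cvg a b x :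
  tensor (box_bump k.+1%:R a b) x @[k --> \oo] -->
  (\1_(box (fun i => `]a i, b i[%classic)) x : R).
Proof.
rewrite indicE; case: (asboolP (box (fun i => `]a i, b i[%classic) x)) => h; last first.
  rewrite memNset//=; under eq_fun do rewrite tensor_box_bump_eq0//.
  exact: cvg_cst.
rewrite mem_set//= /tensor (_ : 1%:R = \prod_(i < n) (1 : R)); last by rewrite big1_eq.
apply: cvg_bigprod => i; have := h i; rewrite /= in_itv/= => /andP[h1 h2].
rewrite -[X in _ --> X]mulr1; apply: cvgM; apply: flatexp_cvg1; by rewrite subr_gt0.
Qed.

Lemma integrable_tensor_box_bump j a b : 0 < j ->
  (lebesgue_rV n).-integrable setT (EFin \o tensor (box_bump j a b)).
Proof.
move=> j0.
have mB : measurable (box (fun i => `]a i, b i[%classic)).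
  by apply: measurable_box => i; exact: measurable_itv.
apply: (le_integrable measurableT _ _ (integrable_indic_lty mB (lebesgue_rV_openbox_lty _ _))).
- by apply/measurable_EFinP; exact: (tensor_measurable (box_bumpP a b j0)).
- move=> x _ /=; rewrite lee_fin !ger0_norm ?tensor_box_bump_ge0//.
  exact: tensor_box_bump_indic.
Qed.

Lemma Rintegral_tensor_box_bump_gt0 j a b : 0 < j -> (forall i, a i < b i) ->
  0 < \int[lebesgue_rV n]_x tensor (box_bump j a b) x.
Proof.
move=> j0 ab.
have int := integrable_tensor_box_bump a b j0.
rewrite lt_neqAle Rintegral_ge0 ?andbT; last by move=> x _; exact: tensor_box_bump_ge0.
apply/eqP => /esym h0.
have mB : measurable (box (fun i => `]a i, b i[%classic)).
  by apply: measurable_box => i; exact: measurable_itv.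
have : lebesgue_rV n (box (fun i => `]a i, b i[%classic)) = 0%E.
  exact: (Rintegral_eq0_null int (tensor_box_bump_ge0 j a b) h0 mB
    (fun x => tensor_box_bump_gt0 j0)).
apply/eqP; rewrite lebesgue_rV_openbox// eqe gt_eqF// prodr_gt0// => i _.
by rewrite subr_gt0.
Qed.

End box_bump.

Lemma normr_indic_le1 T (R : realDomainType) (A : set T) x : `|\1_A x| <= 1 :> R.
Proof. by rewrite indicE; case: (_ \in _); rewrite ?normr1 ?normr0. Qed.

(** * From test functions to measurable sets *)

Section vanishing_integrals.
Context d (T : measurableType d) (R : realType) (mu : {measure set T -> \bar R}).
Variables (w : nat -> T -> R) (W : T -> R).
Hypothesis intw : forall k, mu.-integrable setT (EFin \o w k).
Hypothesis intW : mu.-integrable setT (EFin \o W).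
Hypothesis w_le : forall k x, `|w k x| <= W x.

Let W0 x : 0 <= W x. Proof. exact: le_trans (normr_ge0 _) (w_le 0 x). Qed.

(** The error of replacing psi by psi_j is at most the integral of W |psi - psi_j|, uniformly in k,
    and this tends to 0 by dominated convergence; so the two limits may be exchanged. *)
Lemma vanishing_integral_lim (psi_ : nat -> T -> R) (psi : T -> R) :
  (forall j, measurable_fun setT (psi_ j)) -> (forall j x, `|psi_ j x| <= 1) ->
  (forall x, psi_ j x @[j --> \oo] --> psi x) ->
  (forall j, \int[mu]_x (w k x * psi_ j x) @[k --> \oo] --> (0 : R)) ->
  \int[mu]_x (w k x * psi x) @[k --> \oo] --> (0 : R).
Proof.
move=> mpsi_ psi_1 cpsi h.
have psi1 x : `|psi x| <= 1.
  by rewrite -(cvg_lim _ (cvg_norm (cpsi x)))//; apply: limr_le; [exact: is_cvg_norm (cvgP _ (cpsi x))|exact: nearW].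
have mpsi : measurable_fun setT psi.
  exact: (measurable_fun_cvg mpsi_ (fun x _ => cpsi x)).
have int1 k : mu.-integrable setT (EFin \o (fun x => w k x * psi x)).
  exact: integrable_mul_bounded (intw k) mpsi psi1.
have int2 k j : mu.-integrable setT (EFin \o (fun x => w k x * psi_ j x)).
  exact: integrable_mul_bounded (intw k) (mpsi_ j) (psi_1 j).
have mdiff j : measurable_fun setT (fun x => `|psi x - psi_ j x|).
  by apply: measurableT_comp => //; exact: measurable_funB.
have diff2 j x : `|psi x - psi_ j x| <= 2.
  by rewrite (le_trans (ler_normB _ _))// [leRHS](_ : _ = 1 + 1)// lerD.
have int3 j : mu.-integrable setT (EFin \o (fun x => W x * `|psi x - psi_ j x|)).
  apply: (integrable_mul_bounded intW (mdiff j) (C := 2)) => x.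
  by rewrite normr_id.
have lim3 : (\int[mu]_x (W x * `|psi x - psi_ j x|)) @[j --> \oo] --> (0 : R).
  have mW : measurable_fun setT W by have /integrableP[/measurable_EFinP] := intW.
  have := @dominated_convergence _ _ _ mu _ measurableT
    (fun j x => (W x * `|psi x - psi_ j x|)%:E) (fun=> 0%E) (fun x => (2 * W x)%:E).
  case=> //.
  - by move=> j; apply/measurable_EFinP/measurable_funM.
  - apply: aeW => x _; apply: cvg_EFin; first exact: nearW.
    have hc : psi x - psi_ j x @[j --> \oo] --> psi x - psi x.
      by apply: cvgB => //; exact: cvg_cst.
    have hW : W x * `|psi x - psi_ j x| @[j --> \oo] --> W x * `|psi x - psi x|.
      by apply: cvgMl_tmp; exact: cvg_norm.
    by rewrite subrr normr0 mulr0 in hW.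
  - exact: (integrableZl measurableT 2 intW).
  - apply: aeW => x j _; rewrite lee_fin normrM (ger0_norm (W0 x)) normr_id.
    by rewrite mulrC ler_wpM2r.
  by move=> _ _; rewrite integral0 => /fine_cvg.
apply/cvgr0Pnorm_le => e e0.
have e2 : 0 < e / 2 by rewrite divr_gt0.
(* j is fixed first, with an error of at most e/2 for every k at once; only then is k taken
   large. *)
have /cvgr0Pnorm_le/(_ _ e2)[j _ hj] := lim3.
have /cvgr0Pnorm_le/(_ _ e2) hk := h j.
near=> k.
have -> : \int[mu]_x (w k x * psi x) =
    \int[mu]_x (w k x * psi_ j x) + \int[mu]_x (w k x * psi x - w k x * psi_ j x).
  by rewrite RintegralB// addrC subrK.
rewrite (le_trans (ler_normD _ _))// [leRHS](splitr e) lerD//.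
  by near: k.
have int4 : mu.-integrable setT (EFin \o (fun x => w k x * psi x - w k x * psi_ j x)).
  exact: (integrableB measurableT (int1 k) (int2 k j)).
rewrite (le_trans (le_normr_Rintegral _ int4))//.
apply: le_trans (hj j (leqnn j)).
apply: le_trans (ler_norm _).
apply: le_Rintegral => //; first exact: integrable_norm.
by move=> x _; rewrite -mulrBr normrM ler_wpM2r.
Unshelve. all: by end_near. Qed.

(* The sets A with int_A w_k -> 0 form a lambda-system; the domination
   |w_k| <= W is what makes it closed under increasing unions. *)
Lemma vanishing_integral_indic (C : set (set T)) :
  setI_closed C -> C setT -> C `<=` measurable ->
  (forall A, C A -> \int[mu]_x (w k x * \1_A x) @[k --> \oo] --> (0 : R)) ->
  forall A, <<s C >> A -> \int[mu]_x (w k x * \1_A x) @[k --> \oo] --> (0 : R).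
Proof.
move=> CI CT Cm hC A sA.
pose H := [set A | measurable A /\ \int[mu]_x (w k x * \1_A x) @[k --> \oo] --> (0 : R)].
suff /(_ A sA)[] : <<s C >> `<=` H by [].
apply: lambda_system_subset => //; last first.
  by move=> B CB; split; [exact: Cm|exact: hC].
split=> //; first by split=> //; exact: hC.
- move=> X Y YX [mX hX] [mY hY]; split; first exact: measurableD.
  have E x : \1_(X `\` Y) x = \1_X x - \1_Y x :> R.
    rewrite !indicE in_setD; have [Yx|] := boolP (x \in Y).
      by rewrite (_ : x \in X) ?subrr//; move: Yx; rewrite !inE; exact: YX.
    by rewrite subr0 andbT.
  have intB (B : set T) k : measurable B -> mu.-integrable setT (EFin \o (fun x => w k x * \1_B x)).
    by move=> mB; exact: integrable_mul_bounded (intw k) _ (normr_indic_le1 R B).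
  under eq_fun do under eq_Rintegral do rewrite E mulrBr.
  rewrite (_ : (fun k => _) = (fun k => \int[mu]_x (w k x * \1_X x)) \- (fun k => \int[mu]_x (w k x * \1_Y x))).
    by rewrite -(subrr (0 : R)); exact: cvgB.
  by apply/funext => k; rewrite /= -RintegralB//; exact: intB.
- move=> F ndF HF.
  have mF i : measurable (F i) by have [] := HF i.
  split; first exact: bigcup_measurable.
  apply: (@vanishing_integral_lim (fun j x => \1_(F j) x)) => //.
  + by move=> j; exact: measurable_indic.
  + by move=> j x; exact: normr_indic_le1.
  + move=> x; under eq_fun do rewrite indicE; rewrite indicE.
    have [[i _ Fix]|nF] := pselect ((\bigcup_i F i) x).
      rewrite mem_set//; last by exists i.
      apply: cvg_near_cst; exists i => // j /= ij.
      by rewrite mem_set//; move: x Fix; exact/subsetPset/ndF.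
    rewrite memNset//; apply: cvg_near_cst; apply: nearW => j.
    by rewrite memNset// => Fj; apply: nF; exists j.
  + by move=> j; have [] := HF j.
Qed.

End vanishing_integrals.

(** * Directional Lipschitz bounds against gradient bounds *)

Section directional_lipschitz.
Context {R : realType} {n : nat} (f : 'rV[R]_n -> R) (G : 'rV[R]_n -> 'rV[R]_n).
Local Notation mu := (@lebesgue_rV R n).
Hypothesis cf : continuous f.
Hypothesis intf : mu.-integrable setT (EFin \o f).
Hypothesis intG : forall i, mu.-integrable setT (EFin \o (fun x => G x ord0 i)).
Hypothesis wG : is_weak_gradient f G.

Let mf : measurable_fun setT f.
Proof. by have /integrableP[/measurable_EFinP] := intf. Qed.

Let mtr (y : 'rV[R]_n) : measurable_fun setT (fun x : 'rV[R]_n => f (x + y)).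
Proof. exact: (measurableT_comp mf (measurable_addv y)). Qed.

Lemma integrable_shift (y : 'rV[R]_n) : mu.-integrable setT (EFin \o (fun x => f (x + y))).
Proof.
have /integrableP[_ f_lty] := intf.
apply/integrableP; split; first exact/measurable_EFinP.
rewrite (@ge0_integral_shift _ _ y (fun x => `|(f x)%:E|)%E)//.
by apply: measurableT_comp => //; exact/measurable_EFinP.
Qed.

Lemma integrable_difference (y : 'rV[R]_n) :
  mu.-integrable setT (EFin \o (fun x => f (x + y) - f x)).
Proof. exact: (integrableB measurableT (integrable_shift y) intf). Qed.

Lemma Rintegral_difference_tensor (u : 'I_n -> R -> R) (y : 'rV[R]_n) :
  (forall i, bump (u i)) ->
  \int[mu]_x (f x * tensor u (x - y)) - \int[mu]_x (f x * tensor u x) =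
  \int[mu]_x ((f (x + y) - f x) * tensor u x).
Proof.
move=> bu; have [C hC] := tensor_bounded bu.
have mu_ := tensor_measurable bu.
have -> : \int[mu]_x (f x * tensor u (x - y)) = \int[mu]_x (f (x + y) * tensor u x).
  rewrite /Rintegral -(@integral_shift _ _ y (fun x => (f x * tensor u (x - y))%:E)).
    by congr fine; apply: eq_integral => x _; rewrite addrK.
  apply/measurable_EFinP; apply: measurable_funM => //.
  exact: (measurableT_comp mu_ (measurable_addv (- y))).
rewrite -RintegralB//.
- by apply: eq_Rintegral => x _; rewrite mulrBl.
- exact: integrable_mul_bounded (integrable_shift y) mu_ hC.
- exact: integrable_mul_bounded intf mu_ hC.
Qed.

(** The mean value theorem for the translated integral. The bound K is left abstract:
    [lipschitz_along] takes it from an essential supremum, the uniform lower bound of the polar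
    gauges also from an L^p energy. *)
Lemma difference_tensor_le (u : 'I_n -> R -> R) (xi : 'rV[R]_n) (K t : R) :
  (forall i, bump (u i)) -> 0 <= t ->
  (forall s, `|\int[mu]_x (dotv (G x) xi * tensor u (x - s *: xi))| <= K) ->
  `|\int[mu]_x ((f (x + t *: xi) - f x) * tensor u x)| <= t * K.
Proof.
move=> bu t0 hK.
have dA s := is_derive_translated_integral intf intG wG xi s bu.
have cA : {within `[0, t], continuous
    (fun t : R => \int[mu]_x (f x * tensor u (x - t *: xi)))}.
  by apply: derivable_within_continuous => s _; case: (dA s).
have [c _] := @MVT_segment R _ _ 0 t t0 (fun s _ => dA s) cA.
rewrite /= scale0r; under [X in _ - X]eq_Rintegral do rewrite subr0.
rewrite Rintegral_difference_tensor// => ->.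
by rewrite subr0 normrM (ger0_norm t0) mulrC ler_wpM2l.
Qed.

Lemma tensor_box_bump_shift j (a b : 'I_n -> R) (x y : 'rV[R]_n) :
  tensor (box_bump j a b) (x - y) =
  tensor (box_bump j (fun i => a i + y ord0 i) (fun i => b i + y ord0 i)) x.
Proof.
apply: eq_bigr => i _; rewrite /box_bump !mxE.
by congr (flatexp _ (_ * _) * flatexp _ (_ * _)); ring.
Qed.

Lemma Rintegral_tensor_shift j (a b : 'I_n -> R) (y : 'rV[R]_n) : 0 < j ->
  \int[mu]_x tensor (box_bump j a b) (x - y) = \int[mu]_x tensor (box_bump j a b) x.
Proof.
move=> j0; congr fine.
apply: (@integral_shift _ _ (- y) (fun x => (tensor (box_bump j a b) x)%:E)).
by apply/measurable_EFinP; apply: tensor_measurable; exact: box_bumpP.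
Qed.

Lemma dotv_tensor_le (xi : 'rV[R]_n) (M j : R) (a b : 'I_n -> R) (y : 'rV[R]_n) :
  0 < j -> 0 <= M -> {ae mu, forall x, `|dotv (G x) xi| <= M} ->
  `|\int[mu]_x (dotv (G x) xi * tensor (box_bump j a b) (x - y))| <=
  M * \int[mu]_x tensor (box_bump j a b) x.
Proof.
move=> j0 M0 hM; have bu := box_bumpP a b j0.
rewrite -(Rintegral_tensor_shift _ _ y j0) -RintegralZl//; last first.
  under [X in _.-integrable _ (_ \o X)]eq_fun do rewrite tensor_box_bump_shift.
  exact: integrable_tensor_box_bump.
have i1 := integrable_mul_tensor y (integrable_dotv intG xi) bu.
rewrite (le_trans (le_normr_Rintegral _ i1))//.
have i2 : mu.-integrable setT (EFin \o (fun x => M * tensor (box_bump j a b) (x - y))).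
  have := integrableZl measurableT M (integrable_tensor_box_bump
    (fun i => a i + y ord0 i) (fun i => b i + y ord0 i) j0).
  by under [X in _ -> _.-integrable _ (_ \o X)]eq_fun do rewrite tensor_box_bump_shift.
rewrite /Rintegral fine_le//.
- exact: (integrable_fin_num measurableT (integrable_norm i1)).
- exact: (integrable_fin_num measurableT i2).
apply: ae_ge0_le_integral => //.
- exact: (measurable_int _ (integrable_norm i1)).
- by move=> x _; rewrite lee_fin mulr_ge0// tensor_box_bump_ge0.
- exact: (measurable_int _ i2).
apply: filterS hM => x hx _; rewrite lee_fin normrM.
by rewrite (ger0_norm (tensor_box_bump_ge0 _ _ _ _)) ler_wpM2r// tensor_box_bump_ge0.
Qed.

Lemma continuous_difference (y : 'rV[R]_n) :
  continuous (fun x : 'rV[R]_n => f (x + y) - f x).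
Proof.
have ca : continuous (fun x : 'rV[R]_n => x + y).
  by move=> x; apply: (@continuousD _ _ _ id (cst y)); [exact: cvg_id|exact: cst_continuous].
have cfa : continuous (f \o (fun x : 'rV[R]_n => x + y)).
  by move=> x; apply: continuous_comp; [exact: ca|exact: cf].
by move=> x; apply: (@continuousB _ _ _ _ f x); [exact: cfa|exact: cf].
Qed.

(** If the bound failed at x0, continuity would make the increment, up to its sign, exceed some c >
    M t on a whole cube; integrating against a bump on that cube contradicts the bound in the
    mean. *)
Lemma lipschitz_along (xi : 'rV[R]_n) (M t : R) (x0 : 'rV[R]_n) :
  0 <= t -> 0 <= M -> {ae mu, forall x, `|dotv (G x) xi| <= M} ->
  `|f (x0 + t *: xi) - f x0| <= M * t.
Proof.
move=> t0 M0 hM; rewrite leNgt; apply/negP => hlt.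
pose g (x : 'rV[R]_n) := f (x + t *: xi) - f x.
pose sg := Num.sg (g x0).
have cg : continuous (fun x : 'rV[R]_n => sg * g x).
  by move=> x; apply: (@continuousM _ _ (cst sg) g x); [exact: cst_continuous|exact: continuous_difference].
(* The midpoint leaves a gap on both sides: below |g x0| for continuity, above M t for the final
   strict inequality. *)
pose c := (M * t + `|g x0|) / 2.
have Mc : M * t < c by rewrite /c midf_lt.
have cgx : c < sg * g x0 by rewrite /sg -normrEsg /c midf_lt.
have [r r0 hr] : exists2 r, 0 < r & cube x0 r `<=` [set x | c < sg * g x].
  apply: nbhs_cube; exact: (cg x0 _ (lt_nbhsr cgx)).
pose a i := x0 ord0 i - r; pose b i := x0 ord0 i + r.
have ab i : a i < b i by rewrite /a /b ltrBlDr -addrA ltrDl addr_gt0.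
have bu := box_bumpP a b (@ltr01 R).
have I0 := Rintegral_tensor_box_bump_gt0 (@ltr01 R) ab.
have := difference_tensor_le bu t0 (fun s => dotv_tensor_le a b (s *: xi) (@ltr01 R) M0 hM).
apply/negP; rewrite -ltNge.
have [C hC] := tensor_bounded bu; have mt := tensor_measurable bu.
have i1 : mu.-integrable setT (EFin \o (fun x => g x * tensor (box_bump 1 a b) x)).
  exact: integrable_mul_bounded (integrable_difference (t *: xi)) mt hC.
have h1 : c * \int[mu]_x tensor (box_bump 1 a b) x <=
    sg * \int[mu]_x (g x * tensor (box_bump 1 a b) x).
  have ib := integrable_tensor_box_bump a b (@ltr01 R).
  rewrite -!RintegralZl//; apply: le_Rintegral => //.
  - exact: (integrableZl measurableT c ib).
  - exact: (integrableZl measurableT sg i1).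
  move=> x _; rewrite mulrA.
  have [hx|hx] := pselect (cube x0 r x).
    by rewrite ler_wpM2r ?tensor_box_bump_ge0// ltW//; exact: hr.
  by rewrite tensor_box_bump_eq0// !mulr0.
apply: (@lt_le_trans _ _ (c * \int[mu]_x tensor (box_bump 1 a b) x)).
  by rewrite mulrA (mulrC t) ltr_pM2r.
rewrite (le_trans h1)// (le_trans (ler_norm _))// normrM.
have sg1 : `|sg| <= 1 by rewrite /sg normr_sg lern1 leq_b1.
by rewrite -[leRHS]mul1r ler_wpM2r.
Qed.

Definition diff_quotient (xi : 'rV[R]_n) (k : nat) (x : 'rV[R]_n) : R :=
  k.+1%:R * (f (x + k.+1%:R^-1 *: xi) - f x).

Lemma integrable_diff_quotient xi k : mu.-integrable setT (EFin \o diff_quotient xi k).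
Proof. exact: (integrableZl measurableT k.+1%:R (integrable_difference _)). Qed.

(** After a change of variables, these integrals are difference quotients at 0 of the translated
    integral, whose derivative is already known. *)
Lemma diff_quotient_tensor_cvg (u : 'I_n -> R -> R) (xi : 'rV[R]_n) :
  (forall i, bump (u i)) ->
  \int[mu]_x ((diff_quotient xi k x - dotv (G x) xi) * tensor u x) @[k --> \oo] --> (0 : R).
Proof.
move=> bu; have [C hC] := tensor_bounded bu; have mt := tensor_measurable bu.
have ih := integrable_mul_bounded (integrable_dotv intG xi) mt hC.
have iq k := integrable_mul_bounded (integrable_diff_quotient xi k) mt hC.
rewrite (_ : (fun k => _) = (fun k => \int[mu]_x (diff_quotient xi k x * tensor u x)) \-
    cst (\int[mu]_x (dotv (G x) xi * tensor u x))); last first.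
  apply/funext => k /=; rewrite -RintegralB//.
  by apply: eq_Rintegral => x _; rewrite mulrBl.
rewrite -[X in _ --> X](subrr (\int[mu]_x (dotv (G x) xi * tensor u x))).
apply: cvgB; last exact: cvg_cst.
pose A t := \int[mu]_x (f x * tensor u (x - t *: xi)).
have dA : is_derive (0 : R) 1 A (\int[mu]_x (dotv (G x) xi * tensor u x)).
  have := is_derive_translated_integral intf intG wG xi 0 bu.
  by under [X in is_derive _ _ _ X -> _]eq_Rintegral do rewrite scale0r subr0.
have [/cvg_ex[/= l hl] dl] := dA.
have El : l = \int[mu]_x (dotv (G x) xi * tensor u x).
  by rewrite -dl; apply/esym/cvg_lim.
rewrite -El.
pose h (k : nat) : R := k.+1%:R^-1.
have h0 : (forall k, h k != 0) /\ h k @[k --> \oo] --> (0:R).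
  by split=> [k|]; [rewrite invr_neq0|exact: cvg_harmonic].
move/cvgr_dnbhsP : hl => /(_ h h0); apply: cvg_trans.
apply: near_eq_cvg; apply: nearW => k /=.
rewrite /h invrK addr0 [_ *: 1]mulr1 /A.
under [X in _ *: (_ - X)]eq_Rintegral do rewrite scale0r subr0.
rewrite Rintegral_difference_tensor// /GRing.scale/= -RintegralZl//.
  by apply: eq_Rintegral => x _; rewrite /diff_quotient mulrA.
exact: integrable_mul_bounded (integrable_difference _) mt hC.
Qed.

(** The difference quotients are bounded by D but D is not integrable on R^n; cutting off by a cube
    provides the integrable majorant W. Bumps then give open boxes, and open boxes give all
    measurable sets. *)
Lemma diff_quotient_indic_cvg (xi : 'rV[R]_n) (D N : R) (A : set 'rV[R]_n) :
  (forall x t, 0 < t -> `|f (x + t *: xi) - f x| <= D * t) -> measurable A ->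
  \int[mu]_x ((diff_quotient xi k x - dotv (G x) xi) * \1_(cube 0 N) x * \1_A x)
    @[k --> \oo] --> (0 : R).
Proof.
move=> hD mA.
have dqD k x : `|diff_quotient xi k x| <= D.
  rewrite /diff_quotient normrM ger0_norm// mulrC -ler_pdivlMr//.
  exact: hD.
have mQ := measurable_cube (0 : 'rV[R]_n) N.
have iQ := integrable_indic_lty mQ (lebesgue_rV_cube_lty (0 : 'rV[R]_n) N).
pose w k x := (diff_quotient xi k x - dotv (G x) xi) * \1_(cube 0 N) x.
pose W x := (D + `|dotv (G x) xi|) * \1_(cube 0 N) x.
have ih := integrable_dotv intG xi.
have intw k : mu.-integrable setT (EFin \o w k).
  apply: (integrable_mul_bounded _ _ (normr_indic_le1 R _)) => //.
  exact: (integrableB measurableT (integrable_diff_quotient xi k) ih).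
have intW : mu.-integrable setT (EFin \o W).
  rewrite /W; under [X in _.-integrable _ (_ \o X)]eq_fun do rewrite mulrDl.
  have i2 : mu.-integrable setT (EFin \o (fun x => `|dotv (G x) xi| * \1_(cube 0 N) x)).
    by apply: (integrable_mul_bounded _ _ (normr_indic_le1 R _)) => //; exact: integrable_norm.
  exact: (integrableD measurableT (integrableZl measurableT D iQ) i2).
have wW k x : `|w k x| <= W x.
  rewrite /w /W normrM (ger0_norm (_ : 0 <= \1_(cube 0 N) x))//.
  rewrite ler_wpM2r// (le_trans (ler_normB _ _))// lerD2r//.
apply: (vanishing_integral_indic intw intW wW (@setI_rectangles R n)).
- by exists (fun=> setT); [left|apply/seteqP; split].
- exact: rectangles_measurable.
- move=> _ [I hI ->].
  (* Intersecting with the cube turns full-line factors into intervals, so that the rectangle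
     becomes a bounded open box and hence a limit of bumps. *)
  have hI' i : exists ab : R * R, I i `&` `]0 - N, 0 + N[%classic = `]ab.1, ab.2[%classic.
    have [->|[a [b ->]]] := hI i; first by rewrite setTI; exists (0 - N, 0 + N).
    by rewrite setI_itvoo; exists (Num.max a (0 - N), Num.min b (0 + N)).
  have [ab hab] := choice hI'.
  pose a i := (ab i).1; pose b i := (ab i).2.
  have EB : box I `&` cube 0 N = box (fun i => `]a i, b i[%classic).
    rewrite /cube box_setI; congr box; apply/funext => i.
    by rewrite -[RHS]hab; congr (_ `&` _); rewrite mxE.
  have wE k x : w k x * \1_(box I) x = w k x * \1_(box (fun i => `]a i, b i[%classic)) x.
    rewrite /w -EB !indicE in_setI.
    by case: (x \in box I) => /=; case: (x \in cube 0 N); rewrite ?mulr0 ?mulr1.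
  under eq_fun do under eq_Rintegral do rewrite wE.
  apply: (vanishing_integral_lim intw intW wW (psi_ := fun j => tensor (box_bump j.+1%:R a b))).
  + by move=> j; apply: tensor_measurable; exact: box_bumpP.
  + by move=> j x; rewrite ger0_norm ?tensor_box_bump_ge0// tensor_box_bump_le1.
  + by move=> x; exact: tensor_box_bump_cvg.
  + move=> j.
    (* The bump vanishes outside a box contained in the cube, so the cut-off has no effect here. *)
    have E k x : w k x * tensor (box_bump j.+1%:R a b) x =
        (diff_quotient xi k x - dotv (G x) xi) * tensor (box_bump j.+1%:R a b) x.
      have [hx|hx] := pselect (box (fun i => `]a i, b i[%classic) x).
        move: hx; rewrite -EB => -[_ hx].
        by rewrite /w indicE mem_set// mulr1.
      by rewrite tensor_box_bump_eq0// !mulr0.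
    under eq_fun do under eq_Rintegral do rewrite E.
    by apply: diff_quotient_tensor_cvg => i; exact: box_bumpP.
- by rewrite -measurable_rectanglesE.
Qed.

(** On the set where the gradient exceeds D, the difference quotients stay at most D while
    converging weakly to the gradient; this forces the set to be null. *)
Lemma dotv_le_of_lipschitz_along (xi : 'rV[R]_n) (D : R) :
  (forall x t, 0 < t -> `|f (x + t *: xi) - f x| <= D * t) ->
  {ae mu, forall x, dotv (G x) xi <= D}.
Proof.
move=> hD.
have ih := integrable_dotv intG xi.
have mh : measurable_fun setT (fun x => dotv (G x) xi).
  by have /integrableP[/measurable_EFinP] := ih.
pose E := [set x : 'rV[R]_n | D < dotv (G x) xi].
have mE : measurable E.
  rewrite /E -[X in measurable X]setTI.
  have -> : [set x : 'rV[R]_n | D < dotv (G x) xi] = (fun x => dotv (G x) xi) @^-1` `]D, +oo[.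
    by apply/seteqP; split => x /=; rewrite in_itv/= andbT.
  exact: mh.
(* The constant D is integrable only on sets of finite measure, so the exceptional set is exhausted
   by its traces on cubes. *)
suff hN (N : nat) : mu (cube 0 N.+1%:R `&` E) = 0%E.
  have : {ae mu, forall x (N : nat), ~ (cube 0 N.+1%:R `&` E) x}.
    apply/ae_foralln => N; exists (cube 0 N.+1%:R `&` E); split=> //.
    - by apply: measurableI => //; exact: measurable_cube.
    - exact: hN.
    - by move=> x /= /contrapT.
  apply: filterS => x hx; rewrite leNgt; apply/negP => Dx.
  apply: (hx (Num.truncn `|x|)); split => //.
  move=> i; rewrite /= in_itv/= mxE sub0r add0r -ltr_norml.
  exact: le_lt_trans (coord_le_norm _ _) (truncnS_gt _).
set Q := cube 0 N.+1%:R.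
have mQ : measurable Q by exact: measurable_cube.
have iQ := integrable_indic_lty mQ (lebesgue_rV_cube_lty (0 : 'rV[R]_n) N.+1%:R).
have mI (B : set 'rV[R]_n) : measurable B -> measurable_fun setT (\1_B : _ -> R).
  by move=> mB; exact: measurable_indic.
pose g x := (dotv (G x) xi - D) * \1_Q x * \1_E x.
have ig : mu.-integrable setT (EFin \o g).
  apply: (integrable_mul_bounded _ (mI _ mE) (normr_indic_le1 R _)).
  rewrite /=; under [X in _.-integrable _ (_ \o X)]eq_fun do rewrite mulrBl.
  have i1 : mu.-integrable setT (EFin \o (fun x => dotv (G x) xi * \1_Q x)).
    exact: (integrable_mul_bounded ih (mI _ mQ) (normr_indic_le1 R _)).
  exact: (integrableB measurableT i1 (integrableZl measurableT D iQ)).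
have g0 x : 0 <= g x.
  rewrite /g [\1_E x]indicE; have [|_] := boolP (x \in E); last by rewrite mulr0.
  by rewrite inE => Ex; rewrite mulr1 mulr_ge0// subr_ge0 ltW.
apply: (Rintegral_eq0_null ig g0) => //; last first.
- move=> x [Qx Ex]; rewrite /g !indicE !mem_set// !mulr1 subr_gt0//.
- exact: measurableI.
(* If the integral of g were positive, weak convergence would give some k whose discrepancy on Q and
   E is smaller; but g is at most the gradient minus the k-th quotient there, since that quotient is
   at most D. *)
apply/eqP; rewrite eq_le Rintegral_ge0// andbT leNgt; apply/negP => c0.
have /cvgr0Pnorm_lt/(_ _ c0)[k _ /(_ k (leqnn k))] := diff_quotient_indic_cvg N.+1%:R hD mE.
apply/negP; rewrite -leNgt -normrN; apply: le_trans (ler_norm _).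
pose v x := (diff_quotient xi k x - dotv (G x) xi) * \1_Q x * \1_E x.
have iv : mu.-integrable setT (EFin \o v).
  apply: (integrable_mul_bounded _ (mI _ mE) (normr_indic_le1 R _)).
  apply: (integrable_mul_bounded _ (mI _ mQ) (normr_indic_le1 R _)).
  exact: (integrableB measurableT (integrable_diff_quotient xi k) ih).
rewrite -/v -mulN1r -RintegralZl//; apply: le_Rintegral => //.
  exact: (integrableZl measurableT (-1) iv).
move=> x _; rewrite /g /v mulN1r -!mulNr opprB !ler_wpM2r// lerD2l lerN2.
rewrite /diff_quotient -ler_pdivlMl// mulrC.
exact: le_trans (ler_norm _) (hD _ _ _).
Qed.

Lemma abs_dotv_le_of_lipschitz_along (xi : 'rV[R]_n) (D : R) :
  (forall x t, 0 < t -> `|f (x + t *: xi) - f x| <= D * t) ->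
  {ae mu, forall x, `|dotv (G x) xi| <= D}.
Proof.
move=> hD.
have h1 := dotv_le_of_lipschitz_along hD.
have h2 : {ae mu, forall x, dotv (G x) (- xi) <= D}.
  apply: dotv_le_of_lipschitz_along => x t t0.
  (* The same segment run backwards, based at its other endpoint, gives the hypothesis for -xi. *)
  have := hD (x - t *: xi) t t0.
  by rewrite subrK scalerN distrC.
apply: filterS2 h1 h2 => x h1 h2; rewrite ler_norml h1 andbT lerNl.
apply: le_trans h2; rewrite /dotv -sumrN.
by under [leRHS]eq_bigr do rewrite mxE mulrN.
Qed.

End directional_lipschitz.

Section euclidean_norm.
Context {R : realType} {n : nat}.
Implicit Types x y : 'rV[R]_n.

Lemma dotv_ge0 x : 0 <= dotv x x.
Proof. by apply: sumr_ge0 => i _; rewrite -expr2 sqr_ge0. Qed.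

Lemma enorm_ge0 x : 0 <= enorm x.
Proof. exact: sqrtr_ge0. Qed.

Lemma enormZ (t : R) x : enorm (t *: x) = `|t| * enorm x.
Proof.
rewrite /enorm (_ : dotv _ _ = t ^+ 2 * dotv x x).
  by rewrite sqrtrM ?sqr_ge0// sqrtr_sqr.
by rewrite /dotv mulr_sumr; apply: eq_bigr => i _; rewrite !mxE; ring.
Qed.

Lemma dotvZr (t : R) x y : dotv x (t *: y) = t * dotv x y.
Proof. by rewrite /dotv mulr_sumr; apply: eq_bigr => i _; rewrite mxE mulrCA. Qed.

(** The factor n is cruder than the sharp square root of n, but only the equivalence of the norms
    matters. *)
Lemma enorm_le_norm x : enorm x <= n%:R * `|x|.
Proof.
rewrite -[leRHS]ger0_norm ?mulr_ge0// -sqrtr_sqr ler_sqrt ?sqr_ge0//.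
apply: (@le_trans _ _ (\sum_(i < n) `|x| ^+ 2)).
  apply: ler_sum => i _; rewrite -expr2 -[_ ^+ 2]real_normK ?num_real//.
  by rewrite ler_sqr ?nnegrE// coord_le_norm.
rewrite sumr_const card_ord exprMn -[leLHS]mulr_natl ler_wpM2r ?sqr_ge0//.
by rewrite -natrX ler_nat; case: (n) => // m; rewrite leq_pmulr.
Qed.

Lemma coord_le_enorm x i : `|x ord0 i| <= enorm x.
Proof.
rewrite -sqrtr_sqr ler_sqrt ?dotv_ge0// /dotv (bigD1 i)//= expr2 lerDl.
by apply: sumr_ge0 => j _; rewrite -expr2 sqr_ge0.
Qed.

Lemma measurable_esphere : measurable (@esphere R n).
Proof.
rewrite (_ : esphere = setT `&` enorm @^-1` [set 1]); last by rewrite setTI.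
exact: measurable_enorm.
Qed.

End euclidean_norm.

(** * Integrable Lipschitz functions *)

Section integrable_lipschitz.
Context {R : realType} {n : nat} (f : 'rV[R]_n -> R).
Local Notation mu := (@lebesgue_rV R n).
Hypothesis intf : mu.-integrable setT (EFin \o f).
Hypothesis lipf : euclidean_lipschitz f.

Lemma lipschitz_const : exists2 L, 0 < L &
  forall x y, `|f x - f y| <= L * enorm (x - y).
Proof.
have [L hL] := lipf; exists (`|L| + 1); first by rewrite ltr_wpDl.
move=> x y; rewrite (le_trans (hL x y))// ler_wpM2r ?enorm_ge0//.
by rewrite ler_wpDr// ler_norm.
Qed.

Lemma lipschitz_sup_norm : exists2 L, 0 < L & forall x y, `|f x - f y| <= L * `|x - y|.
Proof.
have [L L0 hL] := lipschitz_const.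
(* The summand 1 keeps the constant positive in dimension 0 as well. *)
exists (L * n%:R + 1); first by rewrite ltr_wpDl// mulr_ge0// ltW.
move=> x y; rewrite (le_trans (hL x y))// (@le_trans _ _ (L * (n%:R * `|x - y|)))//.
  by rewrite ler_wpM2l ?(ltW L0)// enorm_le_norm.
by rewrite mulrA ler_wpM2r// lerDl.
Qed.

Lemma lipschitz_continuous : continuous f.
Proof.
have [L L0 hL] := lipschitz_sup_norm.
move=> x A /nbhs_ballP[e /= e0 heA].
have eL : 0 < e / L by rewrite divr_gt0.
suff : nbhs x (f @^-1` A) by [].
apply/nbhs_ballP; exists (e / L) => //= y.
rewrite mx_norm_ball /ball_/= => hy; apply: heA.
rewrite -ball_normE /ball_/= (le_lt_trans (hL _ _))//.
by rewrite mulrC -ltr_pdivlMr.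
Qed.

Lemma Rintegral_indic_cube (x : 'rV[R]_n) r : 0 < r ->
  \int[mu]_y \1_(cube x r) y = (r *+ 2) ^+ n.
Proof.
move=> r0; have E : mu (cube x r `&` setT) = ((r *+ 2) ^+ n)%:E.
  rewrite setIT lebesgue_rV_openbox; last by move=> i; rewrite ltrBlDr -addrA ltrDl addr_gt0.
  rewrite (eq_bigr (fun=> r *+ 2)) ?prodr_const ?card_ord// => i _.
  by rewrite mulr2n; ring.
rewrite /Rintegral integral_indic//; last exact: measurable_cube.
exact: (congr1 fine E).
Qed.

Lemma cube_norm (x y : 'rV[R]_n) r : 0 < r -> cube x r y -> `|y - x| <= r.
Proof.
move=> r0 h; rewrite [leLHS]/Num.Def.normr /= mx_normrE; apply: bigmax_le => [|[i j] _] /=.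
  exact: ltW.
by rewrite !mxE (ord1 i); have := h j; rewrite /= in_itv/= -ltr_distl => /ltW.
Qed.

(** A value of size e persists at size e/2 on a cube of radius r = e / (2L). Far from the origin
    such a cube would contribute a fixed amount to the tail of the integral of |f|, which tends to
    0. *)
Lemma vanish_at_infinity e : 0 < e -> exists R0, forall x, R0 <= `|x| -> `|f x| < e.
Proof.
move=> e0; have [L L0 hL] := lipschitz_sup_norm.
pose r := e / 2 / L; have r0 : 0 < r by rewrite !divr_gt0.
have intn := integrable_norm intf.
have V0 : 0 < (r *+ 2) ^+ n by rewrite exprn_gt0// mulrn_wgt0.
pose E k := ~` cube (0 : 'rV[R]_n) k.+1%:R.
have mE k : measurable (E k) by apply: measurableC; exact: measurable_cube.
have mI k : measurable_fun setT (\1_(E k) : 'rV[R]_n -> R) by exact: measurable_indic.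
have intk k : mu.-integrable setT (EFin \o (fun x => `|f x| * \1_(E k) x)).
  exact: (integrable_mul_bounded intn (mI k) (normr_indic_le1 R _)).
have mf : measurable_fun setT f by have /integrableP[/measurable_EFinP] := intf.
have lim0 : (\int[mu]_x (`|f x| * \1_(E k) x)) @[k --> \oo] --> (0 : R).
  have := @dominated_convergence _ _ _ mu _ measurableT
    (fun k x => (`|f x| * \1_(E k) x)%:E) (fun=> 0%E) (fun x => `|f x|%:E).
  case=> //.
  - by move=> k; apply/measurable_EFinP/measurable_funM => //; exact: measurableT_comp.
  - apply: aeW => x _; apply: cvg_near_cst.
    exists (Num.truncn `|x|).+1 => // k /= hk.
    rewrite indicE memNset ?mulr0// => hE; apply: hE => i; rewrite /= in_itv/= mxE sub0r add0r -ltr_norml.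
    rewrite (le_lt_trans (coord_le_norm _ _))// (lt_le_trans (truncnS_gt _))// ler_nat.
    by rewrite ltnW// ltnS ltnW.
  - apply: aeW => x k _; rewrite lee_fin normrM normr_id.
    by rewrite -[leRHS]mulr1 ler_wpM2l// normr_indic_le1.
  by move=> _ _; rewrite integral0 => /fine_cvg.
have eV : 0 < e / 2 * (r *+ 2) ^+ n by rewrite mulr_gt0// divr_gt0.
have /cvgr0Pnorm_lt/(_ _ eV)[k _ /(_ k (leqnn k)) hk] := lim0.
(* One r keeps the cube around x away from the central cube; the other makes the separation
   strict. *)
exists (k.+1%:R + r + r) => x hx; rewrite ltNge; apply/negP => fxe.
move: hk; apply/negP; rewrite -leNgt (le_trans _ (ler_norm _))//.
have mC := measurable_cube x r.
have iC := integrable_indic_lty mC (lebesgue_rV_cube_lty x r).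
rewrite -(Rintegral_indic_cube x r0) -RintegralZl//.
apply: le_Rintegral => //; first exact: (integrableZl measurableT (e / 2) iC).
move=> y _; rewrite indicE; have [|_] := boolP (y \in cube x r); last by rewrite mulr0 mulr_ge0.
rewrite inE => /(cube_norm r0) hy; rewrite mulr1 indicE mem_set ?mulr1.
  have h1 : `|f x| - `|f y| <= e / 2.
    rewrite (le_trans (lerB_dist _ _))// (le_trans (hL _ _))// distrC.
    by rewrite mulrC -ler_pdivlMr.
  by rewrite -(lerD2l (- (e / 2))) addNr; lra.
move=> /(cube_norm (ltr0Sn R k)); rewrite subr0 => hC.
have := lerB_dist x y; rewrite distrC; lra.
Qed.

Lemma integrable_lipschitz_bounded : exists2 B, 0 < B & forall x, `|f x| <= B.
Proof.
have [L L0 hL] := lipschitz_sup_norm.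
have [R0 hR0] := vanish_at_infinity ltr01.
exists (`|f 0| + L * `|R0| + 1); first by rewrite ltr_wpDl// addr_ge0// mulr_ge0// ltW.
move=> x; have [xR|xR] := leP R0 `|x|.
  by rewrite (le_trans (ltW (hR0 _ xR)))// lerDr addr_ge0// mulr_ge0// ltW.
have h1 := hL x 0; rewrite subr0 in h1.
have h2 : L * `|x| <= L * `|R0| by rewrite ler_wpM2l ?(ltW L0)// (le_trans (ltW xR))// ler_norm.
have h3 := lerB_dist (f x) (f 0).
lra.
Qed.

(* The constants do not depend on the direction xi; the sign lets the bound
   survive integration against a nonnegative bump. *)
Lemma far_difference : (0 < n)%N -> (exists x, f x != 0) ->
  exists (x0 : 'rV[R]_n) (a r T : R), [/\ 0 < a, 0 < r, 0 < T &
    forall xi x t, enorm xi = 1 -> cube x0 r x -> T <= t ->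
      a <= Num.sg (f x0) * (f x - f (x + t *: xi))].
Proof.
move=> n0 [x0 fx0]; have [L L0 hL] := lipschitz_sup_norm.
have a0 : 0 < `|f x0| by rewrite normr_gt0.
(* One quarter of |f x0| is lost to the variation of f near x0 and one quarter to the values far
   away, so half remains. *)
have a4 : 0 < `|f x0| / 4 by rewrite divr_gt0.
have [R0 hR0] := vanish_at_infinity a4.
pose r := `|f x0| / 4 / L; have r0 : 0 < r by rewrite divr_gt0.
(* A Euclidean unit vector has sup norm at least 1/n, so times t >= T move every point of the cube
   beyond R0. *)
pose T := n%:R * (`|R0| + `|x0| + r).
exists x0, (`|f x0| / 2), r, T; split => //; first by rewrite divr_gt0.
  by rewrite mulr_gt0 ?ltr0n// ltr_wpDl// addr_ge0.
move=> xi x t xi1 /(cube_norm r0) hx Tt.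
have n1 : 1 <= n%:R * `|xi| by have := enorm_le_norm xi; rewrite xi1.
have t0 : 0 <= t by apply: le_trans Tt; rewrite mulr_ge0// !addr_ge0// ltW.
have far : R0 <= `|x + t *: xi|.
  have h1 : t <= n%:R * (t * `|xi|) by rewrite mulrCA -[leLHS]mulr1 ler_wpM2l.
  have h2 : `|R0| + `|x0| + r <= t * `|xi|.
    by rewrite -(ler_pM2l (_ : 0 < n%:R)) ?ltr0n// (le_trans Tt).
  have h3 := lerB_dist (t *: xi) (- x); rewrite opprK normrN normrZ (ger0_norm t0) [_ + x]addrC in h3.
  have h4 := lerB_dist x x0; have h5 := ler_norm R0.
  lra.
have {}far := hR0 _ far.
have h1 : `|f x - f x0| <= `|f x0| / 4.
  by rewrite (le_trans (hL _ _))// mulrC -ler_pdivlMr.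
have sg1 : `|Num.sg (f x0)| = 1 by rewrite normr_sg fx0.
have -> : Num.sg (f x0) * (f x - f (x + t *: xi)) =
    `|f x0| + (Num.sg (f x0) * (f x - f x0) - Num.sg (f x0) * f (x + t *: xi)).
  by rewrite normrEsg; ring.
have h2 : `|Num.sg (f x0) * (f x - f x0)| <= `|f x0| / 4 by rewrite normrM sg1 mul1r.
have h3 : `|Num.sg (f x0) * f (x + t *: xi)| <= `|f x0| / 4 by rewrite normrM sg1 mul1r ltW.
rewrite !ler_norml in h2 h3; lra.
Qed.

End integrable_lipschitz.

(** * Convergence of gauges and of volumes *)

Section sequential_limits.
Context {R : realType} {T : topologicalType}.

(** Dominated convergence is applied along sequences. The restriction p0 <= u k admits bounds that
    hold only for large p. *)
Lemma cvg_pinfty_seq (f : R -> T) (l : T) (p0 : R) :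
  (forall u : nat -> R, (forall k, p0 <= u k) -> u @ \oo --> +oo ->
     f (u k) @[k --> \oo] --> l) ->
  f p @[p --> +oo] --> l.
Proof.
move=> h A nA; apply: contrapT => nP.
have ex (k : nat) : exists p, Num.max p0 k%:R < p /\ ~ A (f p).
  apply: contrapT => /forallNP hk; apply: nP.
  exists (Num.max p0 k%:R); split; first exact: num_real.
  by move=> p kp; apply: contrapT => nAp; apply: (hk p).
have [u hu] := choice ex.
have u0 k : p0 <= u k by have [+ _] := hu k; rewrite gt_max => /andP[/ltW].
have uoo : u @ \oo --> +oo.
  apply/cvgryPgt => M; near=> k; have [+ _] := hu k.
  rewrite gt_max => /andP[_]; apply: le_lt_trans.
  by near: k; exact: nbhs_infty_ger.
have [k _ /(_ k (leqnn k))] := h u u0 uoo A nA.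
by have [] := hu k.
Unshelve. all: by end_near. Qed.

Lemma cvg_at_left_seq (f : R -> T) (l : T) (p q : R) : q < p ->
  (forall u : nat -> R, (forall k, q <= u k < p) -> u @ \oo --> p ->
     f (u k) @[k --> \oo] --> l) ->
  f x @[x --> p^'-] --> l.
Proof.
move=> qp h A nA; apply: contrapT => nP.
have ex (k : nat) : exists x, [/\ q <= x, p - k.+1%:R^-1 < x, x < p & ~ A (f x)].
  apply: contrapT => /forallNP hk; apply: nP.
  have : \forall x \near p^'-, [/\ q <= x, p - k.+1%:R^-1 < x & x < p].
    near=> x; split=> //.
    - near: x; apply: filterS (nbhs_left_gt qp) => y; exact: ltW.
    - near: x; apply: nbhs_left_gt; by rewrite ltrBlDr ltrDl.
  apply: filterS => x [h1 h2 h3]; apply: contrapT => nAx; exact: (hk x).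
have [u hu] := choice ex.
have u1 k : q <= u k < p by have [-> _ -> _] := hu k.
have ucvg : u @ \oo --> p.
  apply/cvgrPdist_lt => e e0; near=> k; have [_ h1 h2 _] := hu k.
  rewrite gtr0_norm ?subr_gt0// ltrBlDr -ltrBlDl (lt_trans _ h1)//.
  rewrite ltrD2l ltrN2.
  near: k; exact: near_infty_natSinv_lt (PosNum e0).
have [k _ /(_ k (leqnn k))] := h u u1 ucvg A nA.
by have [] := hu k.
Unshelve. all: by end_near. Qed.

End sequential_limits.

Section root_limit.
Context {R : realType}.

Lemma cvg_div_pinfty (C : R) : C / p @[p --> +oo] --> (0 : R).
Proof.
apply/cvgr0Pnorm_le => e e0; near=> p.
have p0 : 0 < p by near: p; exact: nbhs_pinfty_gt.
rewrite normrM normfV (gtr0_norm p0) ler_pdivrMr// mulrC -ler_pdivrMr//.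
Unshelve. all: by end_near. Qed.

Lemma cvg_root (J : R -> \bar R) (c : R -> R) (K p0 I0 s : R) :
  0 < K -> 0 < s -> 0 < I0 -> 0 < p0 -> (forall p, p0 <= p -> 0 < c p) ->
  ln (c p) / p @[p --> +oo] --> (0 : R) ->
  (forall p : R, p0 <= p -> (J p <= (c p * (K `^ (p - p0) * I0))%:E)%E) ->
  (forall a, 0 < a < K -> exists2 m, 0 < m &
    forall p, p0 <= p -> ((c p * (a `^ p * m))%:E <= J p)%E) ->
  ((J p) `^ (p * s)^-1)%E @[p --> +oo] --> (K `^ s^-1)%:E.
Proof.
move=> K0 s0 I00 p00 c0 cc Jub Jlb.
pose r p := fine (J p).
have Jr p : p0 <= p -> J p = (r p)%:E.
  move=> pp0; rewrite fineK// ge0_fin_numE; first exact: le_lt_trans (Jub _ pp0) (ltry _).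
  have K2 : 0 < K / 2 < K by rewrite divr_gt0//= ltr_pdivrMr// ltr_pMr// ltr1n.
  have [m m0 hm] := Jlb _ K2.
  apply: le_trans (hm _ pp0).
  by rewrite lee_fin !mulr_ge0// ?powR_ge0// ltW// c0.
have rub p : p0 <= p -> r p <= c p * (K `^ (p - p0) * I0).
  by move=> pp0; rewrite -lee_fin -Jr// Jub.
have rlb a : 0 < a < K -> exists2 m, 0 < m & forall p, p0 <= p -> c p * (a `^ p * m) <= r p.
  by move=> aK; have [m m0 hm] := Jlb _ aK; exists m => // p pp0; rewrite -lee_fin -Jr// hm.
have r0 p : p0 <= p -> 0 < r p.
  have K2 : 0 < K / 2 < K by rewrite divr_gt0//= ltr_pdivrMr// ltr_pMr// ltr1n.
  have [m m0 hm] := rlb _ K2; move=> pp0; apply: lt_le_trans (hm _ pp0).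
  by rewrite !mulr_gt0// ?powR_gt0 ?c0//; case/andP: K2.
have lnr : ln (r p) / p @[p --> +oo] --> ln K.
  apply/cvgrPdist_le => e e0.
  have e3 : 0 < e / 3 by rewrite divr_gt0.
  (* Chosen so that ln a = ln K - e/3; the other two thirds of e pay for c and m. *)
  pose a := K * expR (- (e / 3)).
  have aK : 0 < a < K.
    by rewrite /a mulr_gt0 ?expR_gt0//= gtr_pMr// expR_lt1 oppr_lt0.
  have [m m0 hm] := rlb _ aK.
  have lna : ln a = ln K - e / 3 by rewrite /a lnM ?posrE ?expR_gt0// expRK.
  near=> p.
  have pp0 : p0 <= p by near: p; apply: nbhs_pinfty_ge; exact: num_real.
  have h1 : `|ln (c p) / p| <= e / 3 by near: p; move/cvgr0Pnorm_le : cc; exact.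
  have h2 : `|ln m / p| <= e / 3.
    by near: p; have /cvgr0Pnorm_le := cvg_div_pinfty (ln m); exact.
  have h3 : `|(ln I0 - p0 * ln K) / p| <= e / 3.
    by near: p; have /cvgr0Pnorm_le := cvg_div_pinfty (ln I0 - p0 * ln K); exact.
  have u1 : ln (r p) / p <= ln (c p) / p + ln K + (ln I0 - p0 * ln K) / p.
    have -> : ln (c p) / p + ln K + (ln I0 - p0 * ln K) / p =
        (ln (c p) + ((p - p0) * ln K + ln I0)) / p.
      by field; rewrite gt_eqF.
    rewrite ler_pM2r ?invr_gt0// -ln_powR -!lnM ?posrE ?mulr_gt0 ?powR_gt0 ?c0//.
    by rewrite ler_ln ?posrE ?mulr_gt0 ?powR_gt0 ?c0 ?r0// rub.
  have u2 : ln (c p) / p + ln a + ln m / p <= ln (r p) / p.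
    have -> : ln (c p) / p + ln a + ln m / p = (ln (c p) + (p * ln a + ln m)) / p.
      by field; rewrite gt_eqF.
    have a0 : 0 < a by case/andP: aK.
    rewrite ler_pM2r ?invr_gt0// -ln_powR -!lnM ?posrE ?mulr_gt0 ?powR_gt0 ?c0//.
    by rewrite ler_ln ?posrE ?mulr_gt0 ?powR_gt0 ?c0 ?r0// hm.
  rewrite lna in u2; rewrite !ler_norml in h1 h2 h3.
  rewrite ler_norml; lra.
have E p : p0 <= p -> ((J p) `^ (p * s)^-1)%E = (expR (s^-1 * (ln (r p) / p)))%:E.
  move=> pp0; rewrite Jr// poweR_EFin; congr EFin.
  by rewrite /powR gt_eqF ?r0// invfM; congr expR; ring.
have -> : K `^ s^-1 = expR (s^-1 * ln K) by rewrite /powR gt_eqF.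
apply: (@cvg_trans _ ((expR (s^-1 * (ln (r p) / p)))%:E @[p --> +oo])).
  apply: near_eq_cvg; near=> p; apply/esym/E.
  by near: p; apply: nbhs_pinfty_ge; exact: num_real.
apply: cvg_EFin; first exact: nearW.
apply: (@cvg_comp _ _ _ _ expR) ; last exact: continuous_expR.
exact: cvgMl_tmp.
Unshelve. all: by end_near. Qed.

End root_limit.

Section volume_limit.
Context {R : realType} {n : nat}.
Implicit Types (g : 'rV[R]_n -> \bar R) (xi : 'rV[R]_n).

Definition homogeneous g :=
  forall (t : R) xi, 0 < t -> (g (t *: xi) = t%:E * g xi)%E.

(** By homogeneity, xi lies in the dilate by lambda exactly when g xi <= lambda. If g xi is infinite
    no lambda qualifies, and the infimum of the empty set is +oo as well. *)
Lemma gauge_gauge_body g xi : homogeneous g -> (0 <= g xi)%E ->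
  gauge (gauge_body g) xi = g xi.
Proof.
move=> hg g0.
have E : [set lambda%:E | lambda in
    [set lambda : R | 0 < lambda /\ [set lambda *: y | y in gauge_body g] xi]] =
    [set lambda%:E | lambda in [set lambda : R | 0 < lambda /\ (g xi <= lambda%:E)%E]].
  congr image; apply/seteqP; split => l /= [l0].
    by move=> [y gy <-]; split => //; rewrite hg// -[leRHS]mule1 lee_pmul2l.
  move=> gl; split => //; exists (l^-1 *: xi); last by rewrite scalerA divff ?gt_eqF// scale1r.
  by rewrite /gauge_body/= hg ?invr_gt0// lee_pdivrMl// mule1.
rewrite /gauge E; apply/eqP; rewrite eq_le; apply/andP; split; last first.
  by apply: le_ereal_inf_tmp => _ [l [_ gl] <-].
case: (g xi) g0 => [r r0|_|//]; last by rewrite leey.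
(* The value r itself may be 0, which is not an admissible dilation factor; r + e always is. *)
apply/lee_addgt0Pr => e e0; apply: ereal_inf_lbound; exists (r + e) => //=.
rewrite lee_fin in r0; split; first by rewrite ltr_wpDl.
by rewrite lee_fin lerDl ltW.
Qed.

Lemma sphere_measure_lty : (@sphere_measure R n esphere < +oo)%E.
Proof.
rewrite /sphere_measure; apply: lte_mul_pinfty => //.
apply: le_lt_trans (lebesgue_rV_cube_lty (0 : 'rV[R]_n) 2).
apply: le_measure; rewrite ?inE//; last 2 first.
- exact: measurable_cube.
- move=> x [/andP[_ x1] _] i; rewrite /= in_itv/= mxE sub0r add0r -ltr_norml.
  by rewrite (le_lt_trans (coord_le_enorm _ _))// (le_lt_trans x1)// ltr1n.
apply: measurableI; first exact: measurable_punctured_ball.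
rewrite -[X in measurable X]setTI; apply: measurable_normalizev => //.
exact: measurable_esphere.
Qed.

(** The lower bound c gives the constant majorant c^-n, integrable because the sphere has finite
    measure. Finiteness allows the limit of the inverse powers to be taken in R, and measurability
    of the limit gauge comes from the convergence. *)
Lemma volume_cvg (g_ : nat -> 'rV[R]_n -> \bar R) (g : 'rV[R]_n -> \bar R) (c : R) :
  0 < c -> (forall k, homogeneous (g_ k)) -> homogeneous g ->
  (forall k, measurable_fun esphere (g_ k)) ->
  (forall k xi, enorm xi = 1 -> (c%:E <= g_ k xi < +oo)%E) ->
  (forall xi, enorm xi = 1 -> g xi \is a fin_num) ->
  (forall xi, enorm xi = 1 -> g_ k xi @[k --> \oo] --> g xi) ->
  volume (gauge_body (g_ k)) @[k --> \oo] --> volume (gauge_body g).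
Proof.
move=> c0 hg_ hg mg_ bg_ fg cg.
have E_ k xi : enorm xi = 1 ->
    ((gauge (gauge_body (g_ k)) xi ^+ n)^-1)%E = ((fine (g_ k xi) ^+ n)^-1)%:E /\
    c <= fine (g_ k xi).
  move=> xi1; have /andP[h1 h2] := bg_ k xi xi1.
  have g0 : (0 <= g_ k xi)%E by rewrite (le_trans _ h1)// lee_fin ltW.
  have fin : g_ k xi \is a fin_num by rewrite ge0_fin_numE.
  have cf : c <= fine (g_ k xi) by rewrite -lee_fin fineK.
  split => //; rewrite gauge_gauge_body// -{1}(fineK fin) -EFin_expe inver.
  by rewrite gt_eqF// exprn_gt0// (lt_le_trans c0).
have cfg xi : enorm xi = 1 -> c <= fine (g xi).
  move=> xi1; rewrite -lee_fin fineK ?fg//.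
  apply: (cvge_to_ge (cg xi xi1)).
  by apply: nearW => k /=; have /andP[] := bg_ k xi xi1.
have E xi : enorm xi = 1 ->
    ((gauge (gauge_body g) xi ^+ n)^-1)%E = ((fine (g xi) ^+ n)^-1)%:E.
  move=> xi1; have g0 : (0 <= g xi)%E.
    by rewrite -(fineK (fg _ xi1)) lee_fin (le_trans (ltW c0))// cfg.
  rewrite gauge_gauge_body// -{1}(fineK (fg _ xi1)) -EFin_expe inver.
  by rewrite gt_eqF// exprn_gt0// (lt_le_trans c0)// cfg.
have mS := @measurable_esphere R n.
have mf_ k : measurable_fun esphere (fun xi => ((fine (g_ k xi) ^+ n)^-1)%:E).
  apply/measurable_EFinP.
  apply: (@eq_measurable_fun _ _ _ _ _ (fun xi => (fine (g_ k xi) ^+ n) `^ (-1))).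
    move=> xi; rewrite inE => /(E_ k)[_ hc].
    by rewrite powR_inv1// exprn_ge0// (le_trans (ltW c0)).
  apply: (@measurableT_comp _ _ _ _ _ _ (fun r : R => r `^ (-1))); first exact: measurable_powR.
  by apply: measurable_funX; exact: measurableT_comp.
have cf xi : enorm xi = 1 ->
    ((fine (g_ k xi) ^+ n)^-1)%:E @[k --> \oo] --> ((fine (g xi) ^+ n)^-1)%:E.
  move=> xi1; apply: cvg_EFin; first exact: nearW.
  apply: cvgV; first by rewrite gt_eqF// exprn_gt0// (lt_le_trans c0)// cfg.
  apply: (@cvg_comp _ _ _ _ (fun r : R => r ^+ n)); last exact: exprn_continuous.
  by apply: fine_cvg; rewrite fineK ?fg//; exact: cg.
have mf : measurable_fun esphere (fun xi => ((fine (g xi) ^+ n)^-1)%:E).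
  exact: (emeasurable_fun_cvg (fun k xi => ((fine (g_ k xi) ^+ n)^-1)%:E)).
have icst : (@sphere_measure R n).-integrable esphere (fun=> ((c ^+ n)^-1)%:E).
  apply/integrableP; split => //.
  rewrite integral_cst//= lte_mul_pinfty// ?ltry//.
  exact: sphere_measure_lty.
have := @dominated_convergence _ _ _ (@sphere_measure R n) _ mS _ _ _ mf_ mf
  (aeW _ cf) icst.
case.
  apply: aeW => xi k xi1; have [_ hc] := E_ k xi xi1.
  rewrite lee_fin ger0_norm ?invr_ge0 ?exprn_ge0 ?(le_trans (ltW c0))//.
  by rewrite lef_pV2 ?posrE ?exprn_gt0 ?(lt_le_trans c0)// lerXn2r// nnegrE ltW// (lt_le_trans c0).
move=> intg _ lim.
have V : volume (gauge_body g) = ((n%:R^-1)%:E * \int[sphere_measure]_(xi in esphere) ((fine (g xi) ^+ n)^-1)%:E)%E.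
  by congr (_ * _)%E; apply: eq_integral => xi; rewrite inE => /E.
have V_ k : volume (gauge_body (g_ k)) = ((n%:R^-1)%:E * \int[sphere_measure]_(xi in esphere) ((fine (g_ k xi) ^+ n)^-1)%:E)%E.
  by congr (_ * _)%E; apply: eq_integral => xi; rewrite inE => /(E_ k)[].
rewrite V; under eq_fun do rewrite V_.
exact: cvgeZl.
Qed.

End volume_limit.

Section sobolev_W11.
Context {R : realType} {n : nat} (f : 'rV[R]_n -> R).
Local Notation mu := (@lebesgue_rV R n).

Lemma measurable_fun_locally_integrable (g : 'rV[R]_n -> R) :
  locally_integrable_rV g -> measurable_fun setT g.
Proof.
move=> lg.
pose K (k : nat) : set 'rV[R]_n := box (fun=> `[- k%:R, k%:R]%classic).
have -> : [set: 'rV[R]_n] = \bigcup_k K k.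
  apply/seteqP; split => // x _; exists (Num.truncn `|x|).+1 => // i.
  rewrite /= in_itv/= -ler_norml (le_trans (coord_le_norm _ _))//.
  exact/ltW/truncnS_gt.
have mK k : measurable (K k) by apply: measurable_box => i; exact: measurable_itv.
apply/measurable_fun_bigcup => // k.
have cK : compact (K k).
  by apply: (@rV_compact R n (fun=> `[- k%:R, k%:R]%classic)) => i; exact: segment_compact.
by have /integrableP[/measurable_EFinP] := lg _ cK.
Qed.

(** Existence of a weak gradient makes the chosen representative a genuine one. Its coordinates are
    measurable by local integrability and dominated by the integrable Euclidean norm. *)
Lemma W11_integrable : W1 1%E f ->
  [/\ mu.-integrable setT (EFin \o f), is_weak_gradient f (weak_gradient f) &
    forall i, mu.-integrable setT (EFin \o (fun x => weak_gradient f x ord0 i))].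
Proof.
move=> [f1 exG G1].
have wG : is_weak_gradient f (weak_gradient f).
  exact: (xgetPex (cst 0) exG).
split => //; first exact/Lfun1_integrable.
move=> i; have /Lfun1_integrable iG := G1.
apply: (le_integrable measurableT _ _ iG).
  by apply/measurable_EFinP; apply: measurable_fun_locally_integrable; exact: wG.1.
move=> x _ /=; rewrite lee_fin (ger0_norm (enorm_ge0 _)).
exact: coord_le_enorm.
Qed.

End sobolev_W11.

(** * Gauges of the gradient and their limit in p *)

Section polar_gauge_limit.
Context {R : realType} {n : nat} (f : 'rV[R]_n -> R).
Local Notation mu := (@lebesgue_rV R n).
Hypothesis n_gt0 : (0 < n)%N.
Hypothesis intf : mu.-integrable setT (EFin \o f).
Hypothesis wG : is_weak_gradient f (weak_gradient f).
Hypothesis intG : forall i, mu.-integrable setT (EFin \o (fun x => weak_gradient f x ord0 i)).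
Hypothesis lipf : euclidean_lipschitz f.
Hypothesis f_neq0 : exists x, f x != 0.

Let h xi x := dotv (weak_gradient f x) xi.
Let cf : continuous f := lipschitz_continuous lipf.
Let inth xi : mu.-integrable setT (EFin \o h xi) := integrable_dotv intG xi.
Let mh xi : measurable_fun setT (h xi).
Proof. by have /integrableP[/measurable_EFinP] := inth xi. Qed.

Let mhp xi p : measurable_fun setT (fun x => (`|h xi x| `^ p)%:E).
Proof.
apply/measurable_EFinP.
apply: (@measurableT_comp _ _ _ _ _ _ (fun r : R => r `^ p)); first exact: measurable_powR.
exact: measurableT_comp.
Qed.

(** On a null space the essential supremum of a nonnegative function would be -oo, not
    nonnegative. *)
Lemma lebesgue_rV_setT_gt0 : (0 < mu setT)%E.
Proof.
apply: lt_le_trans (lebesgue_rV_cube_gt0 (0 : 'rV[R]_n) (@ltr01 R)) _.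
by apply: le_measure; rewrite ?inE//; exact: measurable_cube.
Qed.

Lemma polar_gauge_oo_ge0 xi : (0 <= polar_gauge_oo f xi)%E.
Proof.
apply: (ess_sup_gee lebesgue_rV_setT_gt0).
by apply: aeW => x; rewrite lee_fin.
Qed.

Lemma polar_gauge_oo_le xi D :
  (forall x t, 0 < t -> `|f (x + t *: xi) - f x| <= D * t) ->
  (polar_gauge_oo f xi <= D%:E)%E.
Proof.
move=> hD; apply/ess_supP.
have := abs_dotv_le_of_lipschitz_along intf intG wG hD.
by apply: filterS => x; rewrite lee_fin.
Qed.

Lemma polar_gauge_oo_fin xi : polar_gauge_oo f xi \is a fin_num.
Proof.
rewrite ge0_fin_numE ?polar_gauge_oo_ge0//.
have [L L0 hL] := lipschitz_const lipf.
apply: le_lt_trans (ltry (L * enorm xi)).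
apply: polar_gauge_oo_le => x t t0.
rewrite (le_trans (hL _ _))// [x + _]addrC addrK enormZ gtr0_norm//.
by rewrite mulrA mulrAC.
Qed.

Let M xi := fine (polar_gauge_oo f xi).

Let M0 xi : 0 <= M xi. Proof. exact/fine_ge0/polar_gauge_oo_ge0. Qed.

Lemma ae_dotv_le xi : {ae mu, forall x, `|h xi x| <= M xi}.
Proof.
have := ess_sup_ge mu (fun x => `|h xi x|%:E).
apply: filterS => x; rewrite -lee_fin fineK//.
exact: polar_gauge_oo_fin.
Qed.

Lemma difference_le_polar_gauge_oo xi x t : 0 <= t ->
  `|f (x + t *: xi) - f x| <= M xi * t.
Proof. by move=> t0; exact: (lipschitz_along cf intf intG wG _ t0 (M0 xi) (ae_dotv_le xi)). Qed.

Lemma homogeneous_polar_gauge_oo : homogeneous (polar_gauge_oo f).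
Proof.
move=> t xi t0; rewrite /polar_gauge_oo -ess_sup_pZl//; congr ess_sup.
by apply/funext => x; rewrite dotvZr normrM gtr0_norm//.
Qed.

Lemma homogeneous_polar_gauge p : 0 < p -> homogeneous (polar_gauge p f).
Proof.
move=> p0 t xi t0; rewrite /polar_gauge.
under eq_integral => x _ do rewrite dotvZr normrM (gtr0_norm t0) powRM ?(ltW t0)// EFinM.
rewrite ge0_integralZl_EFin//; last 2 first.
- exact: mhp.
- exact: powR_ge0.
rewrite poweRM ?lee_fin ?powR_ge0//; last by apply: integral_ge0 => x _; rewrite lee_fin powR_ge0.
by rewrite poweR_EFin -powRrM mulfV ?gt_eqF// powRr1// ltW.
Qed.

Lemma measurable_polar_gauge p : measurable_fun setT (polar_gauge p f).
Proof.
rewrite /polar_gauge.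
apply: (@measurableT_comp _ _ _ _ _ _ (fun x : \bar R => x `^ p^-1)%E); first exact: measurable_poweR.
apply: (@measurable_fun_fubini_tonelli_F _ _ _ _ _ mu
  (fun z : 'rV[R]_n * 'rV[R]_n => (`|h z.1 z.2| `^ p)%:E)); last first.
  by move=> z; rewrite lee_fin powR_ge0.
apply/measurable_EFinP.
apply: (@measurableT_comp _ _ _ _ _ _ (fun r : R => r `^ p)); first exact: measurable_powR.
apply: measurableT_comp => //; rewrite /h /dotv.
apply: measurable_sum => i; apply: measurable_funM.
  have mGi : measurable_fun setT (fun x => weak_gradient f x ord0 i).
    by have /integrableP[/measurable_EFinP] := intG i.
  exact: (measurableT_comp mGi measurable_snd).
exact: (measurableT_comp (measurable_coord i) measurable_fst).
Qed.

(* Uniformly in xi, sup_s int |<grad f, xi>| phi(. - s xi) is at least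
   (a / T) int phi; the inequality |y| <= e^(1-p) |y|^p + e with e = a / (2T)
   turns this into a bound on the L^p norm that does not degenerate as p grows. *)
Lemma polar_gauge_lower_bound : exists2 c, 0 < c & forall p xi, 1 <= p -> enorm xi = 1 ->
  (c%:E <= polar_gauge p f xi)%E /\ (c%:E <= polar_gauge_oo f xi)%E.
Proof.
have [x0 [a [r [T [a0 r0 T0 far]]]]] := far_difference intf lipf n_gt0 f_neq0.
pose al i := x0 ord0 i - r; pose be i := x0 ord0 i + r.
have ab i : al i < be i by rewrite /al /be ltrBlDr -addrA ltrDl addr_gt0.
pose phi := tensor (box_bump 1 al be).
have bu := box_bumpP al be (@ltr01 R).
have I0 := Rintegral_tensor_box_bump_gt0 (@ltr01 R) ab.
have iphi := integrable_tensor_box_bump al be (@ltr01 R).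
rewrite -/phi in I0 iphi; set I := (\int[mu]_x phi x) in I0.
(* Integrating the far increment at time T against phi gives at least a I, while the mean value
   theorem gives at most T K. *)
have key xi K : enorm xi = 1 ->
    (forall s, `|\int[mu]_x (h xi x * phi (x - s *: xi))| <= K) -> a * I <= T * K.
  move=> xi1 hK.
  have h1 := difference_tensor_le intf intG wG bu (ltW T0) hK.
  apply: le_trans h1; rewrite -RintegralZl// -normrN.
  have [C hC] := tensor_bounded bu; have mt := tensor_measurable bu.
  have i1 : mu.-integrable setT (EFin \o (fun x => (f (x + T *: xi) - f x) * phi x)).
    exact: integrable_mul_bounded (integrable_difference intf (T *: xi)) mt hC.
  have sg1 : `|Num.sg (f x0)| <= 1 by rewrite normr_sg lern1 leq_b1.
  apply: (@le_trans _ _ `|Num.sg (f x0) * - \int[mu]_x ((f (x + T *: xi) - f x) * phi x)|); last first.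
    by rewrite normrM -[leRHS]mul1r ler_wpM2r.
  apply: le_trans (ler_norm _).
  rewrite mulrN -mulNr -RintegralZl//; apply: le_Rintegral => //.
  - exact: (integrableZl measurableT a iphi).
  - exact: (integrableZl measurableT _ i1).
  move=> x _; have [hx|hx] := pselect (cube x0 r x); last first.
    by rewrite /phi tensor_box_bump_eq0// !mulr0.
  rewrite mulrA ler_wpM2r ?tensor_box_bump_ge0// (le_trans (far xi x T xi1 hx (lexx T)))//.
  by rewrite mulNr -mulrN opprB.
pose e := a / (T * 2); have e0 : 0 < e by rewrite divr_gt0// mulr_gt0.
(* The energy will be at least I e^p, and the p-th root of I is at least min(1, I) for every p >=
   1. *)
pose c := Num.min 1 I * e.
have c0 : 0 < c by rewrite mulr_gt0// lt_min ltr01.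
exists c => // p xi p1 xi1; split; last first.
  have h1 : a * I <= T * (M xi * I).
    apply: (key xi) => // s.
    exact: (dotv_tensor_le intG al be (s *: xi) (@ltr01 R) (M0 xi) (ae_dotv_le xi)).
  have h2 : a <= T * M xi by rewrite mulrA in h1; rewrite -(ler_pM2r I0).
  rewrite -(fineK (polar_gauge_oo_fin xi)) lee_fin -/(M xi).
  rewrite (@le_trans _ _ e)//; first by rewrite /c ler_piMl ?(ltW e0)// ge_min lexx.
  rewrite /e ler_pdivrMr ?mulr_gt0// (le_trans h2)// mulrC mulrA ler_peMr ?ler1n//.
  by rewrite mulr_ge0// ltW.
have p0 : 0 < p by exact: lt_le_trans p1.
set J := (\int[mu]_x (`|h xi x| `^ p)%:E)%E.
have J0 : (0 <= J)%E by apply: integral_ge0 => x _; rewrite lee_fin powR_ge0.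
have [Joo|JE] : J = +oo%E \/ J = (fine J)%:E.
  case: (J) J0 => [r'||]; by [right|left|].
  by rewrite /polar_gauge -/J Joo poweRyr ?leey// invr_neq0// gt_eqF.
have iJ : mu.-integrable setT (EFin \o (fun x => `|h xi x| `^ p)).
  apply/integrableP; split; first exact: mhp.
  under eq_integral do rewrite /= ger0_norm ?powR_ge0//.
  by rewrite -/J JE ltry.
have young y : `|y| <= e `^ (1 - p) * `|y| `^ p + e :> R.
  have [ye|ye] := leP `|y| e; first by rewrite ler_wpDl// mulr_ge0// powR_ge0.
  rewrite ler_wpDr ?(ltW e0)//.
  have -> : e `^ (1 - p) = (e `^ (p - 1))^-1 by rewrite -powRN opprB.
  rewrite -ler_pdivrMl ?invr_gt0 ?powR_gt0// invrK mulrC.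
  have -> : `|y| `^ p = `|y| * `|y| `^ (p - 1).
    by rewrite -[X in X * _]powRr1// -powRD ?subrKC//; apply/implyP; rewrite gt_eqF.
  rewrite ler_wpM2l// ge0_ler_powR ?subr_ge0// ?nnegrE// ltW//.
have hK s : `|\int[mu]_x (h xi x * phi (x - s *: xi))| <= e `^ (1 - p) * fine J + e * I.
  have i1 := integrable_mul_tensor (s *: xi) (inth xi) bu.
  rewrite (le_trans (le_normr_Rintegral _ i1))//.
  have -> : I = \int[mu]_x phi (x - s *: xi) by rewrite Rintegral_tensor_shift.
  have -> : fine J = \int[mu]_x (`|h xi x| `^ p) by [].
  have i2 : mu.-integrable setT (EFin \o (fun x => phi (x - s *: xi))).
    rewrite /phi; under [X in _.-integrable _ (_ \o X)]eq_fun do rewrite tensor_box_bump_shift.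
    exact: integrable_tensor_box_bump.
  rewrite -RintegralZl// -[X in _ + X]RintegralZl// -RintegralD//; last 2 first.
  - exact: (integrableZl measurableT _ iJ).
  - exact: (integrableZl measurableT _ i2).
  apply: le_Rintegral => //; first exact: integrable_norm.
    exact: (integrableD measurableT (integrableZl measurableT _ iJ) (integrableZl measurableT _ i2)).
  move=> x _; rewrite normrM (ger0_norm (tensor_box_bump_ge0 _ _ _ _)) -/phi.
  apply: (@le_trans _ _ ((e `^ (1 - p) * `|h xi x| `^ p + e) * phi (x - s *: xi))).
    by rewrite ler_wpM2r ?tensor_box_bump_ge0.
  rewrite mulrDl lerD2r -[leRHS]mulr1 ler_wpM2l ?tensor_box_bump_le1//.
  by rewrite mulr_ge0// powR_ge0.
have h1 := key _ _ xi1 hK.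
have h2 : I * e `^ p <= fine J.
  (* The term T e I absorbs exactly half of a I; the other half bounds the energy from below. *)
  have E1 : T * e = a / 2 by rewrite /e; field; rewrite gt_eqF.
  have h3 : T * (e * I) <= T * (e `^ (1 - p) * fine J).
    have E2 : T * (e * I) = a / 2 * I by rewrite mulrA E1.
    rewrite mulrDr E2 in h1; rewrite E2; lra.
  have h4 : e * I <= e `^ (1 - p) * fine J by rewrite -(ler_pM2l T0).
  have e1p : e `^ (1 - p) = e / e `^ p.
    rewrite powRD; last by apply/implyP => _; rewrite gt_eqF.
    by rewrite powRr1 ?(ltW e0)// powRN.
  rewrite e1p -mulrA ler_pM2l// in h4.
  by rewrite mulrC -ler_pdivlMl ?powR_gt0.
rewrite /polar_gauge -/J JE poweR_EFin lee_fin.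
apply: (@le_trans _ _ ((I * e `^ p) `^ p^-1)); last first.
  by rewrite ge0_ler_powR ?invr_ge0 ?(ltW p0)// nnegrE ?fine_ge0// mulr_ge0 ?powR_ge0// ltW.
rewrite powRM ?powR_ge0 ?(ltW I0)// -powRrM mulfV ?gt_eqF// powRr1 ?(ltW e0)//.
rewrite ler_wpM2r ?(ltW e0)//.
have [I1|I1] := leP 1 I.
  have := @ge0_ler_powR R p^-1; rewrite invr_ge0 (ltW p0) => /(_ isT 1 I).
  by rewrite !nnegrE ler01 (ltW I0) I1 powR1; exact.
rewrite -[leLHS]powRr1 ?(ltW I0)// ger_powR ?I0 ?(ltW I1)//.
by rewrite invf_le1.
Qed.

Lemma ereal_gt0_exists (x : \bar R) : (0 < x)%E -> exists2 m : R, 0 < m & (m%:E <= x)%E.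
Proof.
by case: x => [r||]//; [exists r|exists 1; rewrite ?leey].
Qed.

(** Almost everywhere |h|^p <= M^(p-1) |h|, and h is integrable, so the base exponent can be 1. *)
Lemma polar_energy_le xi p : 1 <= p ->
  (\int[mu]_x (`|h xi x| `^ p)%:E <= (M xi `^ (p - 1) * \int[mu]_x `|h xi x|)%:E)%E.
Proof.
move=> p1; have p0 : p != 0 by rewrite gt_eqF// (lt_le_trans _ p1).
have in1 := integrable_norm (inth xi).
apply: (@le_trans _ _ (\int[mu]_x (M xi `^ (p - 1) * `|h xi x|)%:E)%E).
  apply: ae_ge0_le_integral => //.
  - by move=> x _; rewrite lee_fin mulr_ge0// powR_ge0.
  - by apply/measurable_EFinP/measurable_funM => //; exact: measurableT_comp.
  have := ae_dotv_le xi; apply: filterS => x hx _; rewrite lee_fin.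
  rewrite -[X in _ * X]powRr1//.
  have -> : `|h xi x| `^ p = `|h xi x| `^ (p - 1) * `|h xi x| `^ 1.
    by rewrite -powRD ?subrK//; apply/implyP; rewrite (negbTE p0).
  by rewrite ler_wpM2r ?powR_ge0// ge0_ler_powR ?subr_ge0// nnegrE.
under eq_integral do rewrite EFinM.
rewrite ge0_integralZl_EFin//; last 2 first.
- by apply/measurable_EFinP; exact: measurableT_comp.
- exact: powR_ge0.
rewrite EFinM; have -> : (\int[mu]_x `|h xi x|%:E = (\int[mu]_x `|h xi x|)%:E)%E; last by [].
by rewrite fineK//; exact: (integrable_fin_num measurableT in1).
Qed.

Lemma polar_gauge_lty xi p : 1 <= p -> (polar_gauge p f xi < +oo)%E.
Proof. by move=> p1; rewrite poweR_lty// (le_lt_trans (polar_energy_le xi p1))// ltry. Qed.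

Lemma polar_gauge_cvg xi : enorm xi = 1 ->
  polar_gauge p f xi @[p --> +oo] --> polar_gauge_oo f xi.
Proof.
move=> xi1; have [c c0 hc] := polar_gauge_lower_bound.
have M_gt0 : 0 < M xi.
  have [_] := hc 1 xi (lexx 1) xi1.
  by rewrite -(fineK (polar_gauge_oo_fin xi)) lee_fin; exact: lt_le_trans.
have -> : polar_gauge_oo f xi = ((M xi) `^ 1^-1)%:E.
  by rewrite invr1 powRr1// fineK// polar_gauge_oo_fin.
rewrite (_ : polar_gauge ^~ f ^~ xi = fun p => ((\int[mu]_x (`|h xi x| `^ p)%:E) `^ (p * 1)^-1)%E); last first.
  by apply/funext => p; rewrite mulr1.
pose I0 := \int[mu]_x `|h xi x| + 1.
have I00 : 0 < I0 by rewrite ltr_wpDl// Rintegral_ge0.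
apply: (@cvg_root _ _ (fun=> 1) _ 1 I0) => //.
- rewrite ln1; under eq_fun do rewrite mul0r; exact: cvg_cst.
- move=> p p1; rewrite mul1r; apply: le_trans (polar_energy_le xi p1) _.
  by rewrite lee_fin ler_wpM2l ?powR_ge0// lerDl.
- move=> a /andP[a0 aM].
  pose E := [set x | a < `|h xi x|].
  have mE : measurable E.
    rewrite /E -[X in measurable X]setTI.
    have -> : [set x : 'rV[R]_n | a < `|h xi x|] = (fun x => `|h xi x|) @^-1` `]a, +oo[.
      by apply/seteqP; split => x /=; rewrite in_itv/= andbT.
    have mn : measurable_fun setT (fun x => `|h xi x|) by exact: measurableT_comp.
    exact: mn.
  have E0 : (0 < mu E)%E.
    rewrite lt_neqAle measure_ge0 andbT; apply/eqP => /esym E0.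
    have : (polar_gauge_oo f xi <= a%:E)%E.
      apply/ess_supP; exists E; split => // x /=.
      by rewrite lee_fin => /negP; rewrite -ltNge.
    by rewrite -(fineK (polar_gauge_oo_fin xi)) lee_fin leNgt aM.
  (* The set where |h| > a may have infinite measure, whereas [cvg_root] needs a real m. *)
  have [m m0 mE'] := ereal_gt0_exists E0.
  exists m => // p p1; rewrite mul1r.
  apply: (@le_trans _ _ (\int[mu]_(x in E) (`|h xi x| `^ p)%:E)%E); last first.
    exact: ge0_subset_integral.
  apply: (@le_trans _ _ (\int[mu]_(x in E) (a `^ p)%:E)%E).
    by rewrite integral_cst// EFinM lee_wpmul2l// lee_fin powR_ge0.
  apply: ge0_le_integral => //.
  + by move=> x _; rewrite lee_fin powR_ge0.
  + exact: measurable_funS (mhp xi p).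
  move=> x Ex; rewrite lee_fin ge0_ler_powR ?nnegrE ?(ltW a0)//.
    exact: le_trans p1.
  exact: ltW.
Qed.

End polar_gauge_limit.

Lemma powR_le1 (R : realType) (x e : R) : 0 <= x -> x <= 1 -> 0 <= e -> x `^ e <= 1.
Proof.
move=> x0 x1 e0; have := ge0_ler_powR e0 x0 (ler01 : (1:R) \in Num.nneg) x1.
by rewrite powR1.
Qed.

Lemma powR_ge1 (R : realType) (x e : R) : 1 <= x -> 0 <= e -> 1 <= x `^ e.
Proof.
move=> x1 e0; have x0 : x \in Num.nneg by rewrite nnegrE (le_trans ler01).
by have := ge0_ler_powR e0 (ler01 : (1:R) \in Num.nneg) x0 x1; rewrite powR1.
Qed.

(** * Fractional gauges *)

Section frac_polar_gauge_limit.
Context {R : realType} {n : nat} (f : 'rV[R]_n -> R).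
Local Notation mu := (@lebesgue_rV R n).
Local Notation leb := (@lebesgue_measure R).
Hypothesis n_gt0 : (0 < n)%N.
Hypothesis intf : mu.-integrable setT (EFin \o f).
Hypothesis lipf : euclidean_lipschitz f.
Hypothesis f_neq0 : exists x, f x != 0.

Let mf : measurable_fun setT f.
Proof. by have /integrableP[/measurable_EFinP] := intf. Qed.

Definition increment_integral (p : R) (xi : 'rV[R]_n) (t : R) : \bar R :=
  (\int[mu]_x (`|f (x + t *: xi) - f x| `^ p)%:E)%E.

Lemma increment_integral_ge0 p xi t : (0 <= increment_integral p xi t)%E.
Proof. by apply: integral_ge0 => x _; rewrite lee_fin powR_ge0. Qed.

Lemma measurable_increment_integral p : measurable_fun setT
  (fun z : 'rV[R]_n * measurableTypeR R => increment_integral p z.1 z.2).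
Proof.
apply: (@measurable_fun_fubini_tonelli_F _ _ _ _ _ mu
  (fun z : ('rV[R]_n * measurableTypeR R) * 'rV[R]_n =>
     (`|f (z.2 + z.1.2 *: z.1.1) - f z.2| `^ p)%:E)); last first.
  by move=> z; rewrite lee_fin powR_ge0.
apply/measurable_EFinP.
apply: (@measurableT_comp _ _ _ _ _ _ (fun r : R => r `^ p)); first exact: measurable_powR.
apply: measurableT_comp => //; apply: measurable_funB; last exact: (measurableT_comp mf measurable_snd).
apply: (measurableT_comp mf); apply/measurable_fun_rVP => i.
under eq_fun do rewrite !mxE.
apply: measurable_funD.
  exact: (measurableT_comp (measurable_coord i) measurable_snd).
apply: measurable_funM.
  exact: (measurableT_comp measurable_snd measurable_fst).
exact: (measurableT_comp (measurable_coord i) (measurableT_comp measurable_fst measurable_fst)).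
Qed.

Lemma measurable_increment_fun p xi (t : R) :
  measurable_fun setT (fun x : 'rV[R]_n => (`|f (x + t *: xi) - f x| `^ p)%:E).
Proof.
apply/measurable_EFinP.
apply: (@measurableT_comp _ _ _ _ _ _ (fun r : R => r `^ p)); first exact: measurable_powR.
apply: measurableT_comp => //; apply: measurable_funB => //.
exact: (measurableT_comp mf (measurable_addv (t *: xi))).
Qed.

Definition frac_integrand (s p : R) (xi : 'rV[R]_n) (t : R) : \bar R :=
  ((t `^ (- (p * s) - 1))%:E * increment_integral p xi t)%E.

Lemma frac_integrand_ge0 s p xi t : (0 <= frac_integrand s p xi t)%E.
Proof. by rewrite mule_ge0// ?increment_integral_ge0// lee_fin powR_ge0. Qed.

Lemma measurable_frac_integrand s p : measurable_fun setT
  (fun z : 'rV[R]_n * measurableTypeR R => frac_integrand s p z.1 z.2).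
Proof.
apply: emeasurable_funM; last exact: measurable_increment_integral.
apply/measurable_EFinP.
apply: (@measurableT_comp _ _ _ _ _ _ (fun r : R => r `^ (- (p * s) - 1))).
  exact: measurable_powR.
exact: measurable_snd.
Qed.

Lemma measurable_frac_integrand_time s p xi :
  measurable_fun setT (frac_integrand s p xi : measurableTypeR R -> \bar R).
Proof.
exact: (measurableT_comp (measurable_frac_integrand s p) (pair1_measurable xi)).
Qed.

Definition frac_energy (s p : R) xi : \bar R :=
  (\int[leb]_(t in `]0%R, +oo[) frac_integrand s p xi t)%E.

Lemma frac_energy_ge0 s p xi : (0 <= frac_energy s p xi)%E.
Proof. by apply: integral_ge0 => t _; exact: frac_integrand_ge0. Qed.

Lemma frac_polar_gaugeE s p xi :
  frac_polar_gauge s p f xi = (((p * (1 - s))%:E * frac_energy s p xi) `^ (p * s)^-1)%E.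
Proof. by []. Qed.

Lemma measurable_frac_polar_gauge s p : measurable_fun setT (frac_polar_gauge s p f).
Proof.
rewrite /frac_polar_gauge.
apply: (@measurableT_comp _ _ _ _ _ _ (fun x : \bar R => x `^ (p * s)^-1)%E); first exact: measurable_poweR.
apply: measurable_funeM.
rewrite (_ : (fun x => _) = (fun xi => \int[leb]_t
    (frac_integrand s p xi t * (\1_(`]0%R, +oo[%classic : set R) t)%:E)%E)%E); last first.
  apply/funext => xi; rewrite integral_mkcond; apply: eq_integral => t _.
  by rewrite epatch_indic.
apply: (@measurable_fun_fubini_tonelli_F _ _ _ _ _ leb
  (fun z : 'rV[R]_n * measurableTypeR R =>
    (frac_integrand s p z.1 z.2 * (\1_(`]0%R, +oo[%classic : set R) z.2)%:E)%E)); last first.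
  by move=> z; rewrite mule_ge0 ?frac_integrand_ge0// lee_fin.
apply: emeasurable_funM; first exact: measurable_frac_integrand.
apply/measurable_EFinP.
have mi : measurable_fun setT (\1_(`]0%R, +oo[%classic : set R) : measurableTypeR R -> R).
  by apply: measurable_indic; exact: measurable_itv.
exact: (measurableT_comp mi measurable_snd).
Qed.

(** Substituting l t for t, the Jacobian l and the weight (l t)^(-ps-1) combine to l^(-ps). *)
Lemma frac_energy_scale s p xi l : 0 < l ->
  frac_energy s p (l *: xi) = ((l `^ (p * s))%:E * frac_energy s p xi)%E.
Proof.
move=> l0; rewrite [in RHS]/frac_energy.
have m1 := measurable_frac_integrand_time s p xi.
rewrite (ge0_integral_affine 0 l0)//; last 2 first.
- exact: measurable_funS m1.
- by move=> t; exact: frac_integrand_ge0.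
have -> : [set x | `]0, +oo[%classic (l * x + 0)] = `]0, +oo[%classic.
  by apply/seteqP; split => t /=; rewrite !in_itv/= !andbT addr0 pmulr_rgt0.
rewrite muleA -EFinM -ge0_integralZl_EFin//; last 3 first.
- by move=> t _; exact: frac_integrand_ge0.
- rewrite (_ : (fun t => _) = (frac_integrand s p xi : measurableTypeR R -> \bar R) \o affine l 0)//.
  apply: measurable_funS (measurableT_comp m1 (measurable_affine l 0)) => //.
- by rewrite mulr_ge0 ?powR_ge0// ltW.
apply: eq_integral => t; rewrite inE/= in_itv/= andbT => t0.
rewrite addr0 /frac_integrand.
have -> : increment_integral p (l *: xi) t = increment_integral p xi (l * t).
  by apply: eq_integral => x _; rewrite scalerA [t * l]mulrC.
rewrite muleA -EFinM; congr (_%:E * _)%E.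
rewrite powRM ?(ltW l0) ?(ltW t0)// mulrA.
suff -> : l `^ (p * s) * l * l `^ (- (p * s) - 1) = 1 by rewrite mul1r.
have -> : - (p * s) - 1 = - (p * s + 1) by ring.
rewrite powRN powRD; last by apply/implyP => _; rewrite gt_eqF.
by rewrite powRr1 ?(ltW l0)// mulfV// mulf_neq0 ?gt_eqF ?powR_gt0.
Qed.

Lemma homogeneous_frac_polar_gauge s p : 0 < s < 1 -> 0 < p ->
  homogeneous (frac_polar_gauge s p f).
Proof.
move=> /andP[s0 s1] p0 l xi l0; rewrite !frac_polar_gaugeE frac_energy_scale//.
have h0 : (0 <= (p * (1 - s))%:E * frac_energy s p xi)%E.
  by rewrite mule_ge0 ?frac_energy_ge0// lee_fin mulr_ge0 ?(ltW p0)// subr_ge0 ltW.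
have h1 : (0 <= (l `^ (p * s))%:E)%E by rewrite lee_fin powR_ge0.
rewrite muleCA (poweRM _ h1 h0).
by rewrite poweR_EFin -powRrM mulfV ?powRr1 ?(ltW l0)// gt_eqF// mulr_gt0.
Qed.

Lemma difference_lipschitz : exists2 L, 0 < L &
  forall xi x t, enorm xi = 1 -> 0 <= t -> `|f (x + t *: xi) - f x| <= L * t.
Proof.
have [L L0 hL] := lipschitz_const lipf; exists L => // xi x t xi1 t0.
by rewrite (le_trans (hL _ _))// [x + _]addrC addrK enormZ xi1 mulr1 ger0_norm.
Qed.

Lemma difference_bounded : exists2 B, 0 < B & forall xi x t, `|f (x + t *: xi) - f x| <= B.
Proof.
have [B B0 hB] := integrable_lipschitz_bounded intf lipf.
exists (B + B); first by rewrite addr_gt0.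
by move=> xi x t; rewrite (le_trans (ler_normB _ _))// lerD.
Qed.

Definition holder_sup (s : R) xi : \bar R :=
  ereal_sup [set (z.2 `^ (- s) * `|f (z.1 + z.2 *: xi) - f z.1|)%:E
             | z in [set z : 'rV[R]_n * R | 0 < z.2]].

Lemma frac_polar_gauge_ooE s xi :
  frac_polar_gauge_oo s f xi = (holder_sup s xi `^ s^-1)%E.
Proof. by []. Qed.

Lemma holder_sup_ge s xi x t : 0 < t ->
  ((t `^ (- s) * `|f (x + t *: xi) - f x|)%:E <= holder_sup s xi)%E.
Proof. by move=> t0; apply: ereal_sup_ubound; exists (x, t). Qed.

Lemma holder_sup_le s xi (K : \bar R) :
  (forall x t, 0 < t -> ((t `^ (- s) * `|f (x + t *: xi) - f x|)%:E <= K)%E) ->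
  (holder_sup s xi <= K)%E.
Proof. by move=> h; apply: ge_ereal_sup => _ [[x t] /= t0 <-]; exact: h. Qed.

Lemma holder_sup_ge0 s xi : (0 <= holder_sup s xi)%E.
Proof.
apply: le_trans (holder_sup_ge s xi 0 ltr01).
by rewrite lee_fin mulr_ge0// powR_ge0.
Qed.

Lemma holder_sup_scale s xi l : 0 < l ->
  holder_sup s (l *: xi) = ((l `^ s)%:E * holder_sup s xi)%E.
Proof.
move=> l0; rewrite /holder_sup -ereal_sup_pZl ?powR_gt0//; congr ereal_sup.
have E x t : 0 < t -> t `^ (- s) * `|f (x + t *: (l *: xi)) - f x| =
    l `^ s * ((l * t) `^ (- s) * `|f (x + (l * t) *: xi) - f x|).
  move=> t0; rewrite scalerA [t * l]mulrC powRM ?(ltW l0) ?(ltW t0)// !mulrA.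
  by rewrite -[LHS]mul1r !mulrA; congr (_ * _ * _); rewrite powRN mulfV// gt_eqF// powR_gt0.
apply/seteqP; split => y /=.
  move=> [[x t] /= t0 <-]; eexists; first by exists (x, l * t) => //=; rewrite mulr_gt0.
  by rewrite /= E// EFinM.
move=> [_ [[x t] /= t0 <-] <-]; exists (x, l^-1 * t) => /=; first by rewrite mulr_gt0 ?invr_gt0.
by rewrite E ?mulr_gt0 ?invr_gt0// (_ : l * (l^-1 * t) = t) ?EFinM// mulrA divff ?gt_eqF// mul1r.
Qed.

Lemma homogeneous_frac_polar_gauge_oo s : 0 < s -> homogeneous (frac_polar_gauge_oo s f).
Proof.
move=> s0 l xi l0; rewrite !frac_polar_gauge_ooE holder_sup_scale// poweRM; last 2 first.
- by rewrite lee_fin powR_ge0.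
- exact: holder_sup_ge0.
by rewrite poweR_EFin -powRrM mulfV ?powRr1 ?(ltW l0)// gt_eqF.
Qed.

(** For t <= 1 the Lipschitz bound leaves L t^(1-s) <= L; for t > 1 boundedness of f suffices. *)
Lemma holder_sup_lty s xi : 0 < s < 1 -> enorm xi = 1 -> (holder_sup s xi < +oo)%E.
Proof.
move=> /andP[s0 s1] xi1.
have [L L0 hL] := difference_lipschitz; have [B B0 hB] := difference_bounded.
apply: le_lt_trans (ltry (L + B)); apply: holder_sup_le => x t t0; rewrite lee_fin.
have [t1|t1] := leP t 1.
  rewrite (@le_trans _ _ L) ?lerDl ?(ltW B0)//.
  rewrite (@le_trans _ _ (t `^ (- s) * (L * t)))//; first by rewrite ler_wpM2l ?powR_ge0// hL// ltW.
  rewrite mulrCA.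
  have -> : t `^ (- s) * t = t `^ (1 - s).
    rewrite -[X in _ * X = _]powRr1 ?(ltW t0)// -powRD ?[- s + 1]addrC//.
    by apply/implyP => _; rewrite gt_eqF.
  rewrite -[leRHS]mulr1 ler_wpM2l ?(ltW L0)//.
  by rewrite powR_le1 ?(ltW t0)// subr_ge0 ltW.
rewrite (@le_trans _ _ B) ?lerDr ?(ltW L0)//.
rewrite -[leRHS]mul1r ler_pM ?powR_ge0// powRN invf_le1 ?powR_gt0//.
by apply: powR_ge1; exact: ltW.
Qed.

Lemma far_difference_abs : exists (x0 : 'rV[R]_n) (a r T : R), [/\ 0 < a, 0 < r, 0 < T &
    forall xi x t, enorm xi = 1 -> cube x0 r x -> T <= t ->
      a <= `|f (x + t *: xi) - f x|].
Proof.
have [x0 [a [r [T [a0 r0 T0 far]]]]] := far_difference intf lipf n_gt0 f_neq0.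
exists x0, a, r, T; split => // xi x t xi1 hx Tt.
have h1 := far xi x t xi1 hx Tt; have h2 := ler_norm (Num.sg (f x0) * (f x - f (x + t *: xi))).
rewrite normrM distrC in h2; rewrite (le_trans h1)// (le_trans h2)//.
by rewrite -[leRHS]mul1r ler_wpM2r// normr_sg lern1 leq_b1.
Qed.

Lemma holder_sup_gt0 s xi : 0 < s < 1 -> enorm xi = 1 -> 0 < fine (holder_sup s xi).
Proof.
move=> s01 xi1; have [x0 [a [r [T [a0 r0 T0 far]]]]] := far_difference_abs.
have x0c : cube x0 r x0 by move=> i; rewrite /= in_itv/= ltrBlDr ltrDl r0.
have := holder_sup_ge s xi x0 T0.
rewrite -[holder_sup s xi]fineK ?ge0_fin_numE ?holder_sup_ge0 ?holder_sup_lty// lee_fin.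
apply: lt_le_trans; rewrite mulr_gt0 ?powR_gt0//.
exact: lt_le_trans (far xi x0 T xi1 x0c (lexx T)).
Qed.

(** The factor t^(ps) coming from the hypothesis cancels the singular weight up to 1/t, which is at
    least 1/t2 on the interval. Used at large times for a uniform bound and near an almost maximal
    increment for the limit. *)
Lemma frac_energy_lower_bound s p xi (a t1 t2 : R) (x0 : 'rV[R]_n) r :
  0 <= a -> 0 < p -> 0 <= t1 < t2 -> 0 < r ->
  (forall t x, t1 < t < t2 -> cube x0 r x -> a * t `^ s <= `|f (x + t *: xi) - f x|) ->
  ((a `^ p * ((r *+ 2) ^+ n * ((t2 - t1) / t2)))%:E <= frac_energy s p xi)%E.
Proof.
move=> a0 p0 /andP[t10 t12] r0 h.
have t20 : 0 < t2 by exact: le_lt_trans t12.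
have V0 : 0 < (r *+ 2) ^+ n by rewrite exprn_gt0// mulrn_wgt0.
have muV : mu (cube x0 r) = ((r *+ 2) ^+ n)%:E.
  rewrite lebesgue_rV_openbox; last by move=> i; rewrite ltrBlDr -addrA ltrDl addr_gt0.
  rewrite (eq_bigr (fun=> r *+ 2)) ?prodr_const ?card_ord// => i _.
  by rewrite mulr2n; ring.
have mC := measurable_cube x0 r.
have inner t : t1 < t < t2 ->
    (((a * t `^ s) `^ p * (r *+ 2) ^+ n)%:E <= increment_integral p xi t)%E.
  move=> tt; have t0 : 0 < t by case/andP: tt => /(le_lt_trans t10).
  apply: (@le_trans _ _ (\int[mu]_(x in cube x0 r) (`|f (x + t *: xi) - f x| `^ p)%:E)%E); last first.
    apply: ge0_subset_integral => //.
    exact: measurable_increment_fun.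
  apply: (@le_trans _ _ (\int[mu]_(x in cube x0 r) ((a * t `^ s) `^ p)%:E)%E).
    by rewrite integral_cst// EFinM -muV.
  apply: ge0_le_integral => //.
  + by move=> x _; rewrite lee_fin powR_ge0.
  + exact: measurable_funS (measurable_increment_fun p xi t).
  move=> x hx; rewrite lee_fin ge0_ler_powR ?nnegrE ?(ltW p0)//; last exact: h.
  by rewrite mulr_ge0// powR_ge0.
have sI : `]t1, t2[ `<=` `]0%R, +oo[.
  by move=> t /=; rewrite !in_itv/= andbT => /andP[/(le_lt_trans t10)].
apply: (@le_trans _ _ (\int[leb]_(t in `]t1, t2[) frac_integrand s p xi t)%E); last first.
  apply: ge0_subset_integral => //.
  + exact: measurable_funS (measurable_frac_integrand_time s p xi).
  + by move=> t _; exact: frac_integrand_ge0.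
apply: (@le_trans _ _ (\int[leb]_(t in `]t1, t2[) (a `^ p * (r *+ 2) ^+ n / t2)%:E)%E).
  rewrite integral_cst//= lebesgue_measure_itv/= lte_fin t12 -EFinB -EFinM lee_fin.
  by rewrite le_eqVlt; apply/orP; left; apply/eqP; ring.
apply: ge0_le_integral => //.
+ by move=> t _; rewrite lee_fin mulr_ge0 ?invr_ge0 ?(ltW t20)// mulr_ge0 ?powR_ge0// ltW.
+ exact: measurable_funS (measurable_frac_integrand_time s p xi).
move=> t; rewrite /= in_itv/= => tt.
have t0 : 0 < t by case/andP: tt => /(le_lt_trans t10).
rewrite /frac_integrand; apply: le_trans (lee_wpmul2l _ (inner t tt)); last by rewrite lee_fin powR_ge0.
rewrite -EFinM lee_fin powRM ?powR_ge0//.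
have -> : t `^ (- (p * s) - 1) * (a `^ p * t `^ s `^ p * (r *+ 2) ^+ n) = a `^ p * (r *+ 2) ^+ n / t.
  rewrite powRD; last by apply/implyP => _; rewrite gt_eqF.
  rewrite powRN powR_inv1 ?(ltW t0)// -powRrM [s * p]mulrC.
  by field; rewrite !gt_eqF ?powR_gt0.
rewrite ler_wpM2l// ?mulr_ge0 ?powR_ge0 ?(ltW V0)// lef_pV2 ?posrE//.
by case/andP: tt => _ /ltW.
Qed.

Lemma frac_polar_gauge_lower_bound s : 0 < s < 1 ->
  exists2 c, 0 < c & exists p1, forall p xi, p1 <= p -> enorm xi = 1 ->
    (c%:E <= frac_polar_gauge s p f xi)%E.
Proof.
move=> /andP[s0 s1]; have [x0 [a [r [T [a0 r0 T0 far]]]]] := far_difference_abs.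
have V0 : 0 < (r *+ 2) ^+ n by rewrite exprn_gt0// mulrn_wgt0.
have T1 : 0 < T + 1 by rewrite addr_gt0.
(* With this b, b t^s <= a for all t between T and T + 1. *)
pose b := a / (T + 1) `^ s; have b0 : 0 < b by rewrite divr_gt0// powR_gt0.
pose m := (r *+ 2) ^+ n * ((T + 1 - T) / (T + 1)).
have m0 : 0 < m by rewrite /m addrAC subrr add0r mulr_gt0// divr_gt0.
exists (b `^ s^-1); first by rewrite powR_gt0.
have s1' : 0 < 1 - s by rewrite subr_gt0.
(* Beyond this threshold p (1 - s) m >= 1, so the normalized energy is at least b^p and its root at
   least b^(1/s). *)
exists (Num.max 1 ((m * (1 - s))^-1)) => p xi; rewrite ge_max => /andP[p1 pm] xi1.
have p0 : 0 < p by exact: lt_le_trans p1.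
have lb : ((b `^ p * m)%:E <= frac_energy s p xi)%E.
  apply: (@frac_energy_lower_bound _ _ _ _ _ _ x0) => //; rewrite ?(ltW b0) ?(ltW T0) ?ltrDl ?ltr01//.
  move=> t x /andP[Tt tT] hx; apply: le_trans (far xi x t xi1 hx (ltW Tt)).
  rewrite /b mulrAC ler_pdivrMr ?powR_gt0// ler_wpM2l ?(ltW a0)//.
  by rewrite ge0_ler_powR ?nnegrE ?(ltW s0) ?(ltW T1) ?(ltW tT)// (le_trans (ltW T0))// ltW.
rewrite frac_polar_gaugeE.
have ps0 : 0 < p * s by rewrite mulr_gt0.
have -> : (b `^ s^-1)%:E = ((b `^ p)%:E `^ (p * s)^-1)%E.
  by rewrite poweR_EFin -powRrM; congr (_ `^ _)%:E; field; rewrite !gt_eqF.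
apply: gt0_ler_poweR; rewrite ?invr_ge0 ?(ltW ps0)//.
- by rewrite in_itv/= leey andbT lee_fin powR_ge0.
- by rewrite in_itv/= leey andbT mule_ge0 ?frac_energy_ge0// lee_fin mulr_ge0// ltW.
apply: le_trans (lee_wpmul2l _ lb); last by rewrite lee_fin mulr_ge0 ?(ltW p0)// ltW.
rewrite -EFinM lee_fin mulrCA -[leLHS]mulr1 ler_wpM2l ?powR_ge0//.
have ms0 : 0 < m * (1 - s) by rewrite mulr_gt0.
rewrite -div1r ler_pdivrMr// in pm.
by rewrite (_ : p * (1 - s) * m = p * (m * (1 - s)))//; ring.
Qed.

(** All but one power of the increment is bounded by b; the remaining one integrates to at most
    twice the L^1 norm of f, by translation invariance. *)
Lemma increment_integral_le_pow xi t p b : 1 <= p -> 0 <= b ->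
  (forall x, `|f (x + t *: xi) - f x| <= b) ->
  (increment_integral p xi t <= (b `^ (p - 1) * (2 * \int[mu]_x `|f x|))%:E)%E.
Proof.
move=> p1 b0 hb.
have p0 : p != 0 by rewrite gt_eqF// (lt_le_trans _ p1).
have intn := integrable_norm intf.
have ms : measurable_fun setT (fun x : 'rV[R]_n => `|f (x + t *: xi)|).
  by apply: measurableT_comp => //; exact: (measurableT_comp mf (measurable_addv (t *: xi))).
have mn : measurable_fun setT (fun x : 'rV[R]_n => `|f x|) by exact: measurableT_comp.
have E1 : (\int[mu]_x `|f x|%:E = (\int[mu]_x `|f x|)%:E)%E.
  by rewrite fineK//; exact: (integrable_fin_num measurableT intn).
have E2 : (\int[mu]_x `|f (x + t *: xi)|%:E = (\int[mu]_x `|f x|)%:E)%E.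
  by rewrite -E1 (@ge0_integral_shift _ _ (t *: xi) (fun x => `|f x|%:E))//; exact/measurable_EFinP.
apply: (@le_trans _ _ (\int[mu]_x ((b `^ (p - 1))%:E * (`|f (x + t *: xi)|%:E + `|f x|%:E)))%E).
  apply: ge0_le_integral => //.
  - exact: measurable_increment_fun.
  - apply/measurable_funeM/emeasurable_funD; exact/measurable_EFinP.
  move=> x _; rewrite -EFinD -EFinM lee_fin.
  have -> : `|f (x + t *: xi) - f x| `^ p =
      `|f (x + t *: xi) - f x| `^ (p - 1) * `|f (x + t *: xi) - f x| `^ 1.
    by rewrite -powRD ?subrK//; apply/implyP; rewrite (negbTE p0).
  rewrite powRr1// ler_pM ?powR_ge0//; last exact: ler_normB.
  by rewrite ge0_ler_powR ?subr_ge0// nnegrE.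
rewrite ge0_integralZl_EFin//; last 3 first.
- by move=> x _; rewrite adde_ge0 ?lee_fin.
- by apply: emeasurable_funD; exact/measurable_EFinP.
- exact: powR_ge0.
rewrite ge0_integralD//; try exact/measurable_EFinP.
by rewrite E1 E2 -EFinD -EFinM lee_fin; rewrite le_eqVlt; apply/orP; left; apply/eqP; ring.
Qed.

(* |D_t f| <= L t controls the integrand near t = 0 and |D_t f| <= B at
   infinity; both regimes are compared with 1 / (1 + t^2). *)
Lemma frac_energy_lty s p xi : 0 < s < 1 -> enorm xi = 1 ->
  1 <= p -> 2 <= p * (1 - s) -> 1 <= p * s -> (frac_energy s p xi < +oo)%E.
Proof.
move=> /andP[s0 s1] xi1 p1 ps1 ps.
have [L L0 hL] := difference_lipschitz; have [B B0 hB] := difference_bounded.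
pose N1 := 2 * \int[mu]_x `|f x|.
have N10 : 0 <= N1 by rewrite mulr_ge0// Rintegral_ge0.
(* The factor 2 covers both regimes: 1 + t^2 <= 2 for t <= 1, and 1 + t^2 <= 2 t^2 for t > 1. *)
pose C := (L `^ (p - 1) + B `^ (p - 1)) * N1 * 2.
have C0 : 0 <= C.
  rewrite /C; apply: mulr_ge0 => //; apply: mulr_ge0 => //.
  by apply: addr_ge0; exact: powR_ge0.
have key t : 0 < t -> (frac_integrand s p xi t <= (C * (oneDsqr t)^-1)%:E)%E.
  move=> t0; have D0 : 0 < oneDsqr t by rewrite /oneDsqr ltr_wpDr// sqr_ge0.
  have [t1|t1] := leP t 1.
    have Lt0 : 0 <= L * t by rewrite mulr_ge0// ltW.
    have := increment_integral_le_pow p1 Lt0 (fun x => hL xi x t xi1 (ltW t0)).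
    move=> /(lee_wpmul2l _) h; apply: le_trans (h _ _) _; first by rewrite lee_fin powR_ge0.
    rewrite -EFinM lee_fin powRM ?(ltW L0) ?(ltW t0)// -/N1.
    (* The powers of t add up to p(1-s) - 2, nonnegative by hypothesis, so no singularity remains at
       0. *)
    have -> : t `^ (- (p * s) - 1) * (L `^ (p - 1) * t `^ (p - 1) * N1) =
        L `^ (p - 1) * N1 * t `^ (p * (1 - s) - 2).
      have -> : p * (1 - s) - 2 = (- (p * s) - 1) + (p - 1) by ring.
      by rewrite [X in _ = _ * X]powRD; [ring|apply/implyP => _; rewrite gt_eqF].
    rewrite (@le_trans _ _ (L `^ (p - 1) * N1))//.
      rewrite -[leRHS]mulr1 ler_wpM2l ?(mulr_ge0 (powR_ge0 _ _) N10)//.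
      by rewrite powR_le1 ?(ltW t0)// subr_ge0.
    rewrite /C mulrDl mulrDl mulrDl -[leLHS]addr0 lerD//; last first.
      by rewrite !mulr_ge0 ?powR_ge0 ?Rintegral_ge0// invr_ge0 ltW.
    rewrite -mulrA -[leLHS]mulr1 ler_wpM2l ?(mulr_ge0 (powR_ge0 _ _) N10)//.
    rewrite ler_pdivlMr// mul1r /oneDsqr [leRHS](_ : 2 = 1 + 1)// lerD2l.
    by rewrite expr_le1// ltW.
  have := increment_integral_le_pow p1 (ltW B0) (fun x => hB xi x t).
  move=> /(lee_wpmul2l _) h; apply: le_trans (h _ _) _; first by rewrite lee_fin powR_ge0.
  rewrite -EFinM lee_fin -/N1.
  have h2 : t `^ (- (p * s) - 1) <= (t ^+ 2)^-1.
    have -> : (t ^+ 2)^-1 = t `^ (- 2) by rewrite powRN -powR_mulrn// ltW.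
    by apply: ler_powR; [exact: ltW|lra].
  apply: (@le_trans _ _ ((t ^+ 2)^-1 * (B `^ (p - 1) * N1))).
    by rewrite ler_wpM2r// (mulr_ge0 (powR_ge0 _ _) N10).
  rewrite /C mulrDl mulrDl mulrDl -[leLHS]add0r lerD//.
    by rewrite !mulr_ge0 ?powR_ge0 ?Rintegral_ge0// invr_ge0 ltW.
  rewrite mulrC -mulrA ler_wpM2l ?(mulr_ge0 (powR_ge0 _ _) N10)//.
  rewrite ler_pdivlMr// ler_pdivrMl ?exprn_gt0// /oneDsqr.
  have : 1 <= t ^+ 2 by rewrite exprn_ege1// ltW.
  lra.
have mD : measurable_fun setT (fun t : R => (oneDsqr t)^-1%:E).
  apply/measurable_EFinP; apply: continuous_measurable_fun; exact: continuous_oneDsqrV.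
have D0 (t : R) : 0 <= (oneDsqr t)^-1 by rewrite invr_ge0 /oneDsqr addr_ge0// sqr_ge0.
apply: (@le_lt_trans _ _ (\int[leb]_(t in `]0%R, +oo[) (C%:E * (oneDsqr t)^-1%:E))%E).
  apply: ge0_le_integral => //.
  - by move=> t _; exact: frac_integrand_ge0.
  - exact: measurable_funS (measurable_frac_integrand_time s p xi).
  - by apply: measurable_funeM; exact: measurable_funS mD.
  by move=> t; rewrite /= in_itv/= andbT => t0; rewrite -EFinM; exact: key.
rewrite ge0_integralZl_EFin//; last exact: measurable_funS mD.
apply: lte_mul_pinfty => //.
apply: (@le_lt_trans _ _ (\int[leb]_(t in `[0%R, +oo[) (oneDsqr t)^-1%:E)%E).
  apply: ge0_subset_integral => //.
  - exact: measurable_funS mD.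
  - by move=> t; rewrite /= !in_itv/= !andbT; exact: ltW.
by rewrite integral0y_oneDsqr ltry.
Qed.

(** Passing from p0 to p multiplies the integrand by the (p - p0)-th power of t^(-s) |f(x + t xi) -
    f(x)|, which the Hölder supremum bounds. *)
Lemma frac_energy_interpolation s p p0 xi : 0 < s < 1 -> enorm xi = 1 -> 0 < p0 <= p ->
  (frac_energy s p xi <= (fine (holder_sup s xi) `^ (p - p0))%:E * frac_energy s p0 xi)%E.
Proof.
move=> s01 xi1 /andP[p00 pp].
set K := fine (holder_sup s xi).
have K0 : 0 < K by exact: holder_sup_gt0.
have hK x t : 0 < t -> t `^ (- s) * `|f (x + t *: xi) - f x| <= K.
  move=> t0; rewrite -lee_fin fineK ?holder_sup_ge// ge0_fin_numE ?holder_sup_ge0//.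
  exact: holder_sup_lty.
rewrite /frac_energy -ge0_integralZl_EFin//; last 3 first.
- by move=> t _; exact: frac_integrand_ge0.
- exact: measurable_funS (measurable_frac_integrand_time s p0 xi).
- exact: powR_ge0.
apply: ge0_le_integral => //.
- by move=> t _; exact: frac_integrand_ge0.
- exact: measurable_funS (measurable_frac_integrand_time s p xi).
- apply: measurable_funeM; exact: measurable_funS (measurable_frac_integrand_time s p0 xi).
move=> t; rewrite /= in_itv/= andbT => t0.
rewrite /frac_integrand /increment_integral.
have -> : t `^ (- (p * s) - 1) = t `^ (- (p0 * s) - 1) * t `^ (- s * (p - p0)).
  by rewrite -powRD; [congr (_ `^ _); ring|apply/implyP => _; rewrite gt_eqF].
rewrite [leRHS]muleCA EFinM -[leLHS]muleA.
apply: lee_wpmul2l; first by rewrite lee_fin powR_ge0.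
rewrite -!ge0_integralZl_EFin ?powR_ge0//; try (by move=> x _; rewrite lee_fin powR_ge0);
  try exact: measurable_increment_fun.
apply: ge0_le_integral => //.
- by move=> x _; rewrite -EFinM lee_fin mulr_ge0// powR_ge0.
- apply: measurable_funeM; exact: measurable_increment_fun.
- apply: measurable_funeM; exact: measurable_increment_fun.
move=> x _; rewrite -!EFinM lee_fin.
have [d0|dn0] := eqVneq (`|f (x + t *: xi) - f x|) 0.
  rewrite d0 !powR0 ?mulr0//; first by rewrite gt_eqF.
  by rewrite gt_eqF// (lt_le_trans p00).
have -> : `|f (x + t *: xi) - f x| `^ p =
    `|f (x + t *: xi) - f x| `^ (p - p0) * `|f (x + t *: xi) - f x| `^ p0.
  by rewrite -powRD ?subrK//; apply/implyP.
rewrite mulrA ler_wpM2r ?powR_ge0// powRrM -powRM ?powR_ge0//.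
rewrite ge0_ler_powR ?subr_ge0// ?nnegrE ?(ltW K0)//; last exact: hK.
by rewrite mulr_ge0// powR_ge0.
Qed.

(** ln y = 2 ln(sqrt y) <= 2 sqrt y, and sqrt(p c) / p tends to 0; the threshold 4c / e^2 is 2
    sqrt(p c) <= e p, squared. *)
Lemma ln_div_cvg (c : R) : 0 < c -> ln (p * c) / p @[p --> +oo] --> (0 : R).
Proof.
move=> c0; apply/cvgr0Pnorm_le => e e0; near=> p.
have p0 : 0 < p by near: p; apply: nbhs_pinfty_gt; exact: num_real.
have pc1 : 1 <= p * c.
  by rewrite -ler_pdivrMr//; near: p; apply: nbhs_pinfty_ge; exact: num_real.
have pe : 4 * c / e ^+ 2 <= p by near: p; apply: nbhs_pinfty_ge; exact: num_real.
have pc0 : 0 < p * c by rewrite mulr_gt0.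
rewrite ger0_norm; last by rewrite divr_ge0 ?ln_ge0// ltW.
rewrite ler_pdivrMr//.
have h1 : ln (p * c) <= 2 * Num.sqrt (p * c).
  have -> : ln (p * c) = 2 * ln (Num.sqrt (p * c)).
    by rewrite -{1}(sqr_sqrtr (ltW pc0)) lnXn ?sqrtr_gt0// mulr_natl.
  by rewrite ler_pM2l// ltW// ln_sublinear// sqrtr_gt0.
apply: le_trans h1 _.
rewrite -ler_sqr ?nnegrE ?mulr_ge0 ?sqrtr_ge0 ?(ltW e0) ?(ltW p0)//.
rewrite !exprMn sqr_sqrtr ?(ltW pc0)//.
rewrite ler_pdivrMr ?exprn_gt0// in pe.
have := ler_wpM2r (ltW p0) pe; lra.
Unshelve. all: by end_near. Qed.

Lemma frac_polar_gauge_cvg s xi : 0 < s < 1 -> enorm xi = 1 ->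
  frac_polar_gauge s p f xi @[p --> +oo] --> frac_polar_gauge_oo s f xi.
Proof.
move=> s01 xi1; have /andP[s0 s1] := s01.
have s1' : 0 < 1 - s by rewrite subr_gt0.
set K := fine (holder_sup s xi).
have K0 : 0 < K by exact: holder_sup_gt0.
have KE : holder_sup s xi = K%:E.
  by rewrite fineK// ge0_fin_numE ?holder_sup_ge0// holder_sup_lty.
rewrite frac_polar_gauge_ooE KE poweR_EFin.
(* The least exponent meeting the three requirements of [frac_energy_lty]. *)
pose p0 := Num.max (2 / (1 - s)) (Num.max s^-1 1).
have p01 : 1 <= p0 by rewrite /p0 !le_max lexx !orbT.
have p0_gt0 : 0 < p0 by exact: lt_le_trans p01.
have fin0 : (frac_energy s p0 xi < +oo)%E.
  apply: frac_energy_lty => //.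
    by rewrite -ler_pdivrMr// /p0 le_max lexx.
  by rewrite -ler_pdivrMr// div1r /p0 !le_max lexx orbT.
pose I0 := fine (frac_energy s p0 xi) + 1.
have I00 : 0 < I0 by rewrite ltr_wpDl// fine_ge0// frac_energy_ge0.
apply: (@cvg_root _ (fun p => ((p * (1 - s))%:E * frac_energy s p xi)%E)
  (fun p => p * (1 - s)) K p0 I0 s) => //.
- by move=> p pp0; rewrite mulr_gt0// (lt_le_trans p0_gt0).
- exact: ln_div_cvg.
- move=> p pp0; have p_gt0 : 0 < p by exact: lt_le_trans pp0.
  rewrite [leRHS]EFinM; apply: lee_wpmul2l; first by rewrite lee_fin mulr_ge0// ltW.
  apply: le_trans (frac_energy_interpolation s01 xi1 (_ : 0 < p0 <= p)) _; first by rewrite p0_gt0.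
  rewrite EFinM; apply: lee_wpmul2l; first by rewrite lee_fin powR_ge0.
  rewrite -(fineK (_ : frac_energy s p0 xi \is a fin_num)) ?lee_fin ?lerDl//.
  by rewrite ge0_fin_numE ?frac_energy_ge0.
move=> a /andP[a0 aK].
have [x1 [t1 [t10 at1]]] : exists x1 t1, 0 < t1 /\ a < t1 `^ (- s) * `|f (x1 + t1 *: xi) - f x1|.
  apply: contrapT => hn.
  have : (holder_sup s xi <= a%:E)%E.
    apply: holder_sup_le => x t t0; rewrite lee_fin leNgt; apply/negP => h.
    by apply: hn; exists x, t.
  by rewrite KE lee_fin leNgt aK.
have [L L0 hL] := lipschitz_const lipf.
have [L' L'0 hL'] := lipschitz_sup_norm lipf.
set d := `|f (x1 + t1 *: xi) - f x1| in at1.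
have ad : a * t1 `^ s < d.
  by move: at1; rewrite powRN mulrC ltr_pdivlMr// powR_gt0.
(* A quarter of the gap: moving x1 to x and t1 to t changes the increment by at most three terms of
   size e. *)
pose e := (d - a * t1 `^ s) / 4.
have e0 : 0 < e by rewrite divr_gt0// subr_gt0.
pose r := e / L'; have r0 : 0 < r by rewrite divr_gt0.
(* Only times below t1 are used, so that a t^s <= a t1^s holds without further loss. *)
pose t0 := Num.max 0 (t1 - e / L).
have t01 : 0 <= t0 < t1 by rewrite /t0 le_max lexx/= gt_max t10 ltrBlDr ltrDl divr_gt0.
have lb t x : t0 < t < t1 -> cube x1 r x -> a * t `^ s <= `|f (x + t *: xi) - f x|.
  move=> /andP[t0t tt1] hx.
  have t_gt0 : 0 < t by move: t0t; rewrite /t0 gt_max => /andP[].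
  have tL : t1 - t <= e / L.
    by move: t0t; rewrite /t0 gt_max => /andP[_]; rewrite ltrBlDr -ltrBlDl => /ltW.
  have xr : `|x - x1| <= r by exact: cube_norm.
  have h1 : `|f x - f x1| <= e.
    by rewrite (le_trans (hL' _ _))// mulrC -ler_pdivlMr.
  have h2 : `|f (x + t *: xi) - f (x1 + t *: xi)| <= e.
    rewrite (le_trans (hL' _ _))// mulrC -ler_pdivlMr//.
    by rewrite opprD addrACA subrr addr0.
  have h3 : `|f (x1 + t *: xi) - f (x1 + t1 *: xi)| <= e.
    rewrite (le_trans (hL _ _))// mulrC -ler_pdivlMr// opprD addrACA subrr add0r.
    by rewrite -scalerBl enormZ xi1 mulr1 distrC ger0_norm ?subr_ge0// ltW.
  have h4 : a * t `^ s <= a * t1 `^ s.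
    rewrite ler_wpM2l ?(ltW a0)// ge0_ler_powR ?nnegrE ?(ltW s0)// ltW//.
  have h5 : d <= `|f (x + t *: xi) - f x| + `|f x - f x1| +
      (`|f (x + t *: xi) - f (x1 + t *: xi)| + `|f (x1 + t *: xi) - f (x1 + t1 *: xi)|).
    rewrite /d.
    have -> : f (x1 + t1 *: xi) - f x1 = (f (x + t *: xi) - f x) + (f x - f x1) +
        (- (f (x + t *: xi) - f (x1 + t *: xi)) - (f (x1 + t *: xi) - f (x1 + t1 *: xi))) by ring.
    rewrite (le_trans (ler_normD _ _))// lerD ?ler_normD//.
    by rewrite (le_trans (ler_normB _ _))// normrN.
  have h6 : d - a * t1 `^ s = 4 * e by rewrite /e; field.
  lra.
have V0 : 0 < (r *+ 2) ^+ n by rewrite exprn_gt0// mulrn_wgt0.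
exists ((r *+ 2) ^+ n * ((t1 - t0) / t1)).
  by rewrite mulr_gt0// divr_gt0// subr_gt0; case/andP: t01.
move=> p pp0; have p_gt0 : 0 < p by exact: lt_le_trans pp0.
rewrite [leLHS]EFinM; apply: lee_wpmul2l; first by rewrite lee_fin mulr_ge0// ltW.
exact: (frac_energy_lower_bound (ltW a0) p_gt0 t01 r0 lb).
Qed.

Lemma frac_polar_gauge_lty s : 0 < s < 1 -> exists p1, forall p xi, p1 <= p ->
  enorm xi = 1 -> (frac_polar_gauge s p f xi < +oo)%E.
Proof.
move=> s01; have /andP[s0 s1] := s01; have s1' : 0 < 1 - s by rewrite subr_gt0.
exists (Num.max (2 / (1 - s)) (Num.max s^-1 1)) => p xi.
rewrite !ge_max => /and3P[h1 h2 h3] xi1.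
rewrite frac_polar_gaugeE poweR_lty// lte_mul_pinfty//.
  by rewrite lee_fin mulr_ge0 ?(ltW s1')// (le_trans ler01).
apply: frac_energy_lty => //; first by rewrite -ler_pdivrMr.
by rewrite -ler_pdivrMr// div1r.
Qed.

End frac_polar_gauge_limit.

(** * The limit of the Hölder gauges as s tends to 1 *)

Section frac_polar_gauge_oo_limit.
Context {R : realType} {n : nat} (f : 'rV[R]_n -> R).
Local Notation mu := (@lebesgue_rV R n).
Hypothesis n_gt0 : (0 < n)%N.
Hypothesis intf : mu.-integrable setT (EFin \o f).
Hypothesis wG : is_weak_gradient f (weak_gradient f).
Hypothesis intG : forall i, mu.-integrable setT (EFin \o (fun x => weak_gradient f x ord0 i)).
Hypothesis lipf : euclidean_lipschitz f.
Hypothesis f_neq0 : exists x, f x != 0.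

Lemma frac_polar_gauge_oo_fin s xi : 0 < s < 1 -> enorm xi = 1 ->
  frac_polar_gauge_oo s f xi = (fine (holder_sup f s xi) `^ s^-1)%:E.
Proof.
move=> s01 xi1; rewrite frac_polar_gauge_ooE -poweR_EFin fineK//.
by rewrite ge0_fin_numE ?holder_sup_ge0// (holder_sup_lty intf lipf).
Qed.

(** The logarithm of the Hölder supremum lies between ln a + (1-s) ln t1 and ln M + (1-s) ln T,
    where a is any slope below M exceeded by an increment at time t1; the terms in 1 - s vanish. *)
Lemma frac_polar_gauge_oo_cvg xi : enorm xi = 1 ->
  frac_polar_gauge_oo s f xi @[s --> 1^'-] --> polar_gauge_oo f xi.
Proof.
move=> xi1.
have finM := polar_gauge_oo_fin intf wG intG lipf xi.
set M := fine (polar_gauge_oo f xi).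
have M0 : 0 < M.
  have [c c0 hc] := polar_gauge_lower_bound n_gt0 intf wG intG lipf f_neq0.
  have [_] := hc 1 xi (lexx 1) xi1.
  by rewrite -(fineK finM) lee_fin; exact: lt_le_trans.
have [B B0 hB] := difference_bounded intf lipf.
have hM x t : 0 <= t -> `|f (x + t *: xi) - f x| <= M * t.
  by apply: difference_le_polar_gauge_oo.
pose y s := fine (holder_sup f s xi).
have yE s : 0 < s < 1 -> holder_sup f s xi = (y s)%:E.
  by move=> s01; rewrite fineK// ge0_fin_numE ?holder_sup_ge0// (holder_sup_lty intf lipf).
have y0 s : 0 < s < 1 -> 0 < y s.
  by move=> s01; exact: (holder_sup_gt0 n_gt0 intf lipf f_neq0).
have powE t s : 0 < t -> t `^ (- s) * t = t `^ (1 - s).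
  move=> t0; rewrite -[X in _ * X = _]powRr1 ?(ltW t0)// -powRD ?[- s + 1]addrC//.
  by apply/implyP => _; rewrite gt_eqF.
(* Beyond T the increment is at most B <= M T and t^(-s) <= T^(-s), so all times obey the single
   bound M T^(1-s). *)
pose T := Num.max 1 (B / M).
have T1 : 1 <= T by rewrite le_max lexx.
have T0 : 0 < T by exact: lt_le_trans T1.
have BT : B <= M * T by rewrite -ler_pdivrMl// mulrC le_max lexx orbT.
have yub s : 0 < s < 1 -> y s <= M * T `^ (1 - s).
  move=> s01; have /andP[s0 s1] := s01; rewrite -lee_fin -yE//.
  apply: holder_sup_le => x t t0; rewrite lee_fin.
  have [tT|Tt] := leP t T.
    apply: (@le_trans _ _ (t `^ (- s) * (M * t))).
      by rewrite ler_wpM2l ?powR_ge0// hM// ltW.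
    rewrite mulrCA powE// ler_wpM2l ?(ltW M0)//.
    by rewrite ge0_ler_powR ?subr_ge0 ?(ltW s1)// nnegrE ltW.
  apply: (@le_trans _ _ (T `^ (- s) * (M * T))); last by rewrite mulrCA powE.
  rewrite ler_pM ?powR_ge0//; last exact: le_trans (hB _ _ _) BT.
  rewrite !powRN lef_pV2 ?posrE ?powR_gt0//.
  by rewrite ge0_ler_powR ?nnegrE ?(ltW s0)// ltW.
have lny : ln (y s) @[s --> 1^'-] --> ln M.
  apply/cvgrPdist_le => e e0; have e2 : 0 < e / 2 by rewrite divr_gt0.
  pose a := M * expR (- (e / 2)).
  have a0 : 0 < a by rewrite mulr_gt0// expR_gt0.
  have aM : a < M by rewrite /a gtr_pMr// expR_lt1 oppr_lt0.
  have lna : ln a = ln M - e / 2 by rewrite /a lnM ?posrE ?expR_gt0// expRK.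
  have [x1 [t1 [t10 at1]]] : exists x1 t1, 0 < t1 /\ a * t1 < `|f (x1 + t1 *: xi) - f x1|.
    apply: contrapT => hn.
    have : (polar_gauge_oo f xi <= a%:E)%E.
      apply: (polar_gauge_oo_le intf wG intG) => x t t0; rewrite leNgt; apply/negP => h.
      by apply: hn; exists x, t.
    by rewrite -(fineK finM) lee_fin leNgt aM.
  have small (C : R) : \forall s \near 1^'-, `|(1 - s) * C| <= e / 2.
    near=> s.
    have s1 : s <= 1 by near: s; exact: nbhs_left_le.
    rewrite normrM ger0_norm ?subr_ge0//.
    apply: (@le_trans _ _ (e / 2 / (`|C| + 1) * (`|C| + 1))).
      rewrite ler_pM ?subr_ge0 ?lerDl// lerBlDr -lerBlDl.
      near: s; apply: filterS (nbhs_left_gt (_ : 1 - e / 2 / (`|C| + 1) < 1)).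
        by move=> z; exact: ltW.
      by rewrite ltrBlDr ltrDl divr_gt0// ltr_wpDl.
    by rewrite divfK// gt_eqF// ltr_wpDl.
  near=> s.
  have s01 : 0 < s < 1.
    by apply/andP; split; near: s; [exact: nbhs_left_gt|exact: nbhs_left_lt].
  have h1 : `|(1 - s) * ln T| <= e / 2 by near: s.
  have h2 : `|(1 - s) * ln t1| <= e / 2 by near: s.
  have u1 : ln (y s) <= ln M + (1 - s) * ln T.
    rewrite -ln_powR -lnM ?posrE ?powR_gt0// ler_ln ?posrE ?mulr_gt0 ?powR_gt0 ?y0//.
    exact: yub.
  have u2 : ln a + (1 - s) * ln t1 <= ln (y s).
    rewrite -ln_powR -lnM ?posrE ?powR_gt0// ler_ln ?posrE ?mulr_gt0 ?powR_gt0 ?expR_gt0 ?y0//.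
    rewrite -lee_fin -yE//; apply: le_trans (holder_sup_ge f s xi x1 t10).
    by rewrite lee_fin -powE// mulrCA ler_wpM2l ?powR_ge0// ltW.
  rewrite lna in u2; rewrite !ler_norml in h1 h2; rewrite ler_norml; lra.
have E s : 0 < s < 1 -> frac_polar_gauge_oo s f xi = (expR (s^-1 * ln (y s)))%:E.
  by move=> s01; rewrite frac_polar_gauge_oo_fin// /powR gt_eqF// y0.
have -> : polar_gauge_oo f xi = (expR (1^-1 * ln M))%:E.
  by rewrite invr1 mul1r lnK ?posrE// fineK.
apply: (@cvg_trans _ ((expR (s^-1 * ln (y s)))%:E @[s --> 1^'-])).
  apply: near_eq_cvg; near=> s; apply/esym/E.
  by apply/andP; split; near: s; [exact: nbhs_left_gt|exact: nbhs_left_lt].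
apply: cvg_EFin; first exact: nearW.
apply: (@cvg_comp _ _ _ _ expR) ; last exact: continuous_expR.
apply: cvgM => //; apply: cvgV => //.
exact: cvg_at_left_filter cvg_id.
Unshelve. all: by end_near. Qed.

Lemma frac_polar_gauge_oo_lower_bound : exists2 c, 0 < c &
  forall s xi, 2^-1 <= s < 1 -> enorm xi = 1 -> (c%:E <= frac_polar_gauge_oo s f xi)%E.
Proof.
have [x0 [a [r [T [a0 r0 T0 far]]]]] := far_difference_abs n_gt0 intf lipf f_neq0.
have x0c : cube x0 r x0 by move=> i; rewrite /= in_itv/= ltrBlDr ltrDl r0.
pose b := Num.min 1 a; have b0 : 0 < b by rewrite lt_min ltr01.
(* The root of T^(-s) b is T^-1 b^(1/s). Since b <= 1 and s >= 1/2, b^(1/s) >= b^2; this is why s is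
   kept away from 0. *)
exists (T^-1 * b `^ 2); first by rewrite mulr_gt0 ?invr_gt0 ?powR_gt0.
move=> s xi /andP[s2 s1] xi1.
have s0 : 0 < s by exact: lt_le_trans s2.
have s01 : 0 < s < 1 by rewrite s0.
rewrite frac_polar_gauge_oo_fin// lee_fin.
have lb : T `^ (- s) * b <= fine (holder_sup f s xi).
  rewrite -lee_fin fineK; last by rewrite ge0_fin_numE ?holder_sup_ge0// (holder_sup_lty intf lipf).
  apply: le_trans (holder_sup_ge f s xi x0 T0).
  rewrite lee_fin ler_wpM2l ?powR_ge0// (le_trans _ (far xi x0 T xi1 x0c (lexx T)))//.
  by rewrite ge_min lexx orbT.
have lb0 : 0 <= T `^ (- s) * b by rewrite mulr_ge0 ?powR_ge0// ltW.
apply: (@le_trans _ _ ((T `^ (- s) * b) `^ s^-1)); last first.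
  by rewrite ge0_ler_powR ?invr_ge0 ?(ltW s0)// nnegrE// (le_trans lb0).
rewrite powRM ?powR_ge0 ?(ltW b0)// -powRrM mulNr divff ?gt_eqF// powR_inv1 ?(ltW T0)//.
rewrite ler_wpM2l ?invr_ge0 ?(ltW T0)// ger_powR ?b0 ?ge_min ?lexx//.
by rewrite invf_ple ?posrE.
Qed.

Lemma measurable_frac_polar_gauge_oo s : 0 < s < 1 ->
  measurable_fun esphere (frac_polar_gauge_oo s f).
Proof.
move=> s01.
(* The supremum over uncountably many (x, t) is measurable as the limit of the
   gauges of finite order. *)
apply: (emeasurable_fun_cvg (fun k : nat => frac_polar_gauge s k%:R f)).
  by move=> k; apply: measurable_funS (measurable_frac_polar_gauge intf s k%:R).
move=> xi xi1; have := frac_polar_gauge_cvg n_gt0 intf lipf f_neq0 s01 xi1.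
exact: (cvg_comp _ _ cvgr_idn).
Qed.

End frac_polar_gauge_oo_limit.

(** * Convergence of the volumes *)

Unset Implicit Arguments.

Theorem theorem4p1 (R : realType) (n : nat) (n_gt0 : (0 < n)%N)
    (f : 'rV[R]_n -> R)
    (f_W11 : W1 1%E f) (f_W1oo : W1 +oo%E f)
    (f_lip : euclidean_lipschitz f)
    (f_neq0 : exists x, f x != 0) :
  [/\ forall s : R, 0 < s < 1 ->
        volume (frac_polar_body s p f) @[p --> +oo]
          --> volume (frac_polar_body_oo s f),
      volume (polar_body p f) @[p --> +oo] --> volume (polar_body_oo f)
    & volume (frac_polar_body_oo s f) @[s --> 1^'-]
        --> volume (polar_body_oo f)].
Proof.
have [intf wG intG] := W11_integrable f_W11.
have mS := @measurable_esphere R n.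
split.
- move=> s s01.
  have [c c0 [p1 hp1]] := frac_polar_gauge_lower_bound n_gt0 intf f_lip f_neq0 s01.
  have [p2 hp2] := frac_polar_gauge_lty intf f_lip s01.
  apply: (@cvg_pinfty_seq _ _ _ _ (Num.max 1 (Num.max p1 p2))) => u hu uoo.
  have u1 k : [/\ 1 <= u k, p1 <= u k & p2 <= u k].
    by have := hu k; rewrite !ge_max => /and3P[].
  apply: (@volume_cvg _ _ (fun k => frac_polar_gauge s (u k) f) _ c c0).
  + move=> k; have [h _ _] := u1 k; apply: homogeneous_frac_polar_gauge => //.
    exact: lt_le_trans h.
  + by apply: homogeneous_frac_polar_gauge_oo; case/andP: s01.
  + by move=> k; apply: measurable_funS (measurable_frac_polar_gauge intf s (u k)).
  + move=> k xi xi1; have [_ h1 h2] := u1 k; apply/andP; split; first exact: hp1.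
    exact: hp2.
  + by move=> xi xi1; rewrite (frac_polar_gauge_oo_fin intf f_lip).
  + move=> xi xi1; have := frac_polar_gauge_cvg n_gt0 intf f_lip f_neq0 s01 xi1.
    exact: (cvg_comp _ _ uoo).
- have [c c0 hc] := polar_gauge_lower_bound n_gt0 intf wG intG f_lip f_neq0.
  apply: (@cvg_pinfty_seq _ _ _ _ 1) => u u1 uoo.
  apply: (@volume_cvg _ _ (fun k => polar_gauge (u k) f) _ c c0).
  + move=> k; apply: (homogeneous_polar_gauge intG).
    exact: lt_le_trans (u1 k).
  + exact: homogeneous_polar_gauge_oo.
  + by move=> k; apply: measurable_funS (measurable_polar_gauge intG (u k)).
  + move=> k xi xi1; have [h _] := hc (u k) xi (u1 k) xi1; rewrite h/=.
    exact: (polar_gauge_lty intf wG intG f_lip).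
  + by move=> xi _; exact: (polar_gauge_oo_fin intf wG intG f_lip).
  + move=> xi xi1; have := polar_gauge_cvg n_gt0 intf wG intG f_lip f_neq0 xi1.
    exact: (cvg_comp _ _ uoo).
- have [c c0 hc] := frac_polar_gauge_oo_lower_bound n_gt0 intf f_lip f_neq0.
  apply: (@cvg_at_left_seq _ _ _ _ _ 2^-1) => [|u u1 u1cvg].
    by rewrite invf_lt1// ltr1n.
  have u01 k : 0 < u k < 1.
    by have /andP[h1 ->] := u1 k; rewrite andbT; apply: lt_le_trans h1.
  apply: (@volume_cvg _ _ (fun k => frac_polar_gauge_oo (u k) f) _ c c0).
  + by move=> k; apply: homogeneous_frac_polar_gauge_oo; case/andP: (u01 k).
  + exact: homogeneous_polar_gauge_oo.
  + by move=> k; apply: (measurable_frac_polar_gauge_oo n_gt0 intf f_lip f_neq0).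
  + by move=> k xi xi1; rewrite hc//= (frac_polar_gauge_oo_fin intf f_lip)// ltry.
  + by move=> xi _; exact: (polar_gauge_oo_fin intf wG intG f_lip).
  + move=> xi xi1.
    have := frac_polar_gauge_oo_cvg n_gt0 intf wG intG f_lip f_neq0 xi1.
    apply: cvg_comp => A hA.
    (* A left neighbourhood of 1 is a neighbourhood of 1 restricted to s < 1, a restriction that
       every term of the sequence satisfies. *)
    have uA : \forall k \near \oo, u k < 1 -> A (u k) by exact: u1cvg hA.
    by apply: filterS uA => k; apply; case/andP: (u01 k).
Qed.
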